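(* Let $W_1$ and $W_2$ be two doubly periodic weaves in $\mathbb{E}^2\times I$ with weaving diagrams $D_{\infty,1}$ and $D_{\infty,2}$. Let $\Lambda_1\subset\Lambda_2$ be two non-equivalent point lattices such that, for $i\in\{1,2\}$, the quotient $D_{W_i}$ of $D_{\infty,i}$ by $\Lambda_i$ is a weaving motif of $W_i$. Then $W_1$ and $W_2$ are equivalent if the following two conditions are satisfied: (i) $D_{W_1}$ and $D_{W_2}$ are scale-equivalent, through a weaving motif $D'_{W_1}$ containing $D_{W_1}$ which is made of adjacent copies of $D_{W_1}$ and is the quotient of $D_{\infty,1}$ by $\Lambda_2$; (ii) $D'_{W_1}$ and $D_{W_2}$ are related by a finite sequence of Reidemeister moves $R_1$, $R_2$, $R_3$, torus isotopies and Dehn twists.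
   Context: Let $I=[-1,1]$. For a basis $u,v$ of $\mathbb{E}^2$, $\Lambda(u,v)=\{xu+yv:x,y\in\mathbb{Z}\}$ is a point lattice, with quotient torus $T^2=\mathbb{E}^2/\Lambda(u,v)$ and covering maps $\mathbb{E}^2\to T^2$, $\mathbb{E}^2\times I\to T^2\times I$. Lattices $\Lambda(u,v)$, $\Lambda'(u',v')$ are equivalent iff their bases are related by an integer matrix of determinant $\pm1$. Inclusion convention: $\Lambda\subset\Lambda'$ means that a unit cell of $\Lambda'$ is tiled by unit cells of $\Lambda$ (e.g. $u'=k_uu$, $v'=k_vv$ with $k_u,k_v$ positive integers), i.e. periodicity under $\Lambda$ implies periodicity under $\Lambda'$. An essential closed curve component of a link in $T^2\times I$ lifts to infinite open curves in $\mathbb{E}^2\times I$ called threads; a thread is unknotted if its projection to $\mathbb{E}^2$ has no self-crossing. Two components are parallel if they are homotopic to the same $(p,q)$-torus knot. Let $W\subset T^2\times I$ be a link such that each component $t_i$ is homotopic to a $(p_i,q_i)$-torus knot with $p_i,q_i$ coprime, each component lifts to an unknotted thread, and $W$ contains at least two non-parallel components. The lift of $W$ to $\mathbb{E}^2\times I$ is a doubly periodic weave; the lift $D_\infty$ to $\mathbb{E}^2$ of the diagram $D_W$ of $W$ on $T^2$ is a doubly periodic weaving diagram; and $D_W$, the quotient of $D_\infty$ by the lattice, is a weaving motif. Scale-equivalence: for $\Lambda_1\subset\Lambda_2$, a motif for $\Lambda_1$ and a motif for $\Lambda_2$ are scale-equivalent if there is a motif for $\Lambda_2$ defined by adjacent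 copies of the motif for $\Lambda_1$, which is the quotient by $\Lambda_2$ of the same infinite diagram. Two doubly periodic weaves are equivalent if they are ambient isotopic in the thickened plane $\mathbb{E}^2\times I$.
   Formalization: Links in T²×I are taken to lie in the open part T²×(-1,1); without this the claim fails, since an ambient isotopy of E²×I preserves the boundary, so a weave touching it is not equivalent to one with the same diagram that does not. *)

(* Defs.v *)
From HB Require Import structures.
From mathcomp Require Import all_boot all_order all_algebra.
From mathcomp Require Import all_classical all_reals all_analysis.
From Stdlib Require Import Relation_Operators.

Set Implicit Arguments.
Unset Strict Implicit.
Unset Printing Implicit Defensive.

Import Order.TTheory GRing.Theory Num.Theory.
Import numFieldNormedType.Exports.

Local Open Scope classical_set_scope.
Local Open Scope ring_scope.
Local Open Scope quotient_scope.

Notation plane R := (R * R)%type.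

(** * Point lattices and their tori *)

Record lattice (R : realType) := Lattice {
  bu : plane R;
  bv : plane R;
  lattice_basis : forall a b : R,
    a * bu.1 + b * bv.1 = 0 -> a * bu.2 + b * bv.2 = 0 -> a = 0 /\ b = 0 }.

Definition lattice_pt (R : realType) (L : lattice R) : set (plane R) :=
  [set w | exists x y : int, w = bu L *~ x + bv L *~ y].

Definition lattice_equiv (R : realType) (L L' : lattice R) : Prop :=
  exists M : 'M[int]_2, (\det M = 1 \/ \det M = -1) /\
    bu L' = bu L *~ M ord0 ord0 + bv L *~ M ord0 ord_max /\
    bv L' = bu L *~ M ord_max ord0 + bv L *~ M ord_max ord_max.

(* The inclusion of lattices follows the unit cells and is opposite to the
   inclusion of point sets: a cell of L' is tiled by cells of L, so that
   L-periodicity implies L'-periodicity. *)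
Definition sublattice (R : realType) (L L' : lattice R) : Prop :=
  lattice_pt L' `<=` lattice_pt L.

Section Torus.
Context {R : realType} (L : lattice R).

Definition lattice_rel (x y : plane R) : bool := `[< lattice_pt L (x - y) >].

Lemma lattice_rel_refl : reflexive lattice_rel.
Proof. by move=> x; apply/asboolP; exists 0, 0; rewrite subrr !mulr0z addr0. Qed.

Lemma lattice_rel_sym : symmetric lattice_rel.
Proof.
suff S x y : lattice_rel x y -> lattice_rel y x by move=> x y; apply/idP/idP; exact: S.
move=> /asboolP[a [b e]]; apply/asboolP; exists (- a), (- b).
by rewrite !mulrNz -opprD -e opprB.
Qed.

Lemma lattice_rel_trans : transitive lattice_rel.
Proof.
move=> y x z /asboolP[a [b e]] /asboolP[c [d f]]; apply/asboolP.
exists (a + c), (b + d); rewrite !mulrzDr addrACA -e -f.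
by rewrite addrA subrK.
Qed.

Definition lattice_equiv_rel :=
  EquivRel lattice_rel lattice_rel_refl lattice_rel_sym lattice_rel_trans.

Definition torus : Type :=
  quotient_topology {eq_quot lattice_equiv_rel}.
HB.instance Definition _ := Topological.on torus.
HB.instance Definition _ := Quotient.on torus.

Definition torus_cover (x : plane R) : torus := \pi_torus x.

End Torus.

(** * Isotopies *)

Section Isotopy.
Context {R : realType} {X : topologicalType}.

Definition homeo_on (A : set X) (f : X -> X) : Prop :=
  {within A, continuous f} /\ (forall x, A x -> A (f x)) /\
  exists g : X -> X, {within A, continuous g} /\ (forall x, A x -> A (g x)) /\
    forall x, A x -> g (f x) = x /\ f (g x) = x.

Definition ambient_isotopy (A : set X) (H : R -> X -> X) : Prop :=
  {within `[0, 1]%classic `*` A, continuous (fun p : R * X => H p.1 p.2)} /\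
  (forall t, 0 <= t <= 1 -> homeo_on A (H t)) /\
  (forall x, A x -> H 0 x = x).

Definition ambient_isotopic (A B B' : set X) : Prop :=
  exists H, ambient_isotopy A H /\ H 1 @` B = B'.

End Isotopy.

(** * Link diagrams on a surface *)

(* [curve] is the planar projection; in a neighbourhood of each crossing,
   [overstrand] is the over-strand.  The set [overstrand] has no meaning away from
   crossings: diagrams are compared with [same_diagram] below, never with
   Leibniz equality. *)
Record diagram (S : Type) := Diagram { curve : set S; overstrand : set S }.

Definition pullback (S S' : Type) (f : S -> S') (D : diagram S') : diagram S :=
  Diagram (f @^-1` curve D) (f @^-1` overstrand D).

Definition open_embedding (S S' : topologicalType) (f : S -> S') : Prop :=
  injective f /\ continuous f /\ (forall U, open U -> open (f @` U)).

Section Diagrams.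
Context {R : realType} {S : topologicalType}.
Implicit Types (C : set S) (D : diagram S) (K : set (S * R)).

Definition chart_at (x : S) (phi : plane R -> S) : Prop :=
  open_embedding phi /\ phi (0, 0) = x.

Definition simple_point C (x : S) : Prop :=
  exists phi, chart_at x phi /\ phi @^-1` C = [set p | p.2 = 0].

Definition cross : set (plane R) := [set p | p.1 = 0 \/ p.2 = 0].

Definition crossing C (x : S) : Prop :=
  exists phi, chart_at x phi /\ phi @^-1` C = cross.

Definition crossing_with_over D (x : S) : Prop :=
  exists phi, chart_at x phi /\ phi @^-1` curve D = cross /\
    phi @^-1` overstrand D = [set p | p.2 = 0].

Definition agree_near (x : S) D D' : Prop :=
  (\forall y \near x, curve D y <-> curve D' y) /\
  (crossing (curve D) x -> \forall y \near x, overstrand D y <-> overstrand D' y).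

Definition same_diagram D D' : Prop := forall x, agree_near x D D'.

(* K projects regularly to S, with diagram D: finitely many points over each
   point of S (one, or two at a transverse crossing), the over-strand at a
   crossing being the projection of the part of K above an intermediate
   height. *)
Definition diagram_of K D : Prop :=
  curve D = fst @` K /\
  forall x, curve D x ->
    (simple_point (curve D) x /\ exists! z, K (x, z)) \/
    (crossing_with_over D x /\
     exists z1 z2 : R, z1 < z2 /\ (forall z, K (x, z) <-> z = z1 \/ z = z2) /\
       forall m, z1 < m < z2 ->
         \forall y \near x, overstrand D y <-> exists z, m < z /\ K (y, z)).

End Diagrams.
Arguments simple_point R {S}.
Arguments crossing R {S}.
Arguments crossing_with_over R {S}.
Arguments same_diagram R {S}.
Arguments agree_near R {S}.

(** * Moves *)

Section Reidemeister.
Context {R : realType}.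
Implicit Types p : plane R.

Definition r1_before : diagram (plane R) := Diagram [set p | p.2 = 0] set0.

(* The polygonal line through (-oo,0), (-1,0), (1,2), (-1,2), (1,0), (+oo,0). *)
Definition r1_after : diagram (plane R) :=
  Diagram
    [set p | (1 <= `|p.1| /\ p.2 = 0) \/
             (`|p.1| <= 1 /\ (p.2 = p.1 + 1 \/ p.2 = 2 \/ p.2 = 1 - p.1))]
    [set p | p.2 = p.1 + 1].

Definition r2_before : diagram (plane R) :=
  Diagram [set p | p.2 = 1 \/ p.2 = -1] set0.

(* The strand y = min(1, |x| - 1) passes over its mirror image. *)
Definition r2_after : diagram (plane R) :=
  Diagram
    [set p | p.2 = Num.min 1 (`|p.1| - 1) \/ p.2 = - Num.min 1 (`|p.1| - 1)]
    [set p | p.2 = Num.min 1 (`|p.1| - 1)].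

(* The top strand y = s max(0, 1 - |x|), for s = 1 or s = -1, is moved across
   the crossing at the origin of y = x (over) and y = -x (under); the other two
   crossings are at (1/2, s/2) and (-1/2, s/2). *)
Definition r3_picture (s : R) : diagram (plane R) :=
  Diagram
    [set p | p.2 = s * Num.max 0 (1 - `|p.1|) \/ p.2 = p.1 \/ p.2 = - p.1]
    [set p | p.2 = s * Num.max 0 (1 - `|p.1|) \/ (p.2 = p.1 /\ `|p.1| < 1 / 4)].

Definition box : set (plane R) := [set p | `|p.1| <= 3 /\ `|p.2| <= 3].

(* D and D' differ by the replacement of the picture P by P' in a disc.  As the
   chart phi may reverse the orientation, one pair of pictures for each of R1,
   R2, R3 gives all the variants of that move. *)
Definition local_move (P P' : diagram (plane R)) (S : topologicalType)
    (D D' : diagram S) : Prop :=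
  exists phi : plane R -> S, open_embedding phi /\
    same_diagram R (pullback phi D) P /\ same_diagram R (pullback phi D') P' /\
    forall x, ~ (phi @` box) x -> agree_near R x D D'.

Definition R1 (S : topologicalType) (D D' : diagram S) : Prop :=
  local_move r1_before r1_after D D'.
Definition R2 (S : topologicalType) (D D' : diagram S) : Prop :=
  local_move r2_before r2_after D D'.
Definition R3 (S : topologicalType) (D D' : diagram S) : Prop :=
  local_move (r3_picture 1) (r3_picture (-1)) D D'.

Definition carries (S : topologicalType) (f : S -> S) (D D' : diagram S) : Prop :=
  same_diagram R D (pullback f D').

Definition isotopy_move (S : topologicalType) (D D' : diagram S) : Prop :=
  exists H : R -> S -> S, ambient_isotopy setT H /\ carries (H 1) D D'.

(* phi is an embedding in S of the annulus (R/Z) x [0, 1]. *)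
Definition dehn_twist (S : topologicalType) (f : S -> S) : Prop :=
  homeo_on setT f /\
  exists phi : R * R -> S,
    let strip := [set p : R * R | 0 <= p.2 <= 1] in
    {within strip, continuous phi} /\
    (forall p q, strip p -> strip q ->
       (phi p = phi q <-> p.2 = q.2 /\ exists k : int, p.1 - q.1 = k%:~R)) /\
    (forall p, strip p -> f (phi p) = phi (p.1 + p.2, p.2)) /\
    (forall x, ~ (phi @` strip) x -> f x = x).

Definition dehn_move (S : topologicalType) (D D' : diagram S) : Prop :=
  exists f : S -> S, dehn_twist f /\ carries f D D'.

Definition elementary_move (S : topologicalType) (D D' : diagram S) : Prop :=
  R1 D D' \/ R2 D D' \/ R3 D D' \/ isotopy_move D D' \/ dehn_move D D'.

(* Each move of the sequence may be performed in either direction. *)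
Definition related_by_moves (S : topologicalType) : diagram S -> diagram S -> Prop :=
  clos_refl_sym_trans (diagram S) (@elementary_move S).

End Reidemeister.
Arguments related_by_moves R {S}.

(** * Weaves *)

Section Weaves.
Context {R : realType}.

Section Links.
Context (L : lattice R).

(* Closed curves are parametrized by the real line, with period 1. *)
Definition torus_knot (p q : int) (s : R) : torus L * R :=
  let w := bu L *~ p + bv L *~ q in (torus_cover L (s * w.1, s * w.2), 0).

Definition homotopic (c c' : R -> torus L * R) : Prop :=
  exists H : R -> R -> torus L * R,
    {within [set st : R * R | 0 <= st.2 <= 1],
       continuous (fun st : R * R => H st.2 st.1)} /\
    (forall s, H 0 s = c s /\ H 1 s = c' s) /\
    (forall t s, 0 <= t <= 1 -> H t (s + 1) = H t s /\ -1 <= (H t s).2 <= 1).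

(* Components carry no orientation, whence the two signs. *)
Definition homotopic_to_knot (c : R -> torus L * R) (p q : int) : Prop :=
  homotopic c (torus_knot p q) \/ homotopic c (torus_knot (- p) (- q)).

Definition parallel (c c' : R -> torus L * R) : Prop :=
  exists p q : int, coprimez p q /\
    homotopic_to_knot c p q /\ homotopic_to_knot c' p q.

Definition thread (c : R -> torus L * R) (d : R -> plane R * R) : Prop :=
  continuous d /\ forall s, c s = (torus_cover L (d s).1, (d s).2).

Definition unknotted (d : R -> plane R * R) : Prop := injective (fun s => (d s).1).

Definition link_components n (K : set (torus L * R)) (c : 'I_n -> R -> torus L * R) :
    Prop :=
  (forall i, continuous (c i)) /\
  (forall i j s t, c i s = c j t <-> i = j /\ exists k : int, s - t = k%:~R) /\
  (forall i s, -1 < (c i s).2 < 1) /\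
  K = [set x | exists i s, x = c i s].

Definition weaving_link (K : set (torus L * R)) : Prop :=
  exists n (c : 'I_n -> R -> torus L * R), link_components K c /\
    (forall i, exists p q : int, coprimez p q /\ homotopic_to_knot (c i) p q) /\
    (forall i, exists d, thread (c i) d /\ unknotted d) /\
    (exists i j, ~ parallel (c i) (c j)).

Definition lift_link (K : set (torus L * R)) : set (plane R * R) :=
  [set x | K (torus_cover L x.1, x.2)].

Definition quotient_diagram (Dinf : diagram (plane R)) (D : diagram (torus L)) : Prop :=
  same_diagram R Dinf (pullback (torus_cover L) D).

Definition weaving_motif (D : diagram (torus L)) : Prop :=
  exists K, weaving_link K /\ diagram_of K D.

(* D is the quotient by L of the diagram Dinf of the weave W. *)
Definition weaving_motif_of (W : set (plane R * R)) (Dinf : diagram (plane R))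
    (D : diagram (torus L)) : Prop :=
  (exists K, weaving_link K /\ diagram_of K D /\ W = lift_link K) /\
  quotient_diagram Dinf D.

End Links.

Definition weave_with_diagram (W : set (plane R * R)) (Dinf : diagram (plane R)) :
    Prop :=
  exists (L : lattice R) (D : diagram (torus L)), weaving_motif_of W Dinf D.

(* The sheets of the covering p of the torus of L by the torus of L', which are
   the cells of L in a cell of L', each carry a copy of D. *)
Definition adjacent_copies (L L' : lattice R) (D : diagram (torus L))
    (D' : diagram (torus L')) : Prop :=
  exists p : torus L' -> torus L,
    (forall x, p (torus_cover L' x) = torus_cover L x) /\ same_diagram R D' (pullback p D).

Definition scale_equivalent_through (L1 L2 : lattice R) (Dinf : diagram (plane R))
    (D1 : diagram (torus L1)) (D2 D1' : diagram (torus L2)) : Prop :=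
  sublattice L1 L2 /\
  weaving_motif D1 /\ weaving_motif D2 /\ weaving_motif D1' /\
  adjacent_copies D1 D1' /\
  quotient_diagram Dinf D1 /\ quotient_diagram Dinf D1'.

Definition slab : set (plane R * R) := [set x | -1 <= x.2 <= 1].

Definition weave_equiv (W W' : set (plane R * R)) : Prop :=
  ambient_isotopic (R := R) slab W W'.

End Weaves.

(* Main.v *)
(* A link K over a surface that projects regularly, with diagram D, is determined by D up to a
   vertical isotopy: over each point the fibres of two such links have the same cardinality, at
   most two, and the maps of the line sending one fibre to the other form a convex set, so that
   local solutions given by the Tietze extension theorem can be averaged.

   Hence each move on diagrams need only be realized by an isotopy of some link with that
   diagram.  For a Reidemeister move the strands in the chart are first brought to suitable
   heights; the move is then a horizontal slide whose amplitude depends on the height.  The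
   isotopies of the thickened torus so obtained are the identity outside a chart, and are lifted
   to the thickened plane by lifting displacements.

   An isotopy of the torus and a Dehn twist are treated alike: the homeomorphism f of the torus
   lifts to a homeomorphism of the plane at bounded distance from a linear map I + N, where N = 0
   for an isotopy and N^2 = 0 for a Dehn twist (N kills the class of the core of the annulus, and
   its image lies in the line of that class).  Alexander's trick at infinity and the shears I + tN
   give an isotopy to the identity, which is not periodic; this is why Dehn twists are allowed.

   Finally W1 is the lift of a link over the torus of L2 with diagram D1'. *)
Require Import Defs.
From mathcomp Require Import all_boot all_order all_algebra.
From mathcomp Require Import all_classical all_reals all_analysis.
From mathcomp Require Import zify ring lra.

Set Implicit Arguments.
Unset Strict Implicit.
Unset Printing Implicit Defensive.

Import Order.TTheory GRing.Theory Num.Theory.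
Import numFieldNormedType.Exports.

Local Open Scope classical_set_scope.
Local Open Scope ring_scope.

(** * Continuity *)

(** The obstacle is that [overstrand] has a meaning only at crossings, so [curve] alone must tell
    over which points a fibre has two elements. This requires that a crossing never be a point of an
    arc, which is deduced from the intermediate value theorem. The property carried through the
    moves, [presents], is local over the surface: links over a chart, over the torus and over a
    covering torus are treated by the same lemmas, and no component has to be followed through a
    move. Isotopies are families of homeomorphisms of the whole of [plane R * R], indexed by all
    real times and with a jointly continuous inverse. Composition at equal times gives transitivity,
    and exchanging the family with its inverse gives symmetry, which the symmetric closure in
    [related_by_moves] calls for. Most inverses come from fibrewise increasing maps at bounded
    distance from the identity (vertical isotopies, slides), or from lifts of torus homeomorphisms
    corrected by a lattice translation. *)

Definition clamp (R : realType) (a b z : R) : R := Num.max a (Num.min b z).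

Section ContinuityAt.
Context {R : realType} {X : topologicalType}.
Implicit Types (x : X) (f g : X -> R).

Lemma cat_cst (Y : topologicalType) (c : Y) x : continuous_at x (fun=> c).
Proof. exact: cvg_cst. Qed.

Lemma cat_id x : continuous_at x (fun y : X => y).
Proof. exact: cvg_id. Qed.

Lemma cat_comp (Y Z : topologicalType) (f : X -> Y) (g : Y -> Z) x :
  continuous_at x f -> continuous_at (f x) g ->
  continuous_at x (fun y => g (f y)).
Proof. exact: continuous_comp. Qed.

Lemma cat_pair (Y Z : topologicalType) (f : X -> Y) (g : X -> Z) x :
  continuous_at x f -> continuous_at x g ->
  continuous_at x (fun y => (f y, g y)).
Proof. exact: cvg_pair. Qed.

Lemma cat_fst (Y Z : topologicalType) (f : X -> Y * Z) x :
  continuous_at x f -> continuous_at x (fun y => (f y).1).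
Proof. by move=> h; apply: (cat_comp h); exact: cvg_fst. Qed.

Lemma cat_snd (Y Z : topologicalType) (f : X -> Y * Z) x :
  continuous_at x f -> continuous_at x (fun y => (f y).2).
Proof. by move=> h; apply: (cat_comp h); exact: cvg_snd. Qed.

Lemma cat_add f g x : continuous_at x f -> continuous_at x g ->
  continuous_at x (fun y => f y + g y).
Proof. exact: (@continuousD R R^o). Qed.

Lemma cat_opp f x : continuous_at x f -> continuous_at x (fun y => - f y).
Proof. exact: (@continuousN R R^o). Qed.

Lemma cat_mul f g x : continuous_at x f -> continuous_at x g ->
  continuous_at x (fun y => f y * g y).
Proof. exact: continuousM. Qed.

Lemma cat_inv f x : f x != 0 -> continuous_at x f ->
  continuous_at x (fun y => (f y)^-1).
Proof. exact: continuousV. Qed.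

Lemma cat_norm f x : continuous_at x f -> continuous_at x (fun y => `|f y|).
Proof. by move=> h; apply: (cat_comp h); exact: (@norm_continuous R R^o). Qed.

Lemma cat_min f g x : continuous_at x f -> continuous_at x g ->
  continuous_at x (fun y => Num.min (f y) (g y)).
Proof. exact: continuous_min. Qed.

Lemma cat_max f g x : continuous_at x f -> continuous_at x g ->
  continuous_at x (fun y => Num.max (f y) (g y)).
Proof. exact: continuous_max. Qed.

Lemma cat_clamp (f g h : X -> R) x :
  continuous_at x f -> continuous_at x g -> continuous_at x h ->
  continuous_at x (fun y => clamp (f y) (g y) (h y)).
Proof. by move=> cf cg ch; apply: cat_max => //; apply: cat_min. Qed.

Lemma cat_plane_add (f g : X -> plane R) x :
  continuous_at x f -> continuous_at x g -> continuous_at x (fun y => f y + g y).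
Proof.
move=> cf cg; have -> : (fun y => f y + g y) = (fun y => ((f y).1 + (g y).1, (f y).2 + (g y).2)).
  by apply/funext => y; case: (f y) (g y) => [? ?] [? ?].
apply: (@cat_pair _ _ (fun y => (f y).1 + (g y).1) (fun y => (f y).2 + (g y).2)).
  exact: cat_add (@cat_fst _ _ f x cf) (@cat_fst _ _ g x cg).
exact: cat_add (@cat_snd _ _ f x cf) (@cat_snd _ _ g x cg).
Qed.

Lemma cat_plane_opp (f : X -> plane R) x :
  continuous_at x f -> continuous_at x (fun y => - f y).
Proof.
move=> cf; have -> : (fun y => - f y) = (fun y => (- (f y).1, - (f y).2)).
  by apply/funext => y; case: (f y) => [? ?].
apply: (@cat_pair _ _ (fun y => - (f y).1) (fun y => - (f y).2)).
  exact: cat_opp (@cat_fst _ _ f x cf).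
exact: cat_opp (@cat_snd _ _ f x cf).
Qed.

(** Data given on a strip or on a time interval are made global by precomposition with a map into
    that set, usually a [clamp]; this lemma keeps them continuous. *)
Lemma cat_within (Y Z : topologicalType) (A : set Y) (h : Y -> Z) (u : X -> Y) x :
  {within A, continuous h} -> continuous_at x u -> (forall y, A (u y)) ->
  continuous_at x (fun y => h (u y)).
Proof.
move=> /subspace_continuousP ch cu Au U hU.
have h1 : nbhs (u x) [set y | A y -> U (h y)] by exact: (ch (u x) (Au x) U hU).
change (nbhs x ((fun y => h (u y)) @^-1` U)).
have h2 : nbhs x (u @^-1` [set y | A y -> U (h y)]) := cu _ h1.
by apply: filterS h2 => y /= h3; apply: h3.
Qed.

End ContinuityAt.

Ltac cts := cbv beta; repeat lazymatch goal with
  | |- continuous _ => let x := fresh "x" in move=> x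
  | |- continuous_at ?x (fun _ => ?c) => apply: cat_cst
  | |- continuous_at ?x (fun y => y) => apply: cat_id
  | |- continuous_at ?x (fun y => (@?f y, @?g y)) => apply: (@cat_pair _ _ _ f g)
  | |- continuous_at ?x (fun y => (@?f y).1) => apply: (@cat_fst _ _ _ f)
  | |- continuous_at ?x (fun y => (@?f y).2) => apply: (@cat_snd _ _ _ f)
  | |- continuous_at ?x (fun y => @?f y + @?g y) => first [apply: (@cat_add _ _ f g)|apply: (@cat_plane_add _ _ f g)]
  | |- continuous_at ?x (fun y => - @?f y) => first [apply: (@cat_opp _ _ f)|apply: (@cat_plane_opp _ _ f)]
  | |- continuous_at ?x (fun y => @?f y * @?g y) => apply: (@cat_mul _ _ f g)
  | |- continuous_at ?x (fun y => (@?f y)^-1) => apply: (@cat_inv _ _ f)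
  | |- continuous_at ?x (fun y => `|@?f y|) => apply: (@cat_norm _ _ f)
  | |- continuous_at ?x (fun y => Num.min (@?f y) (@?g y)) => apply: (@cat_min _ _ f g)
  | |- continuous_at ?x (fun y => Num.max (@?f y) (@?g y)) => apply: (@cat_max _ _ f g)
  | |- continuous_at ?x (fun y => clamp (@?f y) (@?g y) (@?h y)) =>
      apply: (@cat_clamp _ _ f g h)
  | |- continuous_at ?x fst => exact: cvg_fst
  | |- continuous_at ?x snd => exact: cvg_snd
  | H : continuous ?h |- continuous_at ?x ?h => exact: H
  | H : continuous ?h |- continuous_at ?x (fun y => ?h (@?f y)) =>
      apply: (@cat_comp _ _ _ f h); last exact: H
  end; cbv beta.

Section RealFunctions.
Context {R : realType}.

Lemma clamp_id (a b z : R) : a <= z <= b -> clamp a b z = z.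
Proof. by move=> /andP[az zb]; rewrite /clamp min_r // max_r. Qed.

Lemma clamp_itv (a b z : R) : a <= b -> a <= clamp a b z <= b.
Proof. by move=> ab; rewrite /clamp le_max lexx /= ge_max ab ge_min lexx. Qed.

Lemma cat_norm_lt (X : topologicalType) (x : X) (f : X -> R) (e : R) :
  continuous_at x f -> 0 < e -> \forall y \near x, `|f y - f x| < e.
Proof.
move=> /cvgr_dist_lt h e0; move: (h e e0); apply: filterS => y.
by rewrite distrC.
Qed.

Lemma cat_normP (X : topologicalType) (x : X) (f : X -> R) :
  (forall e, 0 < e -> \forall y \near x, `|f y - f x| < e) -> continuous_at x f.
Proof.
by move=> h; apply/cvgrPdist_lt => e /h; apply: filterS => y; rewrite distrC.
Qed.

Lemma cat_lt (X : topologicalType) (x : X) (f g : X -> R) :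
  continuous_at x f -> continuous_at x g -> f x < g x ->
  \forall y \near x, f y < g y.
Proof.
move=> cf cg fg; have e0 : 0 < (g x - f x) / 2 by lra.
move: (cat_norm_lt cf e0) (cat_norm_lt cg e0); apply: filterS2 => y.
by rewrite !ltr_norml => /andP[_ ?] /andP[? _]; lra.
Qed.

Lemma int_valued_cst (f : R -> R) : continuous f ->
  (forall s, exists k : int, f s = k%:~R) -> forall s t, f s = f t.
Proof.
move=> cf fZ.
suff W (s t : R) : s <= t -> f s = f t.
  by move=> s t; have [/W//|/ltW/W->] := leP s t.
move=> st; apply/eqP/negP => /negP ne.
(* A half-integer between two distinct integer values: the intermediate value theorem would make it
   a value of [f]. *)
pose v := Num.min (f s) (f t) + 1 / 2.
have [k1 e1] := fZ s; have [k2 e2] := fZ t.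
have : k1 != k2 by apply: contra_neq ne; rewrite e1 e2 => ->.
have vm : Num.min (f s) (f t) <= v <= Num.max (f s) (f t).
  apply/andP; split; first by rewrite /v; lra.
  rewrite /v e1 e2; case: (ltgtP k1 k2) => [lt|lt|e].
  - have : (k1 + 1)%:~R <= k2%:~R :> R by rewrite ler_int lezD1.
    rewrite intrD => h; have h' : k1%:~R < k2%:~R :> R by rewrite ltr_int.
    by rewrite min_l ?max_r ?(ltW h') //; lra.
  - have : (k2 + 1)%:~R <= k1%:~R :> R by rewrite ler_int lezD1.
    rewrite intrD => h; have h' : k2%:~R < k1%:~R :> R by rewrite ltr_int.
    by rewrite min_r ?max_l ?(ltW h') //; lra.
  - by move: ne; rewrite e1 e2 e eqxx.
move=> _; have [c _ fc] := IVT st (continuous_subspaceT cf) vm.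
have [k ek] := fZ c; have [l el] : exists l : int, v = l%:~R + 1 / 2.
  rewrite /v; case: (leP (f s) (f t)) => _; [by exists k1; rewrite e1|by exists k2; rewrite e2].
move: fc; rewrite ek el => kl; have [kl'|lk] := leP k l.
  have : k%:~R <= l%:~R :> R by rewrite ler_int.
  by lra.
have : (l + 1)%:~R <= k%:~R :> R by rewrite ler_int lezD1.
by rewrite intrD; lra.
Qed.

(** The bound gives surjectivity of each fibre map through the intermediate value theorem. Joint
    continuity of the inverse comes from the order: the strict inequalities [E (x, G (x, w) - e) < w
    < E (x, G (x, w) + e)] persist nearby and trap the inverse. *)
Lemma increasing_inverse (X : topologicalType) (E : X * R -> R) (C : R) :
  continuous E -> (forall x z w, z < w -> E (x, z) < E (x, w)) ->
  (forall x z, `|E (x, z) - z| <= C) ->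
  exists G : X * R -> R, [/\ continuous G,
    forall x z, G (x, E (x, z)) = z & forall x z, E (x, G (x, z)) = z].
Proof.
move=> cE mE bE.
have sE x w : exists z, E (x, z) = w.
  have ab : w - C <= w + C by have := bE x w; have := normr_ge0 (E (x, w) - w); lra.
  have cEx : {within `[w - C, w + C], continuous (fun z => E (x, z))}.
    by apply: continuous_subspaceT; cts.
  have [|z _ <-] := IVT ab cEx (v := w); last by exists z.
  have := bE x (w - C); have := bE x (w + C).
  rewrite !ler_norml => /andP[h1 h2] /andP[h3 h4].
  by rewrite ge_min le_max; apply/andP; split; apply/orP; [left|right]; lra.
pose G (p : X * R) := projT1 (cid (sE p.1 p.2)).
have EG x w : E (x, G (x, w)) = w by rewrite /G; case: cid.
have GE x z : G (x, E (x, z)) = z.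
  apply/eqP/negP => /negP; rewrite neq_lt => /orP[] /(mE x); rewrite EG ltxx //.
exists G; split => // -[x w]; apply: cat_normP => e e0.
have h1 : \forall q \near (x, w), E (q.1, G (x, w) - e) < q.2.
  apply: (@cat_lt _ _ (fun q => E (q.1, G (x, w) - e)) snd) => /=; try by cts.
  by rewrite -[ltRHS](EG x w); apply: mE; lra.
have h2 : \forall q \near (x, w), q.2 < E (q.1, G (x, w) + e).
  apply: (@cat_lt _ _ snd (fun q => E (q.1, G (x, w) + e))) => /=; try by cts.
  by rewrite -[ltLHS](EG x w); apply: mE; lra.
move: h1 h2; apply: filterS2 => -[y v] /= h1 h2.
have mE' a b : E (y, a) < E (y, b) -> a < b.
  by move=> h; rewrite ltNge le_eqVlt; apply/negP => /orP[/eqP ba|/(mE y)];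
     [move: h; rewrite ba ltxx|rewrite ltNge (ltW h)].
rewrite -(EG y v) in h1 h2; move/mE' in h1; move/mE' in h2.
by rewrite ltr_norml; apply/andP; split; lra.
Qed.

End RealFunctions.

(** * Charts and crossings *)

Section Shrink.
Context {R : realType}.

Definition squash (s : R) : R := s / (1 + `|s|).

Lemma squash_den (s : R) : 1 + `|s| != 0.
Proof. by have := normr_ge0 s; lra. Qed.

Lemma squash_lt1 (s : R) : `|squash s| < 1.
Proof.
have s0 := normr_ge0 s.
by rewrite normrM normfV (ger0_norm (_ : 0 <= 1 + `|s|)) ?ltr_pdivrMr; lra.
Qed.

Lemma squashK (s : R) : squash s / (1 - `|squash s|) = s.
Proof.
have s0 := normr_ge0 s; have d := squash_den s.
rewrite /squash normrM normfV (ger0_norm (_ : 0 <= 1 + `|s|)); last by lra.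
by field; apply/andP; split; lra.
Qed.

Lemma unsquashK (u : R) : `|u| < 1 -> squash (u / (1 - `|u|)) = u.
Proof.
move=> u1; have d : 1 - `|u| != 0 by lra.
rewrite /squash normrM normfV (gtr0_norm (_ : 0 < 1 - `|u|)); last by lra.
by field; apply/andP; split; lra.
Qed.

Lemma squash_eq0 (s : R) : squash s = 0 <-> s = 0.
Proof.
by split=> [h|->]; [rewrite -(squashK s) h mul0r|rewrite /squash mul0r].
Qed.

(** Charts are parametrized by the whole plane, so they are localized by precomposition with a
    homeomorphism of the plane onto a small open square. Acting on each coordinate and fixing zero,
    it preserves the cross. *)
Definition shrink (e : R) (p : plane R) : plane R := (e * squash p.1, e * squash p.2).

Lemma shrink_continuous (e : R) : continuous (shrink e).
Proof. by rewrite /shrink /squash; cts; exact: squash_den. Qed.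

Lemma shrink_embedding (e : R) : 0 < e -> open_embedding (shrink e).
Proof.
move=> e0; have en : e != 0 by lra.
split; last split; last move=> U oU.
- move=> [a b] [c d] [/= /(mulfI en) h1 /(mulfI en) h2].
  by rewrite -(squashK a) -(squashK b) h1 h2 !squashK.
- exact: shrink_continuous.
pose un (q : plane R) := (q.1 / e / (1 - `|q.1 / e|), q.2 / e / (1 - `|q.2 / e|)).
have -> : shrink e @` U =
    [set q | `|q.1 / e| < 1 /\ `|q.2 / e| < 1 /\ U (un q)].
  apply/seteqP; split=> [q [p Up <-]|[u v] /= [h1 [h2 Uq]]].
    rewrite /= /un /= !(mulrC e) !mulfK // !squashK; split; first exact: squash_lt1.
    by split; [exact: squash_lt1|case: p Up].
  exists (un (u, v)) => //; rewrite /shrink /un /= !unsquashK //.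
  by congr (_, _); rewrite mulrC divfK.
rewrite openE => q [h1 [h2 Uq]].
have c1 : \forall q' \near q, `|q'.1 / e| < 1.
  by apply: (@cat_lt _ _ _ (fun q' : plane R => `|q'.1 / e|) (fun=> 1)) => //; cts.
have c2 : \forall q' \near q, `|q'.2 / e| < 1.
  by apply: (@cat_lt _ _ _ (fun q' : plane R => `|q'.2 / e|) (fun=> 1)) => //; cts.
have c3 : \forall q' \near q, U (un q').
  have : continuous_at q un by rewrite /un; cts; lra.
  by apply; apply: open_nbhs_nbhs.
by near=> q'; split; [|split]; near: q'.
Unshelve. all: by end_near. Qed.

Lemma nbhs0_square (U : set (plane R)) : nbhs ((0 : R), (0 : R)) U ->
  exists2 e : R, 0 < e & forall p : plane R, `|p.1| < e -> `|p.2| < e -> U p.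
Proof.
move=> [[A B] /= [/nbhs_ballP[e1 e10 hA] /nbhs_ballP[e2 e20 hB]] AB].
rewrite /= in e10 e20.
exists (Num.min e1 e2) => [|p]; first by rewrite lt_min e10.
rewrite !lt_min => /andP[a _] /andP[_ b]; apply: AB; split => /=.
  by apply: hA; rewrite /ball /= sub0r normrN.
by apply: hB; rewrite /ball /= sub0r normrN.
Qed.

End Shrink.

Section LocalHomeo.
Context {R : realType}.

Lemma comp_embedding (S1 S2 S3 : topologicalType) (f : S1 -> S2) (g : S2 -> S3) :
  open_embedding f -> open_embedding g -> open_embedding (g \o f).
Proof.
move=> [fi [fc fo]] [gi [gc go]]; split; [exact: inj_comp|split].
  by move=> x; apply: continuous_comp; [exact: fc|exact: gc].
by move=> U oU; rewrite -image_comp; apply/go/fo.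
Qed.

Lemma shrink_chart (S : topologicalType) (x : S) (phi : plane R -> S) (U : set S) :
  chart_at x phi -> nbhs x U ->
  exists e : R, [/\ 0 < e, chart_at x (phi \o shrink e) &
    forall p, U (phi (shrink e p))].
Proof.
move=> [[pi [pc po]] p0] Ux.
have /nbhs0_square[e e0 he] : nbhs ((0 : R), (0 : R)) (phi @^-1` U).
  by apply: pc; rewrite p0.
exists e; split => //.
  split; last by rewrite /= /shrink /= /squash !mul0r !mulr0.
  by apply: comp_embedding => //; exact: shrink_embedding.
move=> p; apply: he; rewrite /shrink /= normrM (gtr0_norm e0) -[ltRHS]mulr1
  ltr_pM2l //; exact: squash_lt1.
Qed.

Lemma shrink_cross (e : R) : 0 < e -> shrink e @^-1` cross = cross.
Proof.
move=> e0; have en : e != 0 by lra.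
suff h (s : R) : e * squash s = 0 <-> s = 0.
  by apply/seteqP; split=> p; rewrite /cross /shrink /= !h.
split=> [/eqP|/squash_eq0 ->]; last by rewrite mulr0.
by rewrite mulf_eq0 (negbTE en) /= => /eqP/squash_eq0.
Qed.

Lemma crossing_chart (S : topologicalType) (C : set S) (x : S) (U : set S) :
  crossing R C x -> nbhs x U ->
  exists phi : plane R -> S,
    [/\ chart_at x phi, phi @^-1` C = cross & forall p, U (phi p)].
Proof.
move=> [phi [cp pC]] Ux; have [e [e0 ce eU]] := shrink_chart cp Ux.
by exists (phi \o shrink e); split => //; rewrite comp_preimage pC shrink_cross.
Qed.

Lemma crossing_local (S : topologicalType) (C C' : set S) (x : S) :
  (\forall y \near x, C y <-> C' y) -> crossing R C x -> crossing R C' x.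
Proof.
move=> CC' /crossing_chart /(_ CC')[phi [cp pC h]]; exists phi; split => //.
by rewrite -pC; apply/seteqP; split => p /=; rewrite h.
Qed.

(** One notion for charts, homeomorphisms, the covering of a torus by the plane and the covering of
    one torus by another. *)
Definition local_homeo (S S' : topologicalType) (f : S -> S') :=
  [/\ continuous f, forall U, open U -> open (f @` U) &
    forall x : S, exists2 U, nbhs x U & forall a b, U a -> U b -> f a = f b -> a = b].

Lemma embedding_local_homeo (S S' : topologicalType) (f : S -> S') :
  open_embedding f -> local_homeo f.
Proof.
move=> [fi [fc fo]]; split => // x; exists setT; first exact: filterT.
by move=> a b _ _ /fi.
Qed.

Lemma open_map_near (S S' : topologicalType) (f : S -> S') (x : S) (Q : set S') :
  continuous f -> (forall U, open U -> open (f @` U)) ->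
  (\forall y \near x, Q (f y)) <-> (\forall y \near f x, Q y).
Proof.
move=> fc fo; split=> [h|/fc //]; have : nbhs x (f @^-1` Q) by [].
rewrite nbhsE => -[U [oU Ux] UQ].
apply: (@filterS _ _ _ (f @` U)); last first.
  by apply: open_nbhs_nbhs; split; [exact: fo|exists x].
by move=> y [z Uz <-]; exact: UQ.
Qed.

(** The chart at [f x], shrunk into the image of an open set [V] on which [f] is injective, lifts to
    a chart at [x] by inverting [f] on [V]. *)
Lemma crossing_pull (S S' : topologicalType) (f : S -> S') (C : set S') (x : S) :
  local_homeo f -> crossing R C (f x) -> crossing R (f @^-1` C) x.
Proof.
move=> [fc fo /(_ x)[U]]; rewrite nbhsE => -[V [oV Vx] VU] Ui.
have Vi a b : V a -> V b -> f a = f b -> a = b by move=> ? ?; apply: Ui; exact: VU.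
have fV : nbhs (f x) (f @` V) by apply: open_nbhs_nbhs; split; [exact: fo|exists x].
move=> /crossing_chart /(_ fV)[psi [[[pi [pc po]] p0] pC hV]].
have [|phi phiP] := @boolp.choice _ _ (fun q s => V s /\ f s = psi q).
  by move=> q; have [s ? ?] := hV q; exists s.
exists phi; split; first split; first split.
- by move=> a b ab; apply: pi; rewrite -!(proj2 (phiP _)) ab.
- split; first last.
    move=> O oO; suff -> : phi @` O = V `&` f @^-1` (psi @` O).
      by apply: openI => //; apply: open_comp; [move=> ? _; exact: fc|exact: po].
    apply/seteqP; split=> [s [q Oq <-]|s [Vs [q Oq e]]].
      by have [h1 h2] := phiP q; split => //; exists q.
    by exists q => //; have [h1 h2] := phiP q; apply: Vi => //; rewrite h2.
  move=> q O; rewrite nbhsE => -[W [oW Wq] WO].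
  have : nbhs (psi q) (f @` (W `&` V)).
    apply: open_nbhs_nbhs; split; first by apply: fo; exact: openI.
    by have [h1 h2] := phiP q; exists (phi q).
  move=> /pc h; change (nbhs q (phi @^-1` O)); apply: (@filterS _ (nbhs q) _ (psi @^-1` (f @` (W `&` V))) _ _ h) => q' /= [s [Ws Vs] e]; apply: WO.
  by have [h1 h2] := phiP q'; rewrite -(Vi s (phi q')) // h2.
- by have [h1 h2] := phiP (0, 0); apply: Vi => //; rewrite h2.
- by rewrite -pC; apply/seteqP; split=> q /=; have [_ ->] := phiP q.
Qed.

Lemma crossing_push (S S' : topologicalType) (f : S -> S') (C : set S') (x : S) :
  local_homeo f -> crossing R (f @^-1` C) x -> crossing R C (f x).
Proof.
move=> [fc fo /(_ x)[U Ux Ui]] /crossing_chart /(_ Ux)[phi [[[pi [pc po]] p0] pC hU]].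
exists (f \o phi); split; last by rewrite comp_preimage.
split; last by rewrite /= p0.
split; first by move=> a b /= /Ui h; apply: pi; apply: h; exact: hU.
split; first by move=> q; apply: continuous_comp; [exact: pc|exact: fc].
by move=> O oO; rewrite -image_comp; apply/fo/po.
Qed.

(** The sign condition says that both functions leave their common start in the same direction; the
    end value nearer to the start is then also a value of the other function. *)
Lemma common_value (h k : R -> R) : continuous h -> continuous k -> h 0 = k 0 ->
  0 < (h 1 - h 0) * (k 1 - h 0) -> exists s t, [/\ 0 < s, 0 < t & h s = k t].
Proof.
have pos (a b : R -> R) : continuous a -> continuous b -> a 0 = b 0 ->
    a 0 < a 1 -> a 0 < b 1 -> exists s t, [/\ 0 < s, 0 < t & a s = b t].
  have main (a' b' : R -> R) : continuous b' -> a' 0 = b' 0 -> a' 0 < a' 1 ->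
      a' 1 <= b' 1 -> exists s t, [/\ 0 < s, 0 < t & a' s = b' t].
    move=> cb ab0 a01 ab1.
    have [|t + bt] := @IVT R b' 0 1 (a' 1) ler01 (continuous_subspaceT cb).
    - by rewrite ge_min le_max ab1 -ab0 (ltW a01) orbT.
    - rewrite in_itv /= => /andP[t0 t1].
      exists 1, t; split => //; rewrite lt_neqAle t0 andbT.
      by apply: contraTneq a01 => e; rewrite -bt -e ab0 ltxx.
  move=> ca cb ab0 a01 b01; have [ab|/ltW ba] := leP (a 1) (b 1); first exact: main.
  have [|//|s [t [s0 t0 e]]] := main b a ca (esym ab0); first by rewrite -ab0.
  by exists t, s; split.
move=> ch ck hk0; have [h1|h1|<-] := ltgtP (h 0) (h 1); last by rewrite subrr mul0r ltxx.
  by rewrite pmulr_rgt0 ?subr_gt0 // => k1; apply: pos.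
rewrite nmulr_rgt0 ?subr_lt0 // => k1.
have [|||||s [t [s0 t0 /oppr_inj e]]] := pos (fun z => - h z) (fun z => - k z).
- by cts.
- by cts.
- by rewrite hk0.
- by rewrite ltrN2.
- by rewrite ltrN2.
- by exists s, t; split.
Qed.

(* Among the three half-axes ending at the origin of a cross, two leave it in the same direction
   of the line, where the intermediate value theorem gives a common value. *)
Lemma no_crossing_on_arc (S : topologicalType) (C : set S) (x : S) (U : set S) (f : S -> R) :
  nbhs x U -> (forall y, U y -> continuous_at y f) ->
  (forall y y', U y -> U y' -> C y -> C y' -> f y = f y' -> y = y') ->
  ~ crossing R C x.
Proof.
move=> Ux fc fi /crossing_chart /(_ Ux)[phi [[[pi [pc po]] p0] pC hU]].
pose g p := f (phi p).
have gc : continuous g by move=> p; apply: cat_comp; [exact: pc|apply: fc; exact: hU].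
have gi p q : cross p -> cross q -> g p = g q -> p = q.
  rewrite -pC => Cp Cq e; apply: pi; apply: fi => //; exact: hU.
pose a (t : R) := g (t, 0); pose b (t : R) := g (- t, 0); pose c (t : R) := g (0, t).
have ca : continuous a by rewrite /a; cts.
have cb : continuous b by rewrite /b; cts.
have cc : continuous c by rewrite /c; cts.
have b0 : b 0 = a 0 by rewrite /a /b oppr0.
have nz (h : R -> R) (v : R -> plane R) : (forall t, h t = g (v t)) ->
    (forall t, cross (v t)) -> v 0 = (0, 0) -> v 1 != (0, 0) -> h 1 - a 0 != 0.
  move=> hv cv v0 v1; apply: contra_neq v1 => e; rewrite -v0; apply: gi => //.
  by rewrite -!hv [RHS]hv v0 -/(a 0); lra.
have na : a 1 - a 0 != 0.
  apply: (nz a (fun t => (t, 0))) => // [t|]; first by right.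
  by rewrite xpair_eqE oner_eq0.
have nb : b 1 - a 0 != 0.
  apply: (nz b (fun t => (- t, 0))) => // [t||]; first by right.
    by rewrite oppr0.
  by rewrite xpair_eqE oppr_eq0 oner_eq0.
have nc : c 1 - a 0 != 0.
  apply: (nz c (fun t => (0, t))) => // [t|]; first by left.
  by rewrite xpair_eqE oner_eq0 andbF.
have [|[|]] : 0 < (a 1 - a 0) * (b 1 - a 0) \/
    0 < (a 1 - a 0) * (c 1 - a 0) \/ 0 < (b 1 - a 0) * (c 1 - a 0).
- move: na nb nc; rewrite !neq_lt.
  by move=> /orP[] h1 /orP[] h2 /orP[] h3;
    first [by left; nra|by right; left; nra|by right; right; nra].
- move=> /(common_value ca cb (esym b0))[s [t [s0 t0 e]]].
  have /(congr1 fst)/= st : (s, 0) = (- t, 0) :> plane R by apply: gi => //; right.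
  by move: s0; rewrite st oppr_gt0 => /(lt_trans t0); rewrite ltxx.
- move=> /(common_value ca cc erefl)[s [t [s0 t0 e]]].
  have /(congr1 fst)/= st : (s, 0) = (0, t) :> plane R by apply: gi => //; [right|left].
  by move: s0; rewrite st ltxx.
- rewrite -b0 => /(common_value cb cc b0)[s [t [s0 t0 e]]].
  have /(congr1 fst)/= st : (- s, 0) = (0, t) :> plane R by apply: gi => //; [right|left].
  by move: s0; rewrite -oppr_lt0 st ltxx.
Qed.

End LocalHomeo.

(** * Links with a given diagram *)

Section Presentation.
Context {R : realType} {S : topologicalType}.
Implicit Types (K : set (S * R)) (D : diagram S) (x : S).

Definition single_over K x := forall z w, K (x, z) -> K (x, w) -> z = w.

Definition double_over K D x := exists z1 z2 : R, [/\ z1 < z2,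
  forall z, K (x, z) <-> z = z1 \/ z = z2 &
  forall m, z1 < m < z2 ->
    \forall y \near x, overstrand D y <-> exists z, m < z /\ K (y, z)].

Definition sheets K D x :=
  (~ crossing R (curve D) x /\ \forall y \near x, single_over K y) \/
  [/\ crossing R (curve D) x, \forall y \near x, y <> x -> single_over K y &
    double_over K D x].

(* A local form of [diagram_of] that mentions charts only to recognize crossings: it is
   preserved by local homeomorphisms, by vertical isotopies and by [same_diagram]. *)
Definition presents_at K D x := [/\ forall z, K (x, z) -> -1 < z < 1,
  forall z, ~ K (x, z) -> \forall q \near (x, z), ~ K q,
  curve D x <-> exists z, K (x, z) & sheets K D x].

Definition presents K D := forall x, presents_at K D x.

(** Upper semicontinuity of the fibres, by the tube lemma: heights stay in the compact interval
    [[-1, 1]], and the complement of [K] is a neighbourhood of each of its points over [x]. *)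
Lemma fibre_usc K x (O : set R) :
  (\forall y \near x, forall z, K (y, z) -> -1 < z < 1) ->
  (forall z, ~ K (x, z) -> \forall q \near (x, z), ~ K q) ->
  open O -> (forall z, K (x, z) -> O z) -> \forall y \near x, forall z, K (y, z) -> O z.
Proof.
move=> hK cK oO KO.
have /compact_near_coveringP cov := @segment_compact R (-1) 1.
have h : \forall y \near x, `[-1, 1]%classic `<=` (fun z : R => K (y, z) -> O z).
  apply: (cov S (nbhs x) (fun y z => K (y, z) -> O z)) => z _.
  have [Oz|nOz] := pselect (O z).
    exists (O, setT); first by split; [exact: open_nbhs_nbhs|exact: filterT].
    by move=> [z' y] [/= ? _] _.
  have /cK[[A B] /= [Ax Bz] AB] : ~ K (x, z) by move=> /KO.
  by exists (B, A) => // -[z' y] [/= ? ?] Kyz; case: (AB (y, z')).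
near=> y => z Kz; have zI : `[-1, 1]%classic z.
  have /andP[? ?] : -1 < z < 1.
    by move: z Kz; near: y.
  by rewrite /= in_itv /= !ltW.
by move: z zI Kz; near: y.
Unshelve. all: by end_near. Qed.

Lemma presents_local K K' D D' x :
  (\forall y \near x, forall z, K (y, z) <-> K' (y, z)) -> agree_near R x D D' ->
  presents_at K D x -> presents_at K' D' x.
Proof.
move=> KK' [CC' OO'] [hK cK sK].
have e z : K (x, z) <-> K' (x, z) by move: (nbhs_singleton KK').
have s y : (forall z, K (y, z) <-> K' (y, z)) -> single_over K y -> single_over K' y.
  by move=> h sy z w /h Kz /h Kw; exact: sy.
move=> sh; split.
- by move=> z /e /hK.
- move=> z; rewrite -e => /cK cKz.
  have : \forall q \near (x, z), forall w, K (q.1, w) <-> K' (q.1, w).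
    exists ([set y | forall w, K (y, w) <-> K' (y, w)], setT).
      by split; [exact: KK'|exact: filterT].
    by move=> [y w] [/= ? _].
  by move: cKz; apply: filterS2 => -[y w] /= h1 h2; rewrite -h2.
- have <- := nbhs_singleton CC'; rewrite sK.
  by split=> -[z /e ?]; exists z.
- case: sh => [[nx sx]|[cx sx [z1 [z2 [z12 Kx ov]]]]].
    left; split; last by move: KK' sx; apply: filterS2 => y /s.
    have C'C : \forall y \near x, curve D' y <-> curve D y.
      by apply: filterS CC' => y [? ?]; split.
    by move=> /(crossing_local C'C).
  right; split; first exact: crossing_local CC' cx.
    by move: KK' sx; apply: filterS2 => y /s h h' /h'.
  exists z1, z2; split => // [z|m /ov ovm]; first by rewrite -e.
  have := OO' cx; move: KK' ovm; apply: filterS3 => y h1 h2 <-; rewrite h2.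
  by split=> -[z [? /h1 ?]]; exists z.
Qed.

Lemma presents_same K D D' : same_diagram R D D' -> presents K D -> presents K D'.
Proof.
move=> h p x; apply: presents_local (h x) (p x).
by apply: nearW => y z.
Qed.

End Presentation.

Section PresentationTransport.
Context {R : realType} {S S' : topologicalType} (f : S -> S') (fl : local_homeo f).
Implicit Types (K : set (S' * R)) (D : diagram S').

Definition pull_link K : set (S * R) := [set q | K (f q.1, q.2)].

Let fc : continuous f. Proof. by case: fl. Qed.
Let fo U : open U -> open (f @` U). Proof. by case: fl => _ + _; apply. Qed.

Lemma near_pull x (Q : set S') :
  (\forall y \near x, Q (f y)) <-> (\forall y \near f x, Q y).
Proof. exact: open_map_near. Qed.

Lemma near_pull2 x (z : R) (Q : set (S' * R)) :
  (\forall q \near (x, z), Q (f q.1, q.2)) <-> (\forall q \near (f x, z), Q q).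
Proof.
split=> -[[A B] /= [Ax Bz] AB].
  move: Ax; rewrite nbhsE => -[U [oU Ux] UA].
  exists (f @` U, B) => /=.
    by split => //; apply: open_nbhs_nbhs; split; [exact: fo|exists x].
  by move=> [_ w] [/= [y Uy <-] Bw]; apply: (AB (y, w)); split => //; exact: UA.
exists (f @^-1` A, B) => /=; first by split => //; exact: fc.
by move=> [y w] [/= ? ?]; exact: (AB (f y, w)).
Qed.

Lemma presents_pull K D x :
  presents_at (pull_link K) (pullback f D) x <-> presents_at K D (f x).
Proof.
have ss y : single_over (pull_link K) y <-> single_over K (f y) by [].
have ov m : (\forall y \near x, overstrand (pullback f D) y <->
      exists z, m < z /\ pull_link K (y, z)) <->
    (\forall y \near f x, overstrand D y <-> exists z, m < z /\ K (y, z)).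
  exact: (@near_pull x (fun y => overstrand D y <-> exists z, m < z /\ K (y, z))).
have cK : (forall z, ~ pull_link K (x, z) -> \forall q \near (x, z), ~ pull_link K q) <->
    (forall z, ~ K (f x, z) -> \forall q \near (f x, z), ~ K q).
  by split=> h z /h; rewrite -/(~` K) => h'; apply/(@near_pull2 x z (~` K)).
have sh : sheets (pull_link K) (pullback f D) x <-> sheets K D (f x).
  split=> -[[nx h]|[cx sx [z1 [z2 [z12 Kx hov]]]]].
  - left; split; last exact/(@near_pull x (single_over K)).
    by move=> cx; apply: nx; exact: (crossing_pull fl).
  - right; split; first exact: (crossing_push fl).
      apply/(@near_pull x (fun y => y <> f x -> single_over K y)).
      move: sx; apply: filterS => y sy yx; apply: sy.
      by move=> e; apply: yx; rewrite e.
    by exists z1, z2; split => // m /hov /ov.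
  - left; split; last by move/(@near_pull x (single_over K)): h.
    by move=> cx; apply: nx; exact: (crossing_push fl).
  - right; split; first exact: (crossing_pull fl).
      have [_ _ /(_ x)[U Ux Ui]] := fl.
      move/(@near_pull x (fun y => y <> f x -> single_over K y)): sx => sx; have Ux' := nbhs_singleton Ux.
      move: Ux sx; apply: filterS2 => y Uy sy yx.
      apply: sy => e; apply: yx; exact: Ui.
    by exists z1, z2; split => // m /hov /ov.
split=> -[h1 h2 h3 h4]; split => //; [exact/cK|exact/sh|exact/cK|exact/sh].
Qed.

End PresentationTransport.

(** * Regular projections are presentations *)

Section Regular.
Context {R : realType} {S : topologicalType}.
Implicit Types (K : set (S * R)) (D : diagram S) (x : S).

Lemma chart_inverse (phi : plane R -> S) : open_embedding phi ->
  exists psi : S -> plane R, (forall p, psi (phi p) = p) /\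
    forall p, continuous_at (phi p) psi.
Proof.
move=> [pi [pc po]].
have [|psi psiP] := @boolp.choice S (plane R) (fun y p => range phi y -> phi p = y).
  move=> y; have [[p _ <-]|n] := pselect (range phi y); first by exists p.
  by exists (0, 0) => /n.
have psiK p : psi (phi p) = p by apply: pi; apply: psiP; exists p.
exists psi; split => // p U; rewrite psiK nbhsE => -[V [oV Vp] VU].
have : nbhs (phi p) (phi @` V).
  by apply: open_nbhs_nbhs; split; [exact: po|exists p].
by apply: filterS => _ [q Vq <-]; rewrite /= psiK; exact: VU.
Qed.

(** In the chart the curve is a line, on which the first coordinate is injective, so
    [no_crossing_on_arc] applies at every point of the chart. *)
Lemma simple_no_crossing_near (C : set S) x : simple_point R C x ->
  \forall y \near x, ~ crossing R C y.
Proof.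
move=> [phi [[pe p0] pC]]; have [psi [psiK psic]] := chart_inverse pe.
have [pi [pc po]] := pe.
have : nbhs x (range phi).
  by apply: open_nbhs_nbhs; split; [exact/po/openT|exists (0, 0)].
apply: filterS => _ [p _ <-].
apply: (@no_crossing_on_arc _ _ _ _ (range phi) (fun y => (psi y).1)).
- by apply: open_nbhs_nbhs; split; [exact/po/openT|exists p].
- by move=> _ [q _ <-]; apply: cat_fst; exact: psic.
move=> _ _ [[a b] _ <-] [[c d] _ <-] Cq Cr; rewrite !psiK /= => ->.
have : (phi @^-1` C) (a, b) by [].
have : (phi @^-1` C) (c, d) by [].
by rewrite pC /= => -> ->.
Qed.

Lemma crossing_isolated (C : set S) x : crossing R C x ->
  \forall y \near x, y <> x -> C y -> ~ crossing R C y.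
Proof.
move=> [phi [[pe p0] pC]]; have [psi [psiK psic]] := chart_inverse pe.
have [pi [pc po]] := pe.
have : nbhs x (range phi).
  by apply: open_nbhs_nbhs; split; [exact/po/openT|exists (0, 0)].
apply: filterS => _ [p _ <-] px Cp.
have : cross p by rewrite -pC.
have p_n : p.1 = 0 -> p.2 = 0 -> False.
  by case: p px {Cp} => a b /= px a0 b0; apply: px; rewrite a0 b0.
have ne0 (g : plane R -> R) : continuous g -> g p != 0 -> nbhs (phi p) (phi @` [set q | g q != 0]).
  move=> cg gp; apply: open_nbhs_nbhs; split; last by exists p.
  apply: po; rewrite (_ : [set q | _] = g @^-1` [set z | z != 0]) //.
  by apply: open_comp; [move=> ? _; exact: cg|exact: open_neq].

(* A point of the cross other than its centre lies on one axis only. Removing the other axis leaves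
   an arc, on which the coordinate along the axis is injective. *)
case=> [q1|q2].
  have /ne0 h : p.2 != 0 by apply/eqP => /(p_n q1).
  apply: (@no_crossing_on_arc _ _ _ _ (phi @` [set q | q.2 != 0]) (fun y => (psi y).2)).
  - by apply: h; cts.
  - by move=> _ [q _ <-]; apply: cat_snd; exact: psic.
  move=> _ _ [[a b] /= b0 <-] [[c d] /= d0 <-] Cq Cr; rewrite !psiK /= => bd.
  have : cross (a, b) by rewrite -pC.
  have : cross (c, d) by rewrite -pC.
  case=> /= e; last by rewrite e eqxx in d0.
  by case=> /= e'; [rewrite e e' bd|rewrite e' eqxx in b0].
have /ne0 h : p.1 != 0 by apply/eqP => /p_n /(_ q2).
apply: (@no_crossing_on_arc _ _ _ _ (phi @` [set q | q.1 != 0]) (fun y => (psi y).1)).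
- by apply: h; cts.
- by move=> _ [q _ <-]; apply: cat_fst; exact: psic.
move=> _ _ [[a b] /= b0 <-] [[c d] /= d0 <-] Cq Cr; rewrite !psiK /= => bd.
have : cross (a, b) by rewrite -pC.
have : cross (c, d) by rewrite -pC.
case=> /= e; first by rewrite e eqxx in d0.
by case=> /= e'; [rewrite e' eqxx in b0|rewrite e e' bd].
Qed.

Lemma crossing_with_overW D x : crossing_with_over R D x -> crossing R (curve D) x.
Proof. by move=> [phi [? [? _]]]; exists phi. Qed.

Lemma diagram_of_presents K D : closed K -> (forall q, K q -> -1 < q.2 < 1) ->
  diagram_of K D -> presents K D.
Proof.
move=> cK hK [eC reg] x.
have CK y : curve D y <-> exists z, K (y, z).
  rewrite eC; split=> [[[y' z] ? <-]|[z ?]]; first by exists z.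
  by exists (y, z).
have cKx z : ~ K (x, z) -> \forall q \near (x, z), ~ K q.
  move=> nK; have : open (~` K) by exact: closed_openC.
  by rewrite openE => /(_ _ nK).
have sng y : ~ crossing R (curve D) y -> single_over K y.
  move=> ny z w Kz Kw; case: (reg y); first by apply/CK; exists z.
    by move=> [_ [v [_ v1]]]; rewrite -(v1 z) // -(v1 w).
  by move=> [/crossing_with_overW /ny].
split => //; first by move=> z /hK.
(* Off the curve there is no crossing, since a chart at a crossing sends the centre of the cross to
   the curve. With the empty set as open set, [fibre_usc] shows that the nearby fibres are empty. *)
have [Cx|nCx] := pselect (curve D x); last first.
  left; split.
    move=> [phi [[_ p0] pC]]; apply: nCx; rewrite -p0.
    by rewrite -[curve D _]/((phi @^-1` curve D) _) pC; left.
  have : \forall y \near x, forall z, K (y, z) -> @set0 R z.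
    apply: fibre_usc => //; first by apply: nearW => y z /hK.
    by move=> z Kz; apply: nCx; apply/CK; exists z.
  by apply: filterS => y h z w /h.
case: (reg x Cx) => [[sx _]|[cx [z1 [z2 [z12 [Kx ov]]]]]].
  have nx := simple_no_crossing_near sx.
  by left; split; [exact: nbhs_singleton nx|move: nx; apply: filterS => y /sng].
have cx' := crossing_with_overW cx.
right; split => //; last by exists z1, z2.
move: (crossing_isolated cx'); apply: filterS => y h yx z w Kz.
by apply: sng => //; apply: h => //; apply/CK; exists z.
Qed.

End Regular.

(** * Vertical isotopies *)

Section Step.
Context {R : realType}.
Implicit Types a b c z w : R.

(* The piecewise linear homeomorphism of R that is the identity outside [c, 1] and maps the
   intervals [c, a] and [a, 1] to [c, b] and [b, 1]. *)
Definition step c a b z : R :=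
  Num.min z c + (clamp c a z - c) * ((b - c) / (a - c)) +
  (clamp a 1 z - a) * ((1 - b) / (1 - a)) + (Num.max z 1 - 1).

Lemma step_cat (X : topologicalType) (c a b z : X -> R) x :
  continuous_at x c -> continuous_at x a -> continuous_at x b -> continuous_at x z ->
  c x < a x < 1 -> continuous_at x (fun y => step (c y) (a y) (b y) (z y)).
Proof. by move=> cc ca cb cz /andP[? ?]; rewrite /step; cts => //; lra. Qed.

Lemma clamp_le c a z w : z <= w -> clamp c a z <= clamp c a w.
Proof.
move=> zw; rewrite /clamp ge_max le_max lexx /= le_max; apply/orP; right.
by rewrite le_min !ge_min lexx zw orbT.
Qed.

Lemma clamp_lo c a z : z <= c -> clamp c a z = c.
Proof. by move=> zc; rewrite /clamp max_l // ge_min zc orbT. Qed.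

Lemma clamp_hi c a z : c <= a -> a <= z -> clamp c a z = a.
Proof. by move=> ca az; rewrite /clamp min_l // max_r. Qed.

Section Fixed.
Variables (c a b : R) (ca1 : c < a < 1) (cb1 : c < b < 1).

Lemma step_lo z : z <= c -> step c a b z = z.
Proof.
have /andP[ca a1] := ca1; move=> zc.
by rewrite /step min_l // !clamp_lo ?max_r; lra.
Qed.

Lemma step_hi z : 1 <= z -> step c a b z = z.
Proof.
have /andP[ca a1] := ca1; have /andP[cb b1] := cb1; move=> z1.
rewrite /step min_r ?clamp_hi ?max_l; try lra.
have d1 : a - c != 0 by lra.
have d2 : 1 - a != 0 by lra.
by field; rewrite d1 d2.
Qed.

Lemma step_eq : step c a b a = b.
Proof.
have /andP[ca a1] := ca1; have d1 : a - c != 0 by lra.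
rewrite /step min_r ?(ltW ca) // clamp_hi ?(ltW ca) // clamp_lo // max_r ?(ltW a1) //.
by rewrite [(a - c) * _]mulrC divfK //; lra.
Qed.

Lemma step_lt z w : z < w -> step c a b z < step c a b w.
Proof.
have /andP[ca a1] := ca1; have /andP[cb b1] := cb1; move=> zw.
have p1 : 0 < (b - c) / (a - c) by rewrite divr_gt0; lra.
have p2 : 0 < (1 - b) / (1 - a) by rewrite divr_gt0; lra.
have l1 : Num.min z c <= Num.min w c by rewrite le_min !ge_min lexx (ltW zw) orbT.
have l2 : Num.max z 1 <= Num.max w 1 by rewrite ge_max !le_max lexx (ltW zw) orbT.
have l3 := clamp_le c a (ltW zw); have l4 := clamp_le a 1 (ltW zw).
(* The four truncations of [z] add up to [z] plus a constant, so at least one of them increases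
   strictly; in [step] each has a positive coefficient. *)
have s : Num.min z c + clamp c a z + clamp a 1 z + Num.max z 1 <
         Num.min w c + clamp c a w + clamp a 1 w + Num.max w 1.
  have e u : Num.min u c + clamp c a u + clamp a 1 u + Num.max u 1 = u + c + a + 1.
    have [uc|cu] := leP u c; first by rewrite !clamp_lo ?max_r; lra.
    have [ua|au] := leP u a.
      by rewrite clamp_id ?(ltW cu) // clamp_lo // max_r; lra.
    have [u1|u1] := leP u 1.
      by rewrite clamp_hi ?(ltW au) ?(ltW ca) // clamp_id ?(ltW au) //; lra.
    by rewrite !clamp_hi; lra.
  by rewrite !e; lra.
rewrite /step.
have q1 : (clamp c a z - c) * ((b - c) / (a - c)) <= (clamp c a w - c) * ((b - c) / (a - c)).
  by rewrite ler_pM2r //; lra.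
have q2 : (clamp a 1 z - a) * ((1 - b) / (1 - a)) <= (clamp a 1 w - a) * ((1 - b) / (1 - a)).
  by rewrite ler_pM2r //; lra.
have [e1|n1] := eqVneq (clamp c a z) (clamp c a w); last first.
  have : (clamp c a z - c) * ((b - c) / (a - c)) < (clamp c a w - c) * ((b - c) / (a - c)).
    by rewrite ltr_pM2r // ltrD2r lt_neqAle n1.
  by lra.
have [e2|n2] := eqVneq (clamp a 1 z) (clamp a 1 w); last first.
  have : (clamp a 1 z - a) * ((1 - b) / (1 - a)) < (clamp a 1 w - a) * ((1 - b) / (1 - a)).
    by rewrite ltr_pM2r // ltrD2r lt_neqAle n2.
  by lra.
by rewrite e1 e2; lra.
Qed.

End Fixed.
End Step.

Section HeightExtension.
Context {R : realType} {S : topologicalType} (nS : normal_space S).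

(** By upper semicontinuity of the fibres, the projection of [L] is closed and the height is
    continuous on it; the Tietze theorem, with bound 1, extends it. *)
Lemma height_extension (L : set (S * R)) : closed L -> (forall q, L q -> -1 < q.2 < 1) ->
  (forall y, single_over L y) ->
  exists g : S -> R, continuous g /\ forall y z, L (y, z) -> g y = z.
Proof.
move=> cL hL sL.
pose C : set S := [set y | exists z, L (y, z)].
have usc y (O : set R) : open O -> (forall z, L (y, z) -> O z) ->
    \forall y' \near y, forall z, L (y', z) -> O z.
  apply: fibre_usc; first by apply: nearW => y' z /hL.
  by move=> z nL; have : open (~` L) by [exact: closed_openC]; rewrite openE => /(_ _ nL).
have cC : closed C.
  rewrite -openC openE => y nCy.
  have := usc y set0 open0 (fun z Lz => nCy (ex_intro _ z Lz)).
  by apply: filterS => y' h [z /h].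
have [|g0 g0P] := @boolp.choice S R (fun y z => C y -> L (y, z)).
  by move=> y; have [[z Lz]|n] := pselect (C y); [exists z|exists 0].
have g0L y z : L (y, z) -> g0 y = z by move=> Lz; apply: (sL y) => //; apply: g0P; exists z.
have [|y Cy|g [g0g cg _]] := @continuous_bounded_extension S R nS C cC g0 1 ltr01.
- apply/subspace_continuousP => y Cy; apply/cvgrPdist_lt => e e0.
  have : \forall y' \near y, forall z, L (y', z) -> ball (g0 y) e z.
    apply: usc; first exact: ball_open.
    by move=> z /g0L <-; exact: ballxx.
  move=> h; rewrite near_withinE; move: h; apply: filterS => y' h Cy'.
  by have := h _ (g0P _ Cy').
- have /andP[? ?] := hL _ (g0P _ Cy); rewrite ler_norml.
  by apply/andP; split; rewrite ltW.
exists g; split => // y z Lz.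
by rewrite -g0g ?(g0L _ _ Lz) // inE; exists z.
Qed.

End HeightExtension.

(** * Matching the fibres of two links with the same diagram *)

Section Matching.
Context {R : realType} {S : topologicalType}.
Implicit Types (K N : set (S * R)) (D : diagram S) (E : S * R -> R).

(* Two links with the same diagram have fibres of the same cardinality, at most two, and
   [matched] is the increasing bijection between them.  Unlike its existence, the condition
   that a map realizes it is convex, so local solutions can be glued. *)
Definition matched K N y (z w : R) :=
  [/\ K (y, z), N (y, w) &
    (exists z', z' < z /\ K (y, z')) <-> (exists w', w' < w /\ N (y, w'))].

(** Whether [y] is a crossing depends on [D] alone and decides the cardinality of both fibres; the
    clause on lower points then pairs lower with lower and upper with upper. *)
Lemma matched_total K N D y z : presents_at K D y -> presents_at N D y -> K (y, z) ->
  exists w, matched K N y z w.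
Proof.
move=> [_ _ CK sK] [_ _ CN sN] Kz.
have [w0 Nw0] : exists w, N (y, w) by apply/CN/CK; exists z.
case: sK => [[nc /nbhs_singleton sK]|[cy _ [z1 [z2 [z12 Kx _]]]]].
  case: sN => [[_ /nbhs_singleton sN]|[/nc //]].
  exists w0; split => //; split=> -[v [vz hv]].
    by move: vz; rewrite (sK _ _ hv Kz) ltxx.
  by move: vz; rewrite (sN _ _ hv Nw0) ltxx.
case: sN => [[/(_ cy) //]|[_ _ [w1 [w2 [w12 Nx _]]]]].
have nlow (v1 v2 : R) (F : set R) : v1 < v2 -> (forall v, F v <-> v = v1 \/ v = v2) ->
    ~ (exists v', v' < v1 /\ F v').
  by move=> v12 h [v' [lt /h[e|e]]]; move: lt; rewrite e ?ltxx // ltNge (ltW v12).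
case/Kx: Kz => ->; [exists w1|exists w2]; (split; [by apply/Kx; tauto|by apply/Nx; tauto|]).
  split=> h; first by case: (nlow z1 z2 (fun z => K (y, z))).
  by case: (nlow w1 w2 (fun z => N (y, z))).
by split=> _; [exists w1|exists z1]; (split => //); [apply/Nx|apply/Kx]; left.
Qed.

Lemma matched_sym K N y z w : matched K N y z w -> matched N K y w z.
Proof. by move=> [? ? [? ?]]; split => //; split. Qed.

Definition matches K N E y := forall z w, matched K N y z w -> E (y, z) = w.

(* Vertical homeomorphisms of [S * R] fixing the complement of [O * ]-1, 1[]. *)
Definition vertical (O : set S) E := [/\ continuous E,
  forall y z w, z < w -> E (y, z) < E (y, w),
  forall y z, 1 <= `|z| -> E (y, z) = z &
  forall y z, ~ O y -> E (y, z) = z].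

Hypothesis nS : normal_space S.

Definition local_vertical (U : set S) E := [/\
  forall y z, U y -> continuous_at (y, z) E,
  forall y z w, U y -> z < w -> E (y, z) < E (y, w) &
  forall y z, U y -> 1 <= `|z| -> E (y, z) = z].

(** Cutting by the closed sets [V] and [I] isolates one sheet and makes it closed in the product,
    although [K] is controlled only over [V]. *)
Lemma sheet_height K (V : set S) (I : set R) : closed V -> closed I ->
  (forall y z, V y -> K (y, z) -> -1 < z < 1) ->
  (forall y z, V y -> ~ K (y, z) -> \forall q \near (y, z), ~ K q) ->
  (forall y z w, V y -> I z -> I w -> K (y, z) -> K (y, w) -> z = w) ->
  exists g : S -> R, continuous g /\ forall y z, V y -> I z -> K (y, z) -> g y = z.
Proof.
move=> cV cI hK cK sK; pose L := K `&` (V `*` I).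
have [||y z w [/= Kz [/= Vy Iz]] [/= Kw [_ /= Iw]]|g [cg gL]] := @height_extension R S nS L.
- rewrite -openC openE => -[y z] nL.
  have oV : open (~` V) by exact: closed_openC.
  have oI : open (~` I) by exact: closed_openC.
  have [Vy|nVy] := pselect (V y); last first.
    exists (~` V, setT); first by split; [exact: open_nbhs_nbhs|exact: filterT].
    by move=> [y' z'] [/= nV _] [_ [/= ? _]].
  have [Iz|nIz] := pselect (I z); last first.
    exists (setT, ~` I); first by split; [exact: filterT|exact: open_nbhs_nbhs].
    by move=> [y' z'] [_ /= nI] [_ [_ /= ?]].
  have /(cK _ _ Vy) : ~ K (y, z) by move=> Kz; apply: nL.
  by apply: filterS => q nK [].
- by move=> [y z] [Kz [Vy _]]; exact: hK Kz.
- exact: sK Kz Kw.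
by exists g; split => // y z Vy Iz Kz; apply: gL.
Qed.

Hypothesis hS : hausdorff_space S.

Lemma bump_function (x : S) (U : set S) : nbhs x U -> exists f : S -> R,
  [/\ continuous f, forall y, 0 <= f y <= 1, f x = 1 & forall y, ~ U y -> f y = 0].
Proof.
rewrite nbhsE => -[V [oV Vx] VU].
have c1 : closed [set x] by apply: accessible_closed_set1; exact: hausdorff_accessible.
have [||f [cf f1 f0 f01]] := @urysohn_ext_itv S R nS [set x] (~` V) 0 1 c1 _ _ ltr01.
- exact: open_closedC.
- by apply/seteqP; split=> // y [-> ].
exists (fun y => 1 - f y); split.
- by cts.
- by move=> y; have := f01 (f y) (ex_intro2 _ _ y I erefl); rewrite /= in_itv /=; lra.
- by rewrite (f1 (f x)) ?subr0 //; exists x.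
- by move=> y nU; rewrite (f0 (f y)) ?subrr //; exists y => // /VU.
Qed.

Lemma closed_nbhs_in (x : S) (U : set S) : nbhs x U ->
  exists V, [/\ closed V, nbhs x V & V `<=` U].
Proof.
move=> /bump_function[f [cf _ fx f0]]; exists [set y | 1 / 2 <= f y]; split.
- apply: (@closed_comp _ _ f [set z | 1 / 2 <= z]); first by move=> *; exact: cf.
  exact: closed_ge.
- have : \forall y \near x, 1 / 2 < f y.
    by apply: (@cat_lt _ _ _ (fun=> 1 / 2) f); [cts|exact: cf|rewrite fx; lra].
  by apply: filterS => y /ltW.
- by move=> y /= h; have [//|/f0 e] := pselect (U y); move: h; rewrite e; lra.
Qed.

(** Continuous height functions of the sheets of both links are carried to each other by [step]. One
    step is enough away from crossings; at a crossing a second step adjusts the upper sheet and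
    fixes what lies below the lower one. *)
Lemma local_match K N D (x : S) (O : set S) : nbhs x O ->
  (forall y, O y -> presents_at K D y) -> (forall y, O y -> presents_at N D y) ->
  exists U E, [/\ nbhs x U, U `<=` O, local_vertical U E & forall y, U y -> matches K N E y].
Proof.
move=> Ox pK pN; have Ox' := nbhs_singleton Ox.
have [hKx cKx CKx sK] := pK _ Ox'; have [hNx cNx CNx sN] := pN _ Ox'.
have hh M : (forall y, O y -> presents_at M D y) ->
    \forall y \near x, forall z, M (y, z) -> -1 < z < 1.
  by move=> p; move: Ox; apply: filterS => y /p[].
case: sK => [[nx sK]|[cx sK [z1 [z2 [z12 Kx ovK]]]]].
  case: sN => [[_ sN]|[/nx //]].
  have [Kex|nK] := pselect (exists z, K (x, z)); last first.
    have ne : \forall y \near x, forall z, K (y, z) -> @set0 R z.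
      apply: fibre_usc => //; first exact: hh.
      by move=> z Kz; apply: nK; exists z.
    exists (O `&` [set y | forall z, K (y, z) -> @set0 R z]), snd; split.
    - exact: filterI.
    - by move=> y [].
    - by split => //= y z _; cts.
    - by move=> y [_ h] z w [/h].
  have [V [cV Vx VO]] := closed_nbhs_in (filterI Ox (filterI sK sN)).
  have [|||g [cg gK]] := @sheet_height K V setT cV (@closedT R).
  - by move=> y z /VO[/pK[+ _ _ _] _]; apply.
  - by move=> y z /VO[/pK[_ + _ _] _]; apply.
  - by move=> y z w /VO[_ [+ _]] _ _; apply.
  have [|||h [ch hN]] := @sheet_height N V setT cV (@closedT R).
  - by move=> y z /VO[/pN[+ _ _ _] _]; apply.
  - by move=> y z /VO[/pN[_ + _ _] _]; apply.
  - by move=> y z w /VO[_ [_ +]] _ _; apply.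
  have Vx' := nbhs_singleton Vx.
  have [z Kz] := Kex; have [w Nw] : exists w, N (x, w) by apply/CNx/CKx.
  have gx : -1 < g x < 1 by rewrite (gK x z) //; exact: hKx.
  have hx : -1 < h x < 1 by rewrite (hN x w) //; exact: hNx.
  pose W : set S := [set y | [/\ -1 < g y < 1 & -1 < h y < 1]].
  have Wx : nbhs x W.
    have [/andP[? ?] /andP[? ?]] := (gx, hx).
    have n1 : \forall y \near x, -1 < g y by apply: (@cat_lt _ _ _ (fun=> -1) g); cts.
    have n2 : \forall y \near x, g y < 1 by apply: (@cat_lt _ _ _ g (fun=> 1)); cts.
    have n3 : \forall y \near x, -1 < h y by apply: (@cat_lt _ _ _ (fun=> -1) h); cts.
    have n4 : \forall y \near x, h y < 1 by apply: (@cat_lt _ _ _ h (fun=> 1)); cts.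
    by near=> y; split; apply/andP; split; near: y.
  exists (V `&` W), (fun q => step (-1) (g q.1) (h q.1) q.2); split.
  - exact: filterI.
  - by move=> y [/VO[]].
  - split=> [y v [_ [gy hy]]|y v u [_ [gy hy]]|y v [_ [gy hy]]] /=.
    + apply: (@step_cat _ _ (fun=> -1) (fun q : S * R => g q.1) (fun q : S * R => h q.1)
        (fun q : S * R => q.2)) => //=; cts.
    + exact: step_lt.
    + by rewrite ler_normr => /orP[?|?]; [rewrite step_hi|rewrite step_lo //; lra].
  - move=> y [Vy [gy hy]] v u [/(gK _ _ Vy I) <- /(hN _ _ Vy I) <- _].
    exact: step_eq.
case: sN => [[/(_ cx) //]|[_ sN [w1 [w2 [w12 Nx ovN]]]]].
(* Heights separating the two points of each fibre over the crossing. Near [x] the links avoid them,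
   so each link splits into a lower and an upper part, both with a continuous height. *)
pose m := (z1 + z2) / 2; pose n := (w1 + w2) / 2.
have zm : z1 < m < z2 by rewrite /m; lra.
have wn : w1 < n < w2 by rewrite /n; lra.
have avoid M (p : R) : (forall y, O y -> presents_at M D y) -> ~ M (x, p) ->
    \forall y \near x, forall z, M (y, z) -> z != p.
  move=> pM nM; have [_ cM _ _] := pM _ Ox'.
  apply: (@fibre_usc _ _ _ _ [set z : R | z != p]) => //; first exact: hh.
  by move=> z Mz; apply/eqP => e; apply: nM; rewrite -e.
have aK : \forall y \near x, forall z, K (y, z) -> z != m.
  by apply: avoid => // /Kx[e|e]; move: zm; rewrite e ltxx ?andbF.
have aN : \forall y \near x, forall z, N (y, z) -> z != n.
  by apply: avoid => // /Nx[e|e]; move: wn; rewrite e ltxx ?andbF.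
have [V [cV Vx VO]] := closed_nbhs_in (filterI Ox (filterI (filterI sK sN)
  (filterI (filterI aK aN) (filterI (ovK _ zm) (ovN _ wn))))).
have Vx' := nbhs_singleton Vx.
have half M v1 v2 p (I : set R) : closed I -> (forall y, O y -> presents_at M D y) ->
    (forall y, V y -> y <> x -> single_over M y) -> (forall z, M (x, z) <-> z = v1 \/ z = v2) ->
    (forall y, V y -> forall z, M (y, z) -> z != p) -> v1 < p < v2 ->
    (forall z, I z -> z <= p) \/ (forall z, I z -> p <= z) ->
    exists g : S -> R, continuous g /\ forall y z, V y -> I z -> M (y, z) -> g y = z.
  move=> cI pM sM Mx aM /andP[vp pv] Ip; apply: sheet_height => //.
  - by move=> y z /VO[/pM[+ _ _ _] _]; apply.
  - by move=> y z /VO[/pM[_ + _ _] _]; apply.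
  move=> y z w Vy Iz Iw Mz Mw; have [yx|yx] := pselect (y = x); last exact: (sM y).
  move: Mz Mw Iz Iw; rewrite yx => /Mx[->|->] /Mx[->|->] //; case: Ip => Ip /Ip h1 /Ip h2; lra.
have [VsK VsN] : (forall y, V y -> y <> x -> single_over K y) /\
    (forall y, V y -> y <> x -> single_over N y) by split=> y /VO[_ [[? ?] _]].
have [VaK VaN] : (forall y, V y -> forall z, K (y, z) -> z != m) /\
    (forall y, V y -> forall z, N (y, z) -> z != n) by split=> y /VO[_ [_ [[? ?] _]]].
have [VoK VoN] : (forall y, V y -> overstrand D y <-> exists z, m < z /\ K (y, z)) /\
    (forall y, V y -> overstrand D y <-> exists z, n < z /\ N (y, z)).
  by split=> y /VO[_ [_ [_ [? ?]]]].
have [g1 [cg1 g1K]] := half K z1 z2 m _ (@closed_le R m) pK VsK Kx VaK zm (or_introl (fun z h => h)).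
have [g2 [cg2 g2K]] := half K z1 z2 m _ (@closed_ge R m) pK VsK Kx VaK zm (or_intror (fun z h => h)).
have [h1 [ch1 h1N]] := half N w1 w2 n _ (@closed_le R n) pN VsN Nx VaN wn (or_introl (fun z h => h)).
have [h2 [ch2 h2N]] := half N w1 w2 n _ (@closed_ge R n) pN VsN Nx VaN wn (or_intror (fun z h => h)).
have [Kz1 Kz2] : K (x, z1) /\ K (x, z2) by split; apply/Kx; tauto.
have [Nw1 Nw2] : N (x, w1) /\ N (x, w2) by split; apply/Nx; tauto.
have [e1 e2] : g1 x = z1 /\ g2 x = z2.
  by split; [apply: g1K|apply: g2K] => //=; apply/ltW; case/andP: zm.
have [e3 e4] : h1 x = w1 /\ h2 x = w2.
  by split; [apply: h1N|apply: h2N] => //=; apply/ltW; case/andP: wn.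
pose good y := [/\ -1 < g1 y, g1 y < g2 y & g2 y < 1] /\
               [/\ -1 < h1 y, h1 y < h2 y & h2 y < 1].
have goodx : \forall y \near x, good y.
  have /andP[? _] := hKx _ Kz1; have /andP[_ ?] := hKx _ Kz2.
  have /andP[? _] := hNx _ Nw1; have /andP[_ ?] := hNx _ Nw2.
  have n1 : \forall y \near x, -1 < g1 y.
    by apply: (@cat_lt _ _ _ (fun=> -1) g1); cts; rewrite e1.
  have n2 : \forall y \near x, g1 y < g2 y.
    by apply: (@cat_lt _ _ _ g1 g2); cts; rewrite e1 e2.
  have n3 : \forall y \near x, g2 y < 1.
    by apply: (@cat_lt _ _ _ g2 (fun=> 1)); cts; rewrite e2.
  have n4 : \forall y \near x, -1 < h1 y.
    by apply: (@cat_lt _ _ _ (fun=> -1) h1); cts; rewrite e3.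
  have n5 : \forall y \near x, h1 y < h2 y.
    by apply: (@cat_lt _ _ _ h1 h2); cts; rewrite e3 e4.
  have n6 : \forall y \near x, h2 y < 1.
    by apply: (@cat_lt _ _ _ h2 (fun=> 1)); cts; rewrite e4.
  by near=> y; split; split; near: y.
(* The height at which the first step leaves the upper sheet of [K]; the second step moves it from
   there to [h2 y], between the fixed levels [h1 y] and 1. *)
pose mid y := step (-1) (g1 y) (h1 y) (g2 y).
have gy1 y : good y -> -1 < g1 y < 1 by move=> [[? ? ?] _]; lra.
have gy2 y : good y -> -1 < h1 y < 1 by move=> [_ [? ? ?]]; lra.
have gmid y : good y -> h1 y < mid y < 1.
  move=> gy; have [[? ? ?] _] := gy.
  rewrite -{1}(step_eq (h1 y) (gy1 y gy)) step_lt ?gy1 ?gy2 //=.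
  by rewrite -[ltRHS](step_hi (gy1 y gy) (gy2 y gy) (lexx 1)) step_lt ?gy1 ?gy2.
have gy3 y : good y -> h1 y < h2 y < 1 by move=> [_ [? ? ?]]; lra.
exists (V `&` good), (fun q => step (h1 q.1) (mid q.1) (h2 q.1) (step (-1) (g1 q.1) (h1 q.1) q.2)).
split.
- exact: filterI.
- by move=> y [/VO[]].
- split=> [y v [_ gy]|y v u [_ gy] vu|y v [_ gy]] /=.
  + apply: (@step_cat _ _ (fun q : S * R => h1 q.1) (fun q : S * R => mid q.1)
      (fun q : S * R => h2 q.1) (fun q : S * R => step (-1) (g1 q.1) (h1 q.1) q.2));
      rewrite /= ?gmid //; cts.
    * apply: (@step_cat _ _ (fun=> -1) (fun q : S * R => g1 q.1) (fun q : S * R => h1 q.1)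
        (fun q : S * R => g2 q.1)); rewrite /= ?gy1 //; cts.
    * apply: (@step_cat _ _ (fun=> -1) (fun q : S * R => g1 q.1) (fun q : S * R => h1 q.1)
        (fun q : S * R => q.2)); rewrite /= ?gy1 //; cts.
  + by rewrite step_lt ?gmid ?gy3 // step_lt ?gy1 ?gy2.
  + have [_ [? ? ?]] := gy.
    rewrite ler_normr => /orP[?|?]; first by rewrite !step_hi ?gy1 ?gy2 ?gmid ?gy3.
    by rewrite (step_lo _ (gy1 y gy)) ?(step_lo _ (gmid y gy)) //; lra.
- move=> y [Vy gy] z w [Kz Nw lo].
  suff [[zm' wn']|[zm' wn']] : (z < m /\ w < n) \/ (m < z /\ n < w).
  + have <- : g1 y = z by apply: g1K => //; exact: ltW.
    have <- : h1 y = w by apply: h1N => //; exact: ltW.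
    by rewrite /= step_eq ?gy1 // step_lo ?gmid.
  + have <- : g2 y = z by apply: g2K => //; exact: ltW.
    have <- : h2 y = w by apply: h2N => //; exact: ltW.
    by rewrite /= -/(mid y) step_eq ?gmid.
  have [yx|yx] := pselect (y = x).
    move: lo Kz Nw; rewrite yx => lo /Kx ez /Nx ew.
    have lz : z = z2 <-> exists w', w' < w /\ N (x, w').
      rewrite -lo; split=> [->|[z' [z'z /Kx]]]; first by exists z1.
      by case: ez z'z => -> // + [] e; rewrite e ?ltxx // ltNge (ltW z12).
    case: ez => ez; case: ew => ew; rewrite ?ez ?ew; try by [lra].
    - by have /lz : exists w', w' < w /\ N (x, w') by [exists w1; rewrite ew]; lra.
    - have /lz[w' [w'w /Nx []]] := ez; lra.
  have := VaK _ Vy _ Kz; have := VaN _ Vy _ Nw; rewrite !neq_lt.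
  (* Away from [x] the fibres are single points and their order says nothing. The over-strand
     information, common to both links, tells whether this point is above or below in each of
     them. *)
  have [ov|nov] := pselect (overstrand D y).
    have /(VoK _ Vy)[z' [mz' /(VsK _ Vy yx _ _ Kz) ez']] := ov.
    have /(VoN _ Vy)[w' [nw' /(VsN _ Vy yx _ _ Nw) ew']] := ov.
    by move=> _ _; right; rewrite ez' ew'.
  move=> /orP[wn'|wn'] /orP[zm'|zm']; first by left.
  - by case: nov; apply/(VoK _ Vy); exists z.
  - by case: nov; apply/(VoN _ Vy); exists w.
  - by right.
Unshelve. all: by end_near. Qed.

End Matching.

Section VerticalMatch.
Context {R : realType} {S : topologicalType}.
Hypotheses (nS : normal_space S) (hS : hausdorff_space S).
Implicit Types (K N : set (S * R)) (D : diagram S) (E : S * R -> R).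

(** An increasing map that fixes -1 and 1 preserves the interval of length 2 between them. *)
Lemma vertical_bound (e : R -> R) : (forall z w, z < w -> e z < e w) ->
  (forall z, 1 <= `|z| -> e z = z) -> forall z, `|e z - z| <= 2.
Proof.
move=> me fe z; have [z1|z1] := leP 1 `|z|; first by rewrite fe // subrr normr0.
move: z1; rewrite ltr_norml => /andP[h1 h2].
have := me _ _ h1; have := me _ _ h2.
rewrite (fe 1) ?(fe (-1)) ?normrN ?normr1 // => h3 h4.
by rewrite ler_norml; apply/andP; split; lra.
Qed.

Lemma vertical_inverse (O : set S) E : vertical O E -> exists G, [/\ vertical O G,
  forall y z, G (y, E (y, z)) = z & forall y z, E (y, G (y, z)) = z].
Proof.
move=> [cE mE fE oE].
have [G [cG GE EG]] := increasing_inverse cE mE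
  (fun y => vertical_bound (mE y) (fE y)).
exists G; split => //; split => // [y z w zw|y z z1|y z Oy].
- rewrite ltNge le_eqVlt; apply/negP => /orP[/eqP e|/(mE y)].
    by move: zw; rewrite -(EG y z) -e EG ltxx.
  by rewrite !EG ltNge (ltW zw).
- by rewrite -{1}(fE y z z1) GE.
- by rewrite -{1}(oE y z Oy) GE.
Qed.

(** The near-covering form of compactness, for the filter of finite sequences ordered by
    inclusion. *)
Lemma finite_cover (A : set S) (W : S -> set S) : compact A ->
  (forall x, A x -> nbhs x (W x)) ->
  exists s : seq S, forall y, A y -> exists x, [/\ x \in s, A x & W x y].
Proof.
move=> /compact_near_coveringP cA AW.
pose F := filter_from setT (fun s : seq S => [set s' : seq S | {subset s <= s'}]).
have FF : Filter F.
  apply: filter_from_filter; first by exists [::].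
  move=> s t _ _; exists (s ++ t) => // u /= h.
  by split=> x xs; apply: h; rewrite mem_cat xs ?orbT.
have [|s _ h] := cA (seq S) F (fun s y => exists x, [/\ x \in s, A x & W x y]) FF.
  move=> x Ax; exists (W x, [set s : seq S | x \in s]) => /=.
    split; first exact: AW.
    by exists [:: x] => // s; apply; rewrite inE.
  by move=> [y s] [/= Wy xs]; exists x.
by exists s => y Ay; exact: (h s).
Qed.

(* The new map is a convex combination of [E] and of a local solution; it still matches
   wherever [E] did. *)
Lemma match_extend K N D (x : S) (O : set S) : open O -> O x ->
  (forall y, O y -> presents_at K D y) -> (forall y, O y -> presents_at N D y) ->
  exists W : set S, [/\ open W, W x & forall (A : set S) E, vertical O E ->
    (forall y, A y -> matches K N E y) ->
    exists E', vertical O E' /\ forall y, A y \/ W y -> matches K N E' y].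
Proof.
move=> oO Ox pK pN.
have [U [F [Ux UO [cF mF fF] KNF]]] := local_match nS hS (open_nbhs_nbhs (conj oO Ox)) pK pN.
have [f [cf f01 fx f0]] := @bump_function R S nS hS x U Ux.
(* The weight is 1 on the open set where [f] exceeds 1/2, which serves as [W], and 0 outside [U]. *)
pose phi y := Num.min 1 (2 * f y).
have cphi : continuous phi by rewrite /phi; cts.
have phi01 y : 0 <= phi y <= 1.
  by rewrite /phi le_min ge_min lexx ler01 /=; have := f01 y; lra.
have phi0 y : ~ U y -> phi y = 0 by move=> /f0 e; rewrite /phi e mulr0 min_r.
exists (f @^-1` [set z | 1 / 2 < z]); split.
- by apply: open_comp; [move=> *; exact: cf|exact: open_gt].
- by rewrite /= fx; lra.
move=> A E [cE mE fE oE] mA.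
pose E' q := E q + phi q.1 * (F q - E q).
have E'U y z : ~ U y -> E' (y, z) = E (y, z).
  by move=> /phi0 h; rewrite /E' /= h mul0r addr0.
exists E'; split; first split.
- move=> [y z]; apply: cat_add; first exact: cE.
  have [Uy|nUy] := pselect (U y); first by cts; exact: cF.
  (* Outside [U] nothing is known about [F], but the weight tends to 0 there, and over [U] both [E]
     and [F] are within 2 of the height, so they differ by at most 4. *)
  apply: cat_normP => e e0; rewrite /= (phi0 y) // mul0r.
  have : \forall q \near (y, z), `|phi q.1 - phi y| < e / 4.
    apply: (@cat_norm_lt _ _ (y, z) (fun q => phi q.1)); last by lra.
    by cts.
  apply: filterS => -[y' z'] /=; rewrite (phi0 y) // !subr0.
  have [Uy'|/phi0 -> _] := pselect (U y'); last by rewrite mul0r normr0.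
  have /andP[p0 _] := phi01 y'; rewrite ger0_norm // normrM ger0_norm // => h.
  have b1 := vertical_bound (mE y') (fE y') z'.
  have b2 := vertical_bound (fun z w => mF y' z w Uy') (fun z => fF y' z Uy') z'.
  have : `|F (y', z') - E (y', z')| <= 4.
    by move: b1 b2; rewrite !ler_norml => /andP[? ?] /andP[? ?]; apply/andP; split; lra.
  by have := normr_ge0 (F (y', z') - E (y', z')); nra.
- move=> y z w zw; have [Uy|nUy] := pselect (U y); last by rewrite !E'U // mE.
  rewrite /E' /=; have h1 := mE y _ _ zw; have h2 := mF y _ _ Uy zw.
  have /andP[p0 p1] := phi01 y; move: h1 h2.
  move: (E (y, z)) (E (y, w)) (F (y, z)) (F (y, w)) (phi y) p0 p1.
  clear; move=> a b c d t t0 t1 ab cd.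
  have [t2|t2] := leP t (1 / 2); nra.
- move=> y z z1; have [Uy|nUy] := pselect (U y); last by rewrite E'U // fE.
  by rewrite /E' fE // fF // subrr mulr0 addr0.
- by move=> y z nO; rewrite E'U ?oE // => /UO.
move=> y Ay z w mzw; have [Uy|nUy] := pselect (U y); last first.
  rewrite E'U //; case: Ay => [/mA|]; first exact.
  by rewrite /= f0 //; lra.
rewrite /E' (KNF y Uy z w mzw); case: Ay => [/mA h|/= h].
  by rewrite (h _ _ mzw) subrr mulr0 addr0.
rewrite /= (_ : phi y = 1); first by ring.
by rewrite /phi min_l //; lra.
Qed.

(** [match_extend] is iterated along a finite cover of [A]. Both inclusions of fibres follow,
    because [matched] is symmetric in the two links and the map is injective on each fibre. *)
Lemma vertical_match K N D (A O : set S) : open O -> compact A -> A `<=` O ->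
  (forall y, O y -> presents_at K D y) -> (forall y, O y -> presents_at N D y) ->
  exists E, vertical O E /\ forall y, A y -> forall z, K (y, z) <-> N (y, E (y, z)).
Proof.
move=> oO cA AO pK pN.
have [|W WP] := @boolp.choice S (set S) (fun x W => O x ->
    [/\ open W, W x & forall (A : set S) E, vertical O E ->
    (forall y, A y -> matches K N E y) ->
    exists E', vertical O E' /\ forall y, A y \/ W y -> matches K N E' y]).
  move=> x; have [Ox|] := pselect (O x); last by exists set0.
  by have [W ?] := match_extend oO Ox pK pN; exists W.
have [|s cov] := finite_cover (W := W) cA.
  by move=> x /AO /WP[oW Wx _]; exact: open_nbhs_nbhs.
have [E [vE mE]] : exists E, vertical O E /\
    forall y, (exists x, [/\ x \in s, A x & W x y]) -> matches K N E y.
  elim: s {cov} => [|x s [E [vE mE]]].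
    exists snd; split; last by move=> y [x []].
    by split => //; cts.
  have [Ax|nAx] := pselect (A x); last first.
    exists E; split => // y [x' [+ Ax' Wy]]; rewrite inE => /orP[/eqP e|x's].
      by case: nAx; rewrite -e.
    by apply: mE; exists x'.
  have [_ _ /(_ _ _ vE mE)[E' [vE' mE']]] := WP x (AO _ Ax).
  exists E'; split => // y [x' [+ Ax' Wy]].
  rewrite inE => /orP[/eqP e|x's]; first by apply: mE'; right; rewrite -e.
  by apply: mE'; left; exists x'.
exists E; split => // y Ay z; have Oy := AO _ Ay.
have my : matches K N E y by apply: mE; exact: cov.
split=> [Kz|NE].
  have [w mw] := matched_total (pK y Oy) (pN y Oy) Kz.
  by rewrite (my _ _ mw); case: mw.
have [w /matched_sym mw] := matched_total (pN y Oy) (pK y Oy) NE.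
have [_ mono _ _] := vE; have Ew := my _ _ mw.
suff -> : z = w by case: mw.
by apply/eqP/negP => /negP; rewrite neq_lt => /orP[] /(mono y); rewrite Ew ltxx.
Qed.

Lemma vertical_presents (O : set S) K N D E x : vertical O E ->
  (forall y z, K (y, z) <-> N (y, E (y, z))) -> presents_at K D x -> presents_at N D x.
Proof.
move=> vE KN [hK cK CK sK].
have [G [[cG mG fG _] GE EG]] := vertical_inverse vE.
have [cE mE fE _] := vE.
have NK y z : N (y, z) <-> K (y, G (y, z)) by rewrite KN EG.
have sNK y : single_over K y -> single_over N y.
  by move=> s z w /NK h1 /NK h2; rewrite -(EG y z) -(EG y w) (s _ _ h1 h2).
split.
- move=> z /NK /hK /andP[h1 h2]; apply/andP.
  have := mE x _ _ h1; have := mE x _ _ h2.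
  by rewrite !EG (fE x 1) ?(fE x (-1)) ?normrN ?normr1.
- move=> z; rewrite NK => /cK h.
  have : \forall q \near (x, z), ~ K (q.1, G q).
    by apply: (@cat_pair _ _ _ (@fst S R) G (x, z) _ (cG (x, z)) _ h); exact: cvg_fst.
  by apply: filterS => -[y w] /= nK; rewrite NK.
- rewrite CK; split=> -[z Kz]; first by exists (E (x, z)); apply/KN.
  by exists (G (x, z)); apply/NK.
case: sK => [[nx sK]|[cx sK [z1 [z2 [z12 Kx ov]]]]].
  by left; split => //; move: sK; apply: filterS => y /sNK.
right; split => //; first by move: sK; apply: filterS => y h /h /sNK.
exists (E (x, z1)), (E (x, z2)); split; first exact: mE.
  move=> z; rewrite NK Kx; split=> [[] <-|[] ->]; rewrite ?EG ?GE; tauto.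
move=> m /andP[zm mz].
have m1 : z1 < G (x, m) by rewrite -(GE x z1); exact: mG.
have m2 : G (x, m) < z2 by rewrite -(GE x z2); exact: mG.
(* The horizontal level [m] is pulled back to a level [G (y, m)] that varies with [y]. It is
   squeezed between two constant levels, at which the over-strand is known. *)
pose a := (z1 + G (x, m)) / 2; pose b := (G (x, m) + z2) / 2.
have oa : z1 < a < z2 by rewrite /a; lra.
have ob : z1 < b < z2 by rewrite /b; lra.
have na : \forall y \near x, a < G (y, m).
  by apply: (@cat_lt _ _ _ (fun=> a) (fun y => G (y, m))); rewrite /a; cts; lra.
have nb : \forall y \near x, G (y, m) < b.
  by apply: (@cat_lt _ _ _ (fun y => G (y, m)) (fun=> b)); rewrite /b; cts; lra.
have := ov _ oa; have := ov _ ob; move=> hb ha.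
near=> y.
have h1 : overstrand D y <-> exists z, a < z /\ K (y, z) by near: y.
have h2 : overstrand D y <-> exists z, b < z /\ K (y, z) by near: y.
have h3 : a < G (y, m) by near: y.
have h4 : G (y, m) < b by near: y.
split.
  move=> /h2[z [bz Kz]]; exists (E (y, z)); split; last exact/KN.
  by rewrite -(EG y m); apply: mE; exact: lt_trans bz.
move=> [z [mz' /NK Kz]]; apply/h1; exists (G (y, z)); split => //.
by apply: lt_trans h3 _; exact: mG.
Unshelve. all: by end_near. Qed.

End VerticalMatch.

(** * Isotopies of weaves; the torus *)

Section StrongIsotopy.
Context {R : realType}.
Implicit Types (W : set (plane R * R)).

(** Stronger than [weave_equiv]: the maps are global in space and time and the inverse is jointly
    continuous, which makes the relation symmetric and transitive by mere algebra. Times outside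
    [[0, 1]] are usually filled in by [clamp]. *)
Definition strongly_isotopic W W' := exists H G : R * (plane R * R) -> plane R * R,
  [/\ continuous H, continuous G, forall t x, G (t, H (t, x)) = x &
    forall t x, H (t, G (t, x)) = x] /\
  [/\ forall t x, slab x -> slab (H (t, x)), forall t x, slab x -> slab (G (t, x)),
    forall x, H (0, x) = x & forall x, W x <-> W' (H (1, x))].

Lemma strongly_isotopic_refl W : strongly_isotopic W W.
Proof. by exists snd, snd; split; split => //; cts. Qed.

Lemma strongly_isotopic_sym W W' : strongly_isotopic W W' -> strongly_isotopic W' W.
Proof.
move=> [H [G [[cH cG GH HG] [sH sG H0 HW]]]]; exists G, H; split; split => //.
  by move=> x; rewrite -[X in G (0, X)]H0 GH.
by move=> x; rewrite HW HG.
Qed.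

Lemma strongly_isotopic_trans W1 W2 W3 :
  strongly_isotopic W1 W2 -> strongly_isotopic W2 W3 -> strongly_isotopic W1 W3.
Proof.
move=> [H [G [[cH cG GH HG] [sH sG H0 HW]]]] [H' [G' [[cH' cG' GH' HG'] [sH' sG' H0' HW']]]].
exists (fun q => H' (q.1, H (q.1, q.2))), (fun q => G (q.1, G' (q.1, q.2))).
split; split => /=.
- by cts.
- by cts.
- by move=> t x; rewrite GH' GH.
- by move=> t x; rewrite HG HG'.
- by move=> t x /sH /sH'; apply.
- by move=> t x /sG' /sG; apply.
- by move=> x; rewrite H0 H0'.
- by move=> x; rewrite HW HW'.
Qed.

Lemma strongly_isotopic_weave_equiv W W' : strongly_isotopic W W' -> weave_equiv W W'.
Proof.
move=> [H [G [[cH cG GH HG] [sH sG H0 HW]]]].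
exists (fun t x => H (t, x)); split; first split; last first.
- apply/seteqP; split=> [_ [x Wx <-]|x W'x]; first exact/HW.
  by exists (G (1, x)); rewrite ?HG // HW HG.
- split=> [t _|x _]; last exact: H0.
  split; first by apply: continuous_subspaceT; cts.
  split; first by move=> x /sH; apply.
  exists (fun x => G (t, x)); split; first by apply: continuous_subspaceT; cts.
  by split=> [x /sG|x _]; [apply|rewrite GH HG].
- apply: continuous_subspaceT; apply: (_ : continuous (fun p => H (p.1, p.2))).
  by cts.
Qed.

Lemma clamp01_0 : clamp 0 1 (0 : R) = 0.
Proof. by rewrite clamp_id // lexx ler01. Qed.

Lemma clamp01_1 : clamp 0 1 (1 : R) = 1.
Proof. by rewrite clamp_id // lexx ler01. Qed.

Lemma clamp01P (t : R) : 0 <= clamp 0 1 t <= 1.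
Proof. exact: clamp_itv ler01. Qed.

(** Increasing maps of the line form a convex set, so straight interpolation from the identity to
    [E] stays invertible; it is performed at each point of the plane with the map of its
    projection. *)
Lemma vertical_isotopic (S : topologicalType) (pr : plane R -> S) (O : set S)
    (K N : set (S * R)) (E : S * R -> R) : continuous pr -> vertical O E ->
  (forall y z, K (y, z) <-> N (y, E (y, z))) ->
  strongly_isotopic [set x | K (pr x.1, x.2)] [set x | N (pr x.1, x.2)].
Proof.
move=> cpr [cE mE fE _] KN.
pose c t : R := clamp 0 1 t.
pose F (q : (R * plane R) * R) := q.2 + c q.1.1 * (E (pr q.1.2, q.2) - q.2).
have cF : continuous F by rewrite /F /c; cts.
have c01 t : 0 <= c t <= 1 by exact: clamp01P.
have mF p z w : z < w -> F (p, z) < F (p, w).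
  move=> zw; rewrite /F /=; have := mE (pr p.2) _ _ zw; have := c01 p.1.
  move: (c p.1) (E _) (E _) zw; clear; move=> t a b zw /andP[t0 t1] ab.
  have [h|h] := leP t (1 / 2); nra.
have fF p z : 1 <= `|z| -> F (p, z) = z by move=> z1; rewrite /F /= fE // subrr mulr0 addr0.
have [G [cG GF FG]] := increasing_inverse cF mF (fun p => vertical_bound (mF p) (fF p)).
have sl (f : R -> R) : (forall z w, z < w -> f z < f w) -> (forall z, 1 <= `|z| -> f z = z) ->
    forall z, -1 <= z <= 1 -> -1 <= f z <= 1.
  move=> mf ff z /andP[h1 h2].
  have f1 : f 1 = 1 by rewrite ff ?normr1.
  have fN1 : f (-1) = -1 by rewrite ff ?normrN ?normr1.
  have [->|n1] := eqVneq z 1; first by rewrite f1; lra.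
  have [->|n2] := eqVneq z (-1); first by rewrite fN1; lra.
  have := mf z 1; rewrite lt_neqAle n1 h2 f1 => /(_ isT) k1.
  have := mf (-1) z; rewrite lt_neqAle eq_sym n2 h1 fN1 => /(_ isT) k2.
  by rewrite !ltW.
have mG p z w : z < w -> G (p, z) < G (p, w).
  move=> zw; rewrite ltNge le_eqVlt; apply/negP => /orP[/eqP e|/(mF p)].
    by move: zw; rewrite -(FG p z) -e FG ltxx.
  by rewrite !FG ltNge (ltW zw).
have fG p z : 1 <= `|z| -> G (p, z) = z by move=> z1; rewrite -{1}(fF p z z1) GF.
exists (fun q => (q.2.1, F ((q.1, q.2.1), q.2.2))), (fun q => (q.2.1, G ((q.1, q.2.1), q.2.2))).
split; split => /=.
- by cts.
- by cts.
- by move=> t [x z] /=; rewrite GF.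
- by move=> t [x z] /=; rewrite FG.
- by move=> t [x z] /=; exact: (sl _ (mF _) (fF _)).
- by move=> t [x z] /=; exact: (sl _ (mG _) (fG _)).
- by move=> [x z]; rewrite /F /c /= clamp01_0 mul0r addr0.
- by move=> [x z]; rewrite /F /c /= clamp01_1 mul1r addrC subrK; exact: KN.
Qed.

End StrongIsotopy.

(** * Topology of the torus and lattice coordinates *)

Section TorusTopology.
Context {R : realType} (L : lattice R).
Notation T := (torus L).
Notation pr := (torus_cover L).

Let det := (bu L).1 * (bv L).2 - (bu L).2 * (bv L).1.

Lemma lattice_det : det != 0.
Proof.
apply/eqP => d0.
have [||/eqP + /eqP] := @lattice_basis R L (bv L).2 (- (bu L).2).
- by rewrite -d0 /det; ring.
- by ring.
rewrite oppr_eq0 => /eqP v2 /eqP u2.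
have [||/eqP + /eqP] := @lattice_basis R L (bv L).1 (- (bu L).1).
- by ring.
- by rewrite v2 u2; ring.
rewrite oppr_eq0 => /eqP v1 /eqP u1.
have [||/eqP] := @lattice_basis R L 1 0; rewrite ?u1 ?u2 ?v1 ?v2 ?mulr0 ?addr0 //.
by rewrite oner_eq0.
Qed.

(** With [cv], the coordinates in the basis of the lattice, by Cramer's rule. *)
Definition cu (w : plane R) : R := (w.1 * (bv L).2 - w.2 * (bv L).1) / det.
Definition cv (w : plane R) : R := ((bu L).1 * w.2 - (bu L).2 * w.1) / det.

Definition comb (a b : R) : plane R :=
  (a * (bu L).1 + b * (bv L).1, a * (bu L).2 + b * (bv L).2).

Lemma combK (w : plane R) : comb (cu w) (cv w) = w.
Proof.
have d := lattice_det; case: w => a b; rewrite /comb /cu /cv /=.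
by congr (_, _); move: d; rewrite /det => d; field.
Qed.

Lemma cu_comb (a b : R) : cu (comb a b) = a.
Proof. by have d := lattice_det; rewrite /cu /= /det; move: d; rewrite /det => d; field. Qed.

Lemma cv_comb (a b : R) : cv (comb a b) = b.
Proof. by have d := lattice_det; rewrite /cv /= /det; move: d; rewrite /det => d; field. Qed.

Lemma cuD (x y : plane R) : cu (x + y) = cu x + cu y.
Proof. by rewrite /cu /=; ring. Qed.

Lemma cvD (x y : plane R) : cv (x + y) = cv x + cv y.
Proof. by rewrite /cv /=; ring. Qed.

Lemma cuB (x y : plane R) : cu (x - y) = cu x - cu y.
Proof. by rewrite /cu /=; ring. Qed.

Lemma cvB (x y : plane R) : cv (x - y) = cv x - cv y.
Proof. by rewrite /cv /=; ring. Qed.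

Lemma combD (a b c d : R) : comb (a + c) (b + d) = comb a b + comb c d.
Proof. by rewrite /comb; congr (_, _) => /=; ring. Qed.

Lemma comb_continuous : continuous (fun p : R * R => comb p.1 p.2).
Proof. by rewrite /comb; cts. Qed.

Lemma cu_continuous : continuous cu.
Proof. by rewrite /cu; cts. Qed.

Lemma cv_continuous : continuous cv.
Proof. by rewrite /cv; cts. Qed.

Lemma lattice_ptP (w : plane R) :
  lattice_pt L w <-> exists a b : int, cu w = a%:~R /\ cv w = b%:~R.
Proof.
have E (a b : int) : bu L *~ a + bv L *~ b = comb a%:~R b%:~R.
  have m (u : plane R) (k : int) : u *~ k = (k%:~R * u.1, k%:~R * u.2).
    by case: u => u1 u2; rewrite [LHS]surjective_pairing
      (raddfMz (@fst R R)) (raddfMz (@snd R R)) /= !mulrzl.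
  by rewrite !m.
split=> [[a [b ->]]|[a [b [ea eb]]]]; first by exists a, b; rewrite E cu_comb cv_comb.
by exists a, b; rewrite E -ea -eb combK.
Qed.

Lemma torus_coverP (x y : plane R) : pr x = pr y <-> lattice_pt L (x - y).
Proof.
have r : reflect (pr x = pr y) (lattice_rel L x y).
  exact: (@eqmodP _ (lattice_equiv_rel L) x y).
by split=> [/r/asboolP|h]; last by apply/r/asboolP.
Qed.

Lemma torus_cover_surj (y : T) : exists x, pr x = y.
Proof. by exists (repr y); rewrite /torus_cover reprK. Qed.

Lemma torus_cover_continuous : continuous pr.
Proof. exact: pi_continuous. Qed.

Lemma latticeD (x y : plane R) : lattice_pt L x -> lattice_pt L y -> lattice_pt L (x + y).
Proof.
move=> [a [b ->]] [c [d ->]]; exists (a + c), (b + d).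
by rewrite !mulrzDr addrACA.
Qed.

Lemma latticeN (x : plane R) : lattice_pt L x -> lattice_pt L (- x).
Proof. by move=> [a [b ->]]; exists (- a), (- b); rewrite !mulrNz opprD. Qed.

Lemma latticeB (x y : plane R) : lattice_pt L x -> lattice_pt L y -> lattice_pt L (x - y).
Proof. by move=> hx hy; apply: latticeD => //; exact: latticeN. Qed.

Lemma torus_coverD (x y x' y' : plane R) : pr x = pr x' -> pr y = pr y' -> pr (x + y) = pr (x' + y').
Proof.
move=> /torus_coverP h /torus_coverP h'; apply/torus_coverP.
by rewrite opprD addrACA; exact: latticeD.
Qed.

Lemma torus_cover_shift (x l : plane R) : lattice_pt L l -> pr (x + l) = pr x.
Proof. by move=> hl; apply/torus_coverP; rewrite addrAC subrr add0r. Qed.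

Lemma addr_continuous (l : plane R) : continuous (fun x : plane R => x + l).
Proof.
have -> : (fun x : plane R => x + l) = (fun x => (x.1 + l.1, x.2 + l.2)).
  by apply/funext => -[a b].
by cts.
Qed.

Lemma torus_cover_open (U : set (plane R)) : open U -> open (pr @` U).
Proof.
move=> oU; rewrite /open /= /quotient_open openE => w [u Uu /torus_coverP hl].
have : nbhs w [set w' | U (w' + (u - w))].
  by apply: addr_continuous; rewrite addrC subrK; exact: open_nbhs_nbhs.
apply: filterS => w' Uw'; exists (w' + (u - w)) => //.
exact: torus_cover_shift.
Qed.

Lemma not_int_near (r : R) : ~ (exists k : int, r = k%:~R) ->
  \forall s \near r, ~ (exists k : int, s = k%:~R).
Proof.
move=> nr; pose f := Num.floor r.
have h1 : f%:~R < r.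
  by rewrite lt_neqAle floor_le andbT; apply/eqP => e; apply: nr; exists f.
have h2 : r < (f + 1)%:~R by exact: floorD1_gt.
have n1 : \forall s \near r, f%:~R < s by apply: (@cat_lt _ _ _ (fun=> f%:~R) id); cts.
have n2 : \forall s \near r, s < (f + 1)%:~R by apply: (@cat_lt _ _ _ id (fun=> (f + 1)%:~R)); cts.
move: n1 n2; apply: filterS2 => s s1 s2 [k e]; move: s1 s2.
by rewrite e !ltr_int; lia.
Qed.

Lemma not_lattice_near (w : plane R) : ~ lattice_pt L w ->
  \forall w' \near w, ~ lattice_pt L w'.
Proof.
move=> nw.
have [[a ea]|na] := pselect (exists k : int, cu w = k%:~R).
  have nb : ~ exists k : int, cv w = k%:~R.
    by move=> [b eb]; apply: nw; apply/lattice_ptP; exists a, b.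
  have h0 : \forall w' \near w, ~ exists k : int, cv w' = k%:~R :=
    cv_continuous (not_int_near nb).
  apply: filterS h0 => w' h.
  by move=> /lattice_ptP[c [d [_ e]]]; apply: h; exists d.
have h0 : \forall w' \near w, ~ exists k : int, cu w' = k%:~R :=
    cu_continuous (not_int_near na).
  apply: filterS h0 => w' h.
by move=> /lattice_ptP[c [d [e _]]]; apply: h; exists c.
Qed.

Lemma torus_hausdorff : hausdorff_space T.
Proof.
rewrite open_hausdorff => x y xy.
have [a ea] := torus_cover_surj x; have [b eb] := torus_cover_surj y.
have nl : ~ lattice_pt L (a - b).
  by move=> /torus_coverP e; move: xy; rewrite -ea -eb e eqxx.
have cs : continuous (fun p : plane R * plane R => p.1 - p.2).
  have -> : (fun p : plane R * plane R => p.1 - p.2) =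
      (fun p => (p.1.1 - p.2.1, p.1.2 - p.2.2)).
    by apply/funext => -[[? ?] [? ?]].
  by cts.
have [[A B] /= [Aa Bb] AB] := cs (a, b) _ (not_lattice_near nl).
move: Aa Bb; rewrite !nbhsE => -[A' [oA A'a] A'A] [B' [oB B'b] B'B].
exists (pr @` A', pr @` B') => /=.
  by rewrite !inE; split; [exists a|exists b].
split; [exact: torus_cover_open|exact: torus_cover_open|].
apply/eqP/seteqP; split=> // _ [[a' A'a' <-] [b' B'b' /esym/torus_coverP h]].
by case: (AB (a', b')) => //; split; [exact: A'A|exact: B'B].
Qed.

Definition cell : set (plane R) := [set comb p.1 p.2 | p in `[0, 1] `*` `[0, 1]].

Lemma cell_compact : compact cell.
Proof.
apply: continuous_compact; last by apply: compact_setX; exact: segment_compact.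
exact/continuous_subspaceT/comb_continuous.
Qed.

Lemma cell_shift (x : plane R) : exists l, lattice_pt L l /\ cell (x + l).
Proof.
exists (comb (- (Num.floor (cu x))%:~R) (- (Num.floor (cv x))%:~R)); split.
  apply/lattice_ptP; exists (- Num.floor (cu x)), (- Num.floor (cv x)).
  by rewrite cu_comb cv_comb !intrN.
exists (cu x - (Num.floor (cu x))%:~R, cv x - (Num.floor (cv x))%:~R) => /=.
  split; rewrite /= in_itv /= subr_ge0 floor_le /= lerBlDl;
    have := floorD1_gt (cu x); have := floorD1_gt (cv x); rewrite !intrD; lra.
by rewrite /= combD combK.
Qed.

Lemma torus_compact : compact [set: T].
Proof.
have -> : [set: T] = pr @` cell.
  apply/seteqP; split=> // y _; have [x <-] := torus_cover_surj y.
  by have [l [hl hc]] := cell_shift x; exists (x + l) => //; exact: torus_cover_shift.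
apply: continuous_compact; last exact: cell_compact.
exact/continuous_subspaceT/torus_cover_continuous.
Qed.

Lemma torus_normal : normal_space T.
Proof. exact: compact_normal torus_hausdorff torus_compact. Qed.

Lemma small_int (k : int) : `|k%:~R : R| < 1 -> k = 0.
Proof. by rewrite -intr_norm ltrz1 => ?; lia. Qed.

Lemma torus_cover_local_homeo : local_homeo pr.
Proof.
split; [exact: torus_cover_continuous|exact: torus_cover_open|move=> x].
exists [set w | `|cu w - cu x| < 1 / 2 /\ `|cv w - cv x| < 1 / 2].
  have h : 0 < 1 / 2 :> R by lra.
  exact: (filterI (cat_norm_lt (@cu_continuous x) h) (cat_norm_lt (@cv_continuous x) h)).
move=> a b [a1 a2] [b1 b2] /torus_coverP /lattice_ptP[k [l [ek el]]].
have k0 : k = 0.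
  apply: small_int; rewrite -ek cuB; move: a1 b1; rewrite !ltr_norml.
  by move=> /andP[? ?] /andP[? ?]; apply/andP; split; lra.
have l0 : l = 0.
  apply: small_int; rewrite -el cvB; move: a2 b2; rewrite !ltr_norml.
  by move=> /andP[? ?] /andP[? ?]; apply/andP; split; lra.
move: ek el; rewrite k0 l0 cuB cvB => /eqP + /eqP; rewrite !subr_eq0 => /eqP e1 /eqP e2.
by rewrite -(combK a) -(combK b) e1 e2.
Qed.

End TorusTopology.

(** * Lifting maps to the plane *)

Section Lifting.
Context {R : realType} (L : lattice R).
Notation T := (torus L).
Notation pr := (torus_cover L).

(** The path from [x0] to each point, continuous in the point, is the only form in which simple
    connectedness enters the lifting theorem. *)
Definition contraction (V : topologicalType) (sc : R * V -> V) (x0 : V) :=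
  [/\ continuous sc, forall x, sc (0, x) = x0 & forall x, sc (1, x) = x].

Lemma plane_contraction :
  contraction (fun q : R * plane R => (q.1 * q.2.1, q.1 * q.2.2)) ((0 : R), (0 : R)).
Proof.
split; first by cts.
  by move=> x /=; rewrite !mul0r.
by move=> [x y] /=; rewrite !mul1r.
Qed.

Lemma space_contraction :
  contraction (fun q : R * (R * plane R) => (q.1 * q.2.1, (q.1 * q.2.2.1, q.1 * q.2.2.2)))
    ((0 : R), ((0 : R), (0 : R))).
Proof.
split; first by cts.
  by move=> x /=; rewrite !mul0r.
by move=> [t [x y]] /=; rewrite !mul1r.
Qed.

Lemma planeP (x y : plane R) : cu L x = cu L y -> cv L x = cv L y -> x = y.
Proof. by move=> e1 e2; rewrite -(combK L x) -(combK L y) e1 e2. Qed.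

Lemma cat_plane_sum (X : topologicalType) (n : nat) (f : nat -> X -> plane R) x :
  (forall k, (k < n)%N -> continuous_at x (f k)) ->
  continuous_at x (fun y => \sum_(k < n) f k y).
Proof.
elim: n => [_|n IH cf].
  rewrite (_ : (fun _ => _) = fun=> 0); first exact: cat_cst.
  by apply/funext => y; rewrite big_ord0.
rewrite (_ : (fun _ => _) = fun y => \sum_(k < n) f k y + f n y); last first.
  by apply/funext => y; rewrite big_ord_recr.
apply: cat_plane_add; last exact: cf.
by apply: IH => k kn; apply: cf; exact: ltnW.
Qed.

(** Along the contracting path both coordinates are continuous and integer-valued. This rigidity
    underlies all comparisons of lifts. *)
Lemma lattice_valued_cst (V : topologicalType) (sc : R * V -> V) (x0 : V) (g : V -> plane R) :
  contraction sc x0 -> continuous g -> (forall x, lattice_pt L (g x)) -> forall x, g x = g x0.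
Proof.
move=> [csc sc0 sc1] cg gL x.
have cc := @cu_continuous R L; have cc' := @cv_continuous R L.
rewrite -{1}(sc1 x) -(sc0 x); apply: planeP.
  apply: (@int_valued_cst R (fun s => cu L (g (sc (s, x))))); first by cts.
  by move=> s; have /lattice_ptP[a [b [-> _]]] := gL (sc (s, x)); exists a.
apply: (@int_valued_cst R (fun s => cv L (g (sc (s, x))))); first by cts.
by move=> s; have /lattice_ptP[a [b [_ ->]]] := gL (sc (s, x)); exists b.
Qed.

Definition frac (r : R) : R := r - (Num.floor (r + 1 / 2))%:~R.

(* The vector from a to b with coordinates in [-1/2, 1/2[. *)
Definition tdiff (p : T * T) : plane R :=
  let w := repr p.2 - repr p.1 in comb L (frac (cu L w)) (frac (cv L w)).

(** The strict inequalities exclude the value -1/2, where [frac] jumps; this is the region where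
    [tdiff] is continuous. *)
Definition small (w : plane R) := `|cu L w| < 1 / 2 /\ `|cv L w| < 1 / 2.

Lemma tdiffP (a b : T) (x : plane R) : pr x = a -> pr (x + tdiff (a, b)) = b.
Proof.
move=> xa; pose w := repr b - repr a.
have e : pr (tdiff (a, b)) = pr w.
  apply/torus_coverP/lattice_ptP; rewrite /tdiff -/w.
  exists (- Num.floor (cu L w + 1 / 2)), (- Num.floor (cv L w + 1 / 2)).
  by rewrite cuB cvB cu_comb cv_comb /frac !intrN; split; ring.
have -> : pr (x + tdiff (a, b)) = pr (repr a + w).
  by apply: torus_coverD => //; rewrite xa /torus_cover reprK.
by rewrite /w addrC subrK /torus_cover reprK.
Qed.

Lemma frac_itv (r : R) : -1 / 2 <= frac r < 1 / 2.
Proof.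
rewrite /frac; have := floor_le (r + 1 / 2); have := floorD1_gt (r + 1 / 2).
by rewrite intrD; lra.
Qed.

Lemma tdiff_eq (x y : plane R) : small (y - x) -> tdiff (pr x, pr y) = y - x.
Proof.
move=> [h1 h2]; have := @tdiffP (pr x) (pr y) x erefl.
move=> /torus_coverP /lattice_ptP[k [l [ek el]]].
have e1 : cu L (x + tdiff (pr x, pr y) - y) = cu L (tdiff (pr x, pr y)) - cu L (y - x).
  by rewrite !(cuB, cuD); ring.
have e2 : cv L (x + tdiff (pr x, pr y) - y) = cv L (tdiff (pr x, pr y)) - cv L (y - x).
  by rewrite !(cvB, cvD); ring.
have i1 := frac_itv (cu L (repr (pr y) - repr (pr x))).
have i2 := frac_itv (cv L (repr (pr y) - repr (pr x))).
rewrite e1 {1}/tdiff cu_comb in ek; rewrite e2 {1}/tdiff cv_comb in el.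
move: h1 h2 i1 i2; rewrite !ltr_norml => /andP[? ?] /andP[? ?] /andP[? ?] /andP[? ?].
have k0 : k = 0 by apply: (@small_int R); rewrite -ek ltr_norml; apply/andP; split => /=; lra.
have l0 : l = 0 by apply: (@small_int R); rewrite -el ltr_norml; apply/andP; split => /=; lra.
move: ek el; rewrite k0 l0 => /eqP + /eqP; rewrite !subr_eq0 => /eqP e3 /eqP e4.
by apply: planeP; rewrite /tdiff ?cu_comb ?cv_comb.
Qed.

Lemma small0 : small 0.
Proof. by rewrite /small /cu /cv /= !mul0r !mulr0 subrr mul0r normr0; split; lra. Qed.

Lemma tdiff_refl (a : T) : tdiff (a, a) = 0.
Proof.
have [x <-] := torus_cover_surj a.
by rewrite tdiff_eq subrr //; exact: small0.
Qed.

Lemma small_near (w : plane R) : small w -> \forall w' \near w, small w'.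
Proof.
have cc := @cu_continuous R L; have cc' := @cv_continuous R L.
move=> [h1 h2]; apply: filterI.
  by apply: (@cat_lt _ _ w (fun w => `|cu L w|) (fun=> 1 / 2)) => //; cts.
by apply: (@cat_lt _ _ w (fun w => `|cv L w|) (fun=> 1 / 2)) => //; cts.
Qed.

Lemma tdiff_continuous (p : T * T) : small (tdiff p) -> continuous_at p tdiff.
Proof.
case: p => a b sp U Up.
have [x xa] := torus_cover_surj a; pose y := x + tdiff (a, b).
have yb : pr y = b := tdiffP b xa.
have yx : y - x = tdiff (a, b) by rewrite /y addrAC subrr add0r.
pose sub (q : plane R * plane R) := q.2 - q.1.
have csub : continuous_at (x, y) sub.
  by apply: cat_plane_add; [cts|apply: cat_plane_opp; cts].
have : nbhs (x, y) (sub @^-1` (U `&` small)).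
  by apply: csub; rewrite /sub /= yx; apply: filterI => //; exact: small_near.
move=> [[A B] /= [Ax By] AB].
rewrite nbhsE in Ax; rewrite nbhsE in By.
move: Ax By => [A' [oA A'x] A'A] [B' [oB B'y] B'B].
exists (pr @` A', pr @` B') => /=.
  split; apply: open_nbhs_nbhs; split; [exact: torus_cover_open|by exists x|
    exact: torus_cover_open|by exists y].
move=> [_ _] [/= [x' /A'A Ax' <-] [y' /B'B By' <-]].
have [Us s] := AB (x', y') (conj Ax' By').
by rewrite /= tdiff_eq.
Qed.

Lemma tdiff_near (p : T * T) : small (tdiff p) -> \forall q \near p, small (tdiff q).
Proof. by move=> sp; apply: (tdiff_continuous sp); exact: small_near. Qed.

Section Lift.
Variables (V : topologicalType) (sc : R * V -> V) (x0 : V) (csc : contraction sc x0).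
Variables (F : V -> T) (cF : continuous F).

Let F' (s : R) (x : V) : T := F (sc (s, x)).

(** Steps of length at most 1 / (N + 1) along the path of [x] stay where [tdiff] is continuous, so
    the path can be lifted by adding up such differences. *)
Definition fine_at (N : nat) (x : V) := forall s e : R, 0 <= s <= 1 -> `|e| <= N.+1%:R^-1 ->
  small (tdiff (F' s x, F' (s + e) x)).

(** For a zero step the difference is 0; compactness of [[0, 1]] gives a step size valid at all
    times and for all points near [x]. *)
Lemma fine_near (x : V) : exists N, \forall y \near x, fine_at N y.
Proof.
have [cs _ _] := csc.
have /compact_near_coveringP cov := @segment_compact R 0 1.
have h : \forall i \near (x, (0 : R)), `[0, 1]%classic `<=` (fun s : R =>
    small (tdiff (F' s i.1, F' (s + i.2) i.1))).
  apply: (cov _ (nbhs (x, (0 : R)))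
    (fun i s => small (tdiff (F' s i.1, F' (s + i.2) i.1)))) => s _.
  pose g (q : R * (V * R)) := (F' q.1 q.2.1, F' (q.1 + q.2.2) q.2.1).
  have cg : continuous g by rewrite /g /F'; cts.
  have := cg (s, (x, 0)) _ (@tdiff_near (g (s, (x, 0))) _); apply.
  by rewrite /g /= addr0 tdiff_refl; exact: small0.
move: h => [[A B] /= [Ax /nbhs_ballP[e /= e0 eB]] AB].
have [N Ne] : exists N : nat, N.+1%:R^-1 < e.
  exists (Num.truncn e^-1); rewrite -[ltRHS]invrK ltf_pV2 ?posrE ?invr_gt0 //.
  exact: truncnS_gt.
exists N; apply: filterS Ax => y Ay s d s01 dN.
apply: (AB (y, d)); last by rewrite /= in_itv.
split => //; apply: eB; rewrite /ball /= sub0r normrN.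
exact: le_lt_trans Ne.
Qed.

(* The partial sums of [q] lift the values of the path [s |-> F (sc (s, x))] at the multiples
   of 1 / (N + 1). *)
Let q (N : nat) (x : V) (s : R) : plane R := \sum_(k < N.+1)
  tdiff (F' (Num.min s (k%:R / N.+1%:R)) x, F' (Num.min s (k.+1%:R / N.+1%:R)) x).

Lemma fine_small N x (s : R) k : fine_at N x -> 0 <= s <= 1 -> (k < N.+1)%N ->
  small (tdiff (F' (Num.min s (k%:R / N.+1%:R)) x, F' (Num.min s (k.+1%:R / N.+1%:R)) x)).
Proof.
move=> fN /andP[s0 s1] kN; pose u : R := k%:R / N.+1%:R; pose v : R := N.+1%:R^-1.
have -> : k.+1%:R / N.+1%:R = u + v by rewrite /u /v -natr1 mulrDl mul1r.
have gen (u' v' : R) : 0 <= u' -> 0 < v' -> 0 <= Num.min s u' <= 1 /\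
    `|Num.min s (u' + v') - Num.min s u'| <= v'.
  move=> u0 v0; split; first by rewrite le_min s0 u0 ge_min s1.
  by have [h1|h1] := leP s u'; have [h2|h2] := leP s (u' + v'); rewrite ler_norml; lra.
have [||g1 g2] := gen u v; rewrite /u /v ?divr_ge0 ?invr_gt0 //.
have -> : Num.min s (u + v) = Num.min s u + (Num.min s (u + v) - Num.min s u).
  by rewrite subrKC.
exact: fN.
Qed.

Lemma path_lift N x (s : R) (c : plane R) : pr c = F x0 -> 0 <= s <= 1 ->
  pr (c + q N x s) = F' s x.
Proof.
move=> ec /andP[s0 s1]; have [_ sc0 _] := csc.
have partial j : pr (c + \sum_(k < j) tdiff (F' (Num.min s (k%:R / N.+1%:R)) x,
    F' (Num.min s (k.+1%:R / N.+1%:R)) x)) = F' (Num.min s (j%:R / N.+1%:R)) x.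
  elim: j => [|j IH]; first by rewrite big_ord0 addr0 ec mul0r min_r // /F' sc0.
  by rewrite big_ord_recr /= addrA; apply: tdiffP.
by rewrite partial divff ?pnatr_eq0 // min_l.
Qed.

(** The two lifts of the same path start together and differ by a continuous lattice-valued
    function. The end point thus does not depend on the subdivision. *)
Lemma path_unique N M x : fine_at N x -> fine_at M x -> q N x 1 = q M x 1.
Proof.
move=> fN fM; have [cs sc0 sc1] := csc.
have [c ec] := torus_cover_surj (F x0).
have cq K : fine_at K x -> continuous (fun s => q K x (clamp 0 1 s)).
  move=> fK s; rewrite /q.
  have cl : 0 <= clamp 0 1 s <= 1 by exact: clamp01P.
  apply: (@cat_plane_sum R K.+1 (fun k s => tdiff
    (F' (Num.min (clamp 0 1 s) (k%:R / K.+1%:R)) x,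
     F' (Num.min (clamp 0 1 s) (k.+1%:R / K.+1%:R)) x))) => j jK.
  apply: (@cat_comp _ _ _ (fun t => (F' (Num.min (clamp 0 1 t) (j%:R / K.+1%:R)) x,
       F' (Num.min (clamp 0 1 t) (j.+1%:R / K.+1%:R)) x)) tdiff).
    by rewrite /F'; cts.
  by apply: tdiff_continuous; exact: fine_small.
pose g s := q N x (clamp 0 1 s) - q M x (clamp 0 1 s).
have cg : continuous g.
  by move=> s; apply: cat_plane_add; [exact: cq|apply: cat_plane_opp; exact: cq].
have gL s : lattice_pt L (g s).
  have -> : g s = (c + q N x (clamp 0 1 s)) - (c + q M x (clamp 0 1 s)).
    by rewrite opprD addrACA subrr add0r.
  by apply/torus_coverP; rewrite !path_lift //; exact: clamp01P.
have q0 K : q K x 0 = 0.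
  rewrite /q big1 // => k _; rewrite !min_l ?divr_ge0 //.
  exact: tdiff_refl.
have g0 : g 0 = 0 by rewrite /g clamp01_0 !q0 subrr.
have RC : contraction (fun p : R * R => p.1 * p.2) 0.
  by split; [cts|move=> t /=; rewrite mul0r|move=> t /=; rewrite mul1r].
have := lattice_valued_cst RC cg gL 1; rewrite g0 /g clamp01_1 => /eqP.
by rewrite subr_eq0 => /eqP.
Qed.

Lemma lifting : exists f : V -> plane R, continuous f /\ forall x, pr (f x) = F x.
Proof.
have [cs sc0 sc1] := csc.
have [c ec] := torus_cover_surj (F x0).
(* The subdivision is chosen point by point, without any continuity; near each point a common one
   gives the same lift, by [path_unique]. *)
have [|N NP] := @boolp.choice V nat (fun x N => fine_at N x).
  by move=> x; have [N /nbhs_singleton ?] := fine_near x; exists N.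
exists (fun x => c + q (N x) x 1); split; last first.
  by move=> x; rewrite path_lift ?lexx ?ler01 // /F' sc1.
move=> x; have [M fM] := fine_near x.
have e : \forall y \near x, c + q M y 1 = c + q (N y) y 1.
  by apply: filterS fM => y fy; rewrite (path_unique fy (NP y)).
have : continuous_at x (fun y => c + q M y 1).
  apply: cat_plane_add; first exact: cat_cst.
  have fx := nbhs_singleton fM; rewrite /q.
  apply: (@cat_plane_sum V M.+1 (fun k y => tdiff
    (F' (Num.min 1 (k%:R / M.+1%:R)) y, F' (Num.min 1 (k.+1%:R / M.+1%:R)) y))) => j jM.
  apply: (@cat_comp _ _ _ (fun y => (F' (Num.min 1 (j%:R / M.+1%:R)) y,
       F' (Num.min 1 (j.+1%:R / M.+1%:R)) y)) tdiff).
    by rewrite /F'; cts.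
  by apply: tdiff_continuous; apply: fine_small => //; rewrite ler01 lexx.
rewrite /continuous_at -(nbhs_singleton e) => h U /h; apply: filterS2 e.
by move=> y e'; change (U (c + q M y 1) -> U (c + q (N y) y 1)); rewrite e'.
Qed.

End Lift.
End Lifting.

(** * Homeomorphisms of the torus *)

Section Kister.
Context {R : realType} (L : lattice R).
Notation T := (torus L).
Notation pr := (torus_cover L).
Notation cuL := (cu L).
Notation cvL := (cv L).

(** The linear map N that sends [bu L] to [nu] and [bv L] to [nv]. *)
Definition lmap (nu nv x : plane R) : plane R :=
  (cuL x * nu.1 + cvL x * nv.1, cuL x * nu.2 + cvL x * nv.2).

Definition scale (c : R) (x : plane R) : plane R := (c * x.1, c * x.2).

Lemma scaleA (a b : R) x : scale a (scale b x) = scale (a * b) x.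
Proof. by rewrite /scale /= !mulrA. Qed.

Lemma scale0 x : scale 0 x = 0.
Proof. by rewrite /scale !mul0r. Qed.

Lemma scale1 x : scale 1 x = x.
Proof. by case: x => a b; rewrite /scale /= !mul1r. Qed.

Lemma scaleD (c : R) x y : scale c (x + y) = scale c x + scale c y.
Proof. by rewrite /scale /= !mulrDr. Qed.

Lemma scaleN (c : R) x : scale c (- x) = - scale c x.
Proof. by rewrite /scale /= !mulrN. Qed.

Lemma scaleNl (c : R) x : scale (- c) x = - scale c x.
Proof. by rewrite /scale !mulNr. Qed.

Lemma scale_continuous : continuous (fun q : R * plane R => scale q.1 q.2).
Proof. by rewrite /scale; cts. Qed.

Lemma lmapD nu nv x y : lmap nu nv (x + y) = lmap nu nv x + lmap nu nv y.
Proof. by rewrite /lmap cuD cvD; congr (_, _); rewrite /=; ring. Qed.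

Lemma cuZ c x : cuL (scale c x) = c * cuL x.
Proof. by rewrite /cu /=; ring. Qed.

Lemma cvZ c x : cvL (scale c x) = c * cvL x.
Proof. by rewrite /cv /=; ring. Qed.

Lemma lmapZ nu nv c x : lmap nu nv (scale c x) = scale c (lmap nu nv x).
Proof. by rewrite /lmap cuZ cvZ; congr (_, _); rewrite /=; ring. Qed.

Lemma lmapN nu nv x : lmap nu nv (- x) = - lmap nu nv x.
Proof.
have -> : - x = scale (-1) x by case: x => a b; rewrite /scale /= !mulN1r.
rewrite lmapZ; case: (lmap nu nv x) => a b; by rewrite /scale /= !mulN1r.
Qed.

Lemma lmap_continuous nu nv : continuous (lmap nu nv).
Proof.
have cc := @cu_continuous R L; have cc' := @cv_continuous R L.
by rewrite /lmap; cts.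
Qed.

(** Where the scale vanishes the argument of [b] has no limit; boundedness of [b] alone makes the
    product tend to 0, whatever the inverse of zero is. *)
Lemma cat_rescale (X : topologicalType) (c : X -> R) (u : X -> plane R) (b : plane R -> R)
    (C : R) (x : X) : continuous_at x c -> continuous_at x u -> continuous b ->
  (forall v, `|b v| <= C) -> continuous_at x (fun y => c y * b (scale (c y)^-1 (u y))).
Proof.
move=> cc cu' cb bC; have [c0|c0] := eqVneq (c x) 0; last first.
  have cs := scale_continuous; apply: cat_mul => //.
  apply: (@cat_comp _ _ _ (fun y => scale (c y)^-1 (u y)) b) => //.
  apply: (@cat_comp _ _ _ (fun y => ((c y)^-1, u y)) (fun q => scale q.1 q.2)) => //.
  by cts.
apply: cat_normP => e e0.
have C0 : 0 <= C by apply: le_trans (bC 0); exact: normr_ge0.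
have d0 : 0 < e / (C + 1) by rewrite divr_gt0 //; lra.
move: (cat_norm_lt cc d0); apply: filterS => y; rewrite c0 subr0 mul0r subr0 normrM => h.
have := bC (scale (c y)^-1 (u y)); move: (normr_ge0 (b (scale (c y)^-1 (u y)))).
move: h; rewrite ltr_pdivlMr; last by lra.
move: (normr_ge0 (c y)); move: (`|c y|) (`|b _|); clear -C0 => p r p0 h r0 rC.
by nra.
Qed.

(* The homeomorphism f is at bounded distance from I + N, with N nilpotent.  Alexander's
   trick, performed at infinity, deforms (I - N) f to the identity through the maps
   [x |-> t ((I - N) f) (x / t)], and then I + N is deformed through the shears I + t N. *)
Lemma bounded_distance_isotopic (f g : plane R -> plane R) (nu nv : plane R) (C : R)
    (W W' : set (plane R * R)) : continuous f -> continuous g ->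
  (forall x, g (f x) = x) -> (forall x, f (g x) = x) ->
  (forall x, lmap nu nv (lmap nu nv x) = 0) ->
  (forall x, let p := f x - x - lmap nu nv x in `|p.1| <= C /\ `|p.2| <= C) ->
  (forall x z, W (x, z) <-> W' (f x, z)) -> strongly_isotopic W W'.
Proof.
move=> cf cg gf fg NN fC WW'; pose N := lmap nu nv.
have cN : continuous N := @lmap_continuous nu nv.
(* [h] is (I - N) f and [h'] is g (I + N); they are mutually inverse because N^2 = 0. *)
pose h x := f x - N (f x); pose h' y := g (y + N y).
have ND x y : N (x + y) = N x + N y := lmapD nu nv x y.
have Nneg x : N (- x) = - N x := lmapN nu nv x.
have NZ k x : N (scale k x) = scale k (N x) := lmapZ nu nv k x.
have {}NN x : N (N x) = 0 := NN x.
have hh' y : h (h' y) = y.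
  by rewrite /h /h' fg ND NN addr0 addrK.
have h'h x : h' (h x) = x.
  by rewrite /h' /h ND Nneg NN subr0 subrK gf.
have cadd (F G : plane R -> plane R) : continuous F -> continuous G ->
    continuous (fun x => F x + G x).
  by move=> cF cG x; apply: cat_plane_add; [exact: cF|exact: cG].
have copp (F : plane R -> plane R) : continuous F -> continuous (fun x => - F x).
  by move=> cF x; apply: cat_plane_opp; exact: cF.
have ch : continuous h by apply: cadd => //; apply: copp; cts.
have ch' : continuous h'.
  have cN1 : continuous (fun y : plane R => y + N y) by apply: cadd => //; cts.
  by rewrite /h'; cts.
pose b x := h x - x; pose b' x := h' x - x.
have cb : continuous b by apply: cadd => //; apply: copp; cts.
have cb' : continuous b' by apply: cadd => //; apply: copp; cts.
have [B bB] : exists B, forall x, `|(b x).1| <= B /\ `|(b x).2| <= B.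
  pose M := `|nu.1| + `|nu.2| + `|nv.1| + `|nv.2|.
  have [B1 B1P] : exists B1, forall p : plane R, `|p.1| <= C -> `|p.2| <= C ->
      `|cuL p| <= B1 /\ `|cvL p| <= B1.
    pose d := (bu L).1 * (bv L).2 - (bu L).2 * (bv L).1.
    pose B2 := (C * (`|(bu L).1| + `|(bu L).2| + `|(bv L).1| + `|(bv L).2|)) * `|d^-1|.
    exists B2 => p p1 p2; rewrite /cu /cv -/d !normrM /B2.
    have C0 : 0 <= C by apply: le_trans p1; exact: normr_ge0.
    have n1 := normr_ge0 (bu L).1; have n2 := normr_ge0 (bu L).2.
    have n3 := normr_ge0 (bv L).1; have n4 := normr_ge0 (bv L).2.
    have m1 := normr_ge0 p.1; have m2 := normr_ge0 p.2.
    by split; apply: ler_wpM2r => //; apply: le_trans (ler_normB _ _) _; rewrite !normrM; nra.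
  exists (C + B1 * M) => x; have [p1 p2] := fC x; have [q1 q2] := B1P _ p1 p2.
  set p := f x - x - _ in p1 p2 q1 q2.
  (* Writing f = I + N + p and composing with I - N leaves I + p - N p, again because N^2 = 0. *)
  have -> : b x = p - N p.
    have -> : N p = N (f x) - N x by rewrite /p !ND !Nneg -/N NN subr0.
    by rewrite opprB addrA /p subrK /b /h addrAC.
  have B10 : 0 <= B1 by apply: le_trans q1; exact: normr_ge0.
  have k (a a' n1 n2 : R) : `|a| <= B1 -> `|a'| <= B1 -> `|n1| + `|n2| <= M ->
      `|a * n1 + a' * n2| <= B1 * M.
    move=> aB aB' nM; apply: le_trans (ler_normD _ _) _; rewrite !normrM.
    apply: (@le_trans _ _ (B1 * (`|n1| + `|n2|))); last exact: ler_wpM2l.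
    by rewrite mulrDr; apply: lerD; apply: ler_wpM2r.
  have n1 := normr_ge0 nu.1; have n2 := normr_ge0 nu.2.
  have n3 := normr_ge0 nv.1; have n4 := normr_ge0 nv.2.
  split; apply: le_trans (ler_normB _ _) _; apply: lerD => //; apply: k => //;
    rewrite /M; lra.
have bB' x : `|(b' x).1| <= B /\ `|(b' x).2| <= B.
  have -> : b' x = - b (h' x) by rewrite /b' /b hh' opprB.
  by have := bB (h' x); case: (b (h' x)) => u v /=; rewrite !normrN.
pose c t : R := clamp 0 1 t.
(* [Kt b] is Alexander's deformation from the identity to I + b, written so that only the bounded
   map [b] is rescaled; [At e] is the shear I + e t N, with inverse [At (- e)]. *)
pose Kt (b : plane R -> plane R) (q : R * plane R) := q.2 + scale (c q.1) (b (scale (c q.1)^-1 q.2)).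
pose At (e : R) (q : R * plane R) := q.2 + scale (e * c q.1) (N q.2).
have cAt e : continuous (At e).
  by move=> q; rewrite /At /scale /c; apply: cat_plane_add; cts.
have cKt b0 : continuous b0 -> (forall x, `|(b0 x).1| <= B /\ `|(b0 x).2| <= B) -> continuous (Kt b0).
  move=> cb0 b0B q; rewrite /Kt; apply: cat_plane_add; first by cts.
  apply: (@cat_pair _ _ _ (fun q => c q.1 * (b0 (scale (c q.1)^-1 q.2)).1)
    (fun q => c q.1 * (b0 (scale (c q.1)^-1 q.2)).2)).
    by apply: (@cat_rescale _ (fun q => c q.1) snd (fun x => (b0 x).1) B q) => [||?|v];
      [rewrite /c; cts|cts|cts|case: (b0B v)].
  by apply: (@cat_rescale _ (fun q => c q.1) snd (fun x => (b0 x).2) B q) => [||?|v];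
      [rewrite /c; cts|cts|cts|case: (b0B v)].
have Kinv (h1 h2 : plane R -> plane R) t x : (forall x, h2 (h1 x) = x) ->
    Kt (fun x => h2 x - x) (t, Kt (fun x => h1 x - x) (t, x)) = x.
  move=> h21; rewrite /Kt /=; have [c0|c0] := eqVneq (c t) 0.
    by rewrite c0 !scale0 !addr0.
  have E (h0 : plane R -> plane R) y :
      y + scale (c t) (h0 (scale (c t)^-1 y) - scale (c t)^-1 y) = scale (c t) (h0 (scale (c t)^-1 y)).
    by rewrite scaleD scaleN scaleA divff // scale1 addrC subrK.
  by rewrite !E scaleA mulVf // scale1 h21 scaleA divff // scale1.
have Ainv e t x : At (- e) (t, At e (t, x)) = x.
  rewrite /At /= ND.
  have -> : N (scale (e * c t) (N x)) = 0 by rewrite NZ NN /scale !mulr0.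
  rewrite addr0 -addrA; have -> : scale (e * c t) (N x) + scale (- e * c t) (N x) = 0.
    by rewrite mulNr scaleNl subrr.
  by rewrite addr0.
exists (fun q => (At 1 (q.1, Kt b (q.1, q.2.1)), q.2.2)),
  (fun q => (Kt b' (q.1, At (-1) (q.1, q.2.1)), q.2.2)).
have cK := cKt b cb bB; have cK' := cKt b' cb' bB'.
have cA1 := cAt 1; have cA2 := cAt (-1).
split; split => /=.
- by cts.
- by cts.
- by move=> t [x z] /=; rewrite Ainv Kinv.
- by move=> t [x z] /=; rewrite Kinv //; have := Ainv (-1) t x; rewrite opprK => ->.
- by move=> t [x z].
- by move=> t [x z].
- by move=> [x z]; rewrite /At /Kt /c /= clamp01_0 mulr0 !scale0 !addr0.
move=> [x z]; rewrite WW' /At /Kt /c /= clamp01_1 mulr1 invr1 !scale1.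
have -> // : x + b x + N (x + b x) = f x.
have -> : x + b x = h x by rewrite /b subrKC.
by rewrite /h ND Nneg NN subr0 subrK.
Qed.

End Kister.

(** * Lifts of torus homeomorphisms and their linear part *)

Section TorusHomeo.
Context {R : realType} (L : lattice R).
Notation T := (torus L).
Notation pr := (torus_cover L).
Notation cuL := (cu L).
Notation cvL := (cv L).
Notation lm := (lmap L).

Lemma lattice_pt_ind (P : set (plane R)) : P (bu L) -> P (bv L) ->
  (forall x y, P x -> P y -> P (x - y)) -> forall l, lattice_pt L l -> P l.
Proof.
move=> Pu Pv PB.
have P0 : P 0 by rewrite -(subrr (bu L)); exact: PB.
have PN x : P x -> P (- x) by move=> Px; rewrite -sub0r; exact: PB.
have PD x y : P x -> P y -> P (x + y) by move=> Px Py; rewrite -(opprK y); apply: PB => //; exact: PN.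
have Pn x n : P x -> P (x *+ n).
  by move=> Px; elim: n => [|n IH]; rewrite ?mulr0n // mulrS; exact: PD.
have Pz x (k : int) : P x -> P (x *~ k).
  by move=> Px; case: k => n; [exact: Pn|apply: PN; exact: Pn].
by move=> l [a [b ->]]; apply: PD; exact: Pz.
Qed.

Lemma lattice_bu : lattice_pt L (bu L).
Proof. by exists 1, 0; rewrite mulr1z mulr0z addr0. Qed.

Lemma lattice_bv : lattice_pt L (bv L).
Proof. by exists 0, 1; rewrite mulr1z mulr0z add0r. Qed.

Lemma cu_bu : cuL (bu L) = 1.
Proof.
have -> : bu L = comb L 1 0 by rewrite /comb; case: (bu L) => a b; rewrite /= !mul1r !mul0r !addr0.
by rewrite cu_comb.
Qed.

Lemma cv_bu : cvL (bu L) = 0.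
Proof.
have -> : bu L = comb L 1 0 by rewrite /comb; case: (bu L) => a b; rewrite /= !mul1r !mul0r !addr0.
by rewrite cv_comb.
Qed.

Lemma cu_bv : cuL (bv L) = 0.
Proof.
have -> : bv L = comb L 0 1 by rewrite /comb; case: (bv L) => a b; rewrite /= !mul1r !mul0r !add0r.
by rewrite cu_comb.
Qed.

Lemma cv_bv : cvL (bv L) = 1.
Proof.
have -> : bv L = comb L 0 1 by rewrite /comb; case: (bv L) => a b; rewrite /= !mul1r !mul0r !add0r.
by rewrite cv_comb.
Qed.

Lemma lmap_bu nu nv : lm nu nv (bu L) = nu.
Proof. by rewrite /lmap cu_bu cv_bu; case: nu => a b /=; rewrite !mul1r !mul0r !addr0. Qed.

Lemma lmap_bv nu nv : lm nu nv (bv L) = nv.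
Proof. by rewrite /lmap cu_bv cv_bv; case: nv => a b /=; rewrite !mul1r !mul0r !add0r. Qed.

Lemma lmapB nu nv x y : lm nu nv (x - y) = lm nu nv x - lm nu nv y.
Proof. by rewrite lmapD lmapN. Qed.

(** I + N is the action of the torus map on the lattice, that is, on the fundamental group of the
    torus. *)
Definition quasi_periodic (f : plane R -> plane R) nu nv :=
  forall x l, lattice_pt L l -> f (x + l) = f x + l + lm nu nv l.

Lemma quasi_periodic_gen (f : plane R -> plane R) nu nv :
  (forall x, f (x + bu L) = f x + bu L + nu) -> (forall x, f (x + bv L) = f x + bv L + nv) ->
  quasi_periodic f nu nv.
Proof.
move=> fu fv x l hl; move: x.
apply: (@lattice_pt_ind (fun l => forall x, f (x + l) = f x + l + lm nu nv l) _ _ _ l hl).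
- by move=> x; rewrite lmap_bu.
- by move=> x; rewrite lmap_bv.
move=> {hl}l l' h h' x; have e := h' (x - l'); rewrite subrK in e.
rewrite addrA addrAC h e lmapB.
set a := lm nu nv l; set b := lm nu nv l'; set c := f _.
ring.
Qed.

Lemma lattice_valued_plane (g : plane R -> plane R) : continuous g ->
  (forall x, lattice_pt L (g x)) -> forall x y, g x = g y.
Proof.
move=> cg gL x y; have C := @plane_contraction R.
by rewrite (lattice_valued_cst C cg gL x) (lattice_valued_cst C cg gL y).
Qed.

(** For a lattice vector l, the map [f (x + l) - f x - l] is continuous and lattice-valued, hence
    constant; its values on the basis are [nu] and [nv]. *)
Lemma lift_quasi_periodic (fT : T -> T) : continuous fT -> exists f nu nv,
  [/\ continuous f, forall x, pr (f x) = fT (pr x), lattice_pt L nu, lattice_pt L nv &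
    quasi_periodic f nu nv].
Proof.
move=> cfT; have cpr := @torus_cover_continuous R L.
have cF : continuous (fun x => fT (pr x)) by cts.
have [f [cf fP]] := lifting (@plane_contraction R) cF.
pose n l := f (0 + l) - f 0 - l.
have nP l : lattice_pt L l -> lattice_pt L (n l) /\ forall x, f (x + l) = f x + l + n l.
  move=> hl; pose g x := f (x + l) - f x - l.
  have gL x : lattice_pt L (g x).
    apply: latticeB => //; apply/torus_coverP.
    by rewrite !fP torus_cover_shift.
  have cg : continuous g.
    move=> x; apply: cat_plane_add; last exact: cat_cst.
    apply: cat_plane_add; last by apply: cat_plane_opp; exact: cf.
    by apply: (@cat_comp _ _ _ (fun x : plane R => x + l) f); [exact: addr_continuous|exact: cf].
  split; first exact: gL.
  move=> x; have e : g x = n l by rewrite (lattice_valued_plane cg gL x 0).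
  by rewrite -e /g; set a := f _; set b := f _; ring.
have [nuL nuP] := nP _ lattice_bu; have [nvL nvP] := nP _ lattice_bv.
exists f, (n (bu L)), (n (bv L)); split => //.
exact: quasi_periodic_gen.
Qed.

Lemma periodic_bounded (p : plane R -> plane R) : continuous p ->
  (forall x l, lattice_pt L l -> p (x + l) = p x) ->
  exists C, forall x, `|(p x).1| <= C /\ `|(p x).2| <= C.
Proof.
move=> cp pL.
have bnd (q : plane R -> R) : continuous q -> (forall x l, lattice_pt L l -> q (x + l) = q x) ->
    exists C, forall x, `|q x| <= C.
  move=> cq qL.
  have /compact_bounded[M [_ MC]] : compact (q @` cell L).
    by apply: continuous_compact; [exact: continuous_subspaceT|exact: cell_compact].
  exists (M + 1) => x; have [l [hl hc]] := cell_shift L x.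
  by rewrite -(qL x l hl); apply: (MC (M + 1)); [lra|exists (x + l)].
have [|x l hl|C1 h1] := bnd (fun x => (p x).1); [by cts|by rewrite pL|].
have [|x l hl|C2 h2] := bnd (fun x => (p x).2); [by cts|by rewrite pL|].
exists (Num.max C1 C2) => x; rewrite !le_max h1 h2 orbT; split => //.
Qed.

Definition mutual_inverse (A B : Type) (f : A -> B) (g : B -> A) :=
  (forall x, g (f x) = x) /\ (forall y, f (g y) = y).

(** A lift of [gT] composed with [f], on either side, is a translation by a lattice vector. One
    translation is corrected by shifting the argument; the other gives injectivity of [f]. *)
Lemma lift_inverse (fT gT : T -> T) (f : plane R -> plane R) :
  continuous gT -> mutual_inverse fT gT -> continuous f -> (forall x, pr (f x) = fT (pr x)) ->
  exists g, continuous g /\ mutual_inverse f g.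
Proof.
move=> cgT [gfT fgT] cf fP; have cpr := @torus_cover_continuous R L.
have cG : continuous (fun x => gT (pr x)) by cts.
have [g0 [cg0 g0P]] := lifting (@plane_contraction R) cG.
pose a x := f (g0 x) - x; pose b x := g0 (f x) - x.
have ca : continuous a.
  by move=> x; apply: cat_plane_add; [cts|apply: cat_plane_opp; cts].
have cb : continuous b.
  by move=> x; apply: cat_plane_add; [cts|apply: cat_plane_opp; cts].
have aL x : lattice_pt L (a x) by apply/torus_coverP; rewrite fP g0P fgT.
have bL x : lattice_pt L (b x) by apply/torus_coverP; rewrite g0P fP gfT.
pose g y := g0 (y - a 0).
have fg y : f (g y) = y.
  have : a (y - a 0) = a 0 by exact: lattice_valued_plane.
  by rewrite {1}/a -/(g y) => /eqP; rewrite subr_eq => /eqP ->; rewrite subrKC.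
have fi x y : f x = f y -> x = y.
  move=> e; have : b x = b y by exact: lattice_valued_plane.
  by rewrite /b e => /addrI /oppr_inj.
exists g; split; last by split => // x; apply: fi; rewrite fg.
move=> y; apply: (@cat_comp _ _ _ (fun y : plane R => y - a 0) g0); last exact: cg0.
exact: addr_continuous.
Qed.

Lemma torus_homeo_isotopic (fT gT : T -> T) (f : plane R -> plane R) nu nv
    (K K' : set (T * R)) : continuous gT -> mutual_inverse fT gT -> continuous f ->
  (forall x, pr (f x) = fT (pr x)) -> quasi_periodic f nu nv ->
  lm nu nv nu = 0 -> lm nu nv nv = 0 -> (forall y z, K (y, z) <-> K' (fT y, z)) ->
  strongly_isotopic (lift_link K) (lift_link K').
Proof.
move=> cgT fgT cf fP fq Nu Nv KK'.
have [g [cg [gf fg]]] := lift_inverse cgT fgT cf fP.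
have cN := @lmap_continuous R L nu nv.
(* Quasi-periodicity makes this remainder periodic, hence bounded by compactness of a cell. *)
pose p x := f x - x - lm nu nv x.
have [|x l hl|C pC] := @periodic_bounded p.
- move=> x; apply: cat_plane_add; last by apply: cat_plane_opp; cts.
  by apply: cat_plane_add; [cts|apply: cat_plane_opp; cts].
- by rewrite /p fq // lmapD; set a := f x; set b := lm _ _ _; set c := lm _ _ _; ring.
have NN x : lm nu nv (lm nu nv x) = 0.
  have e : lm nu nv x = scale (cuL x) nu + scale (cvL x) nv by [].
  by rewrite [X in lm nu nv X]e lmapD !lmapZ Nu Nv /scale /= !mulr0 addr0.
apply: (bounded_distance_isotopic cf cg gf fg NN pC) => x z.
by rewrite /lift_link /= fP; exact: KK'.
Qed.

Lemma agree_near_sym (S : topologicalType) (D D' : diagram S) (x : S) :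
  agree_near R x D D' -> agree_near R x D' D.
Proof.
move=> [h1 h2]; have h : \forall y \near x, curve D' y <-> curve D y.
  by apply: filterS h1 => y [? ?]; split.
by split => // /(crossing_local h) /h2; apply: filterS => y [? ?]; split.
Qed.

Definition realizable (D D' : diagram T) := forall K, presents K D ->
  exists K', presents K' D' /\ strongly_isotopic (lift_link K) (lift_link K').

Lemma bijection_local_homeo (S S' : topologicalType) (f : S -> S') (g : S' -> S) :
  continuous f -> continuous g -> mutual_inverse f g -> local_homeo f.
Proof.
move=> cf cg [gf fg]; split => // [U oU|x].
  suff -> : f @` U = g @^-1` U by apply: open_comp => // *; exact: cg.
  by apply/seteqP; split=> [_ [u Uu <-]|y Uy] /=; rewrite ?gf //; exists (g y).
by exists setT; [exact: filterT|move=> a b _ _ e; rewrite -(gf a) e gf].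
Qed.

Lemma carries_realizable (fT gT : T -> T) (f : plane R -> plane R) nu nv (D D' : diagram T) :
  continuous fT -> continuous gT -> mutual_inverse fT gT -> continuous f ->
  (forall x, pr (f x) = fT (pr x)) -> quasi_periodic f nu nv ->
  lm nu nv nu = 0 -> lm nu nv nv = 0 -> carries (R := R) fT D D' ->
  realizable D D' /\ realizable D' D.
Proof.
move=> cfT cgT fg cf fP fq Nu Nv cD; have [gfT fgT] := fg.
have lf := bijection_local_homeo cfT cgT fg.
split=> K pK.
  exists (pull_link gT K); split.
    move=> y; rewrite -(fgT y); apply/(presents_pull lf).
    have -> : pull_link fT (pull_link gT K) = K.
      by apply/seteqP; split=> -[x z]; rewrite /pull_link /= gfT.
    exact: presents_same cD pK _.
  apply: (torus_homeo_isotopic cgT fg cf fP fq Nu Nv) => y z.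
  by rewrite /pull_link /= gfT.
exists (pull_link fT K); split.
  apply: (@presents_same _ _ _ (pullback fT D')).
    by move=> x; exact: agree_near_sym.
  by move=> x; apply/(presents_pull lf).
apply: strongly_isotopic_sym.
exact: (torus_homeo_isotopic cgT fg cf fP fq Nu Nv).
Qed.

Lemma homeo_inverse (f : T -> T) : homeo_on setT f -> continuous f /\
  exists g, continuous g /\ mutual_inverse f g.
Proof.
move=> [cf [_ [g [cg [_ gf]]]]]; split; first exact/continuous_subspace_setT.
exists g; split; first exact/continuous_subspace_setT.
by split=> x; case: (gf x I).
Qed.

(** The whole isotopy is lifted, time included. The defect of periodicity is lattice-valued, so
    constant in time, and it vanishes at time 0, where the lift is a translation. Hence N = 0. *)
Lemma isotopy_realizable (D D' : diagram T) : isotopy_move (R := R) D D' ->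
  realizable D D' /\ realizable D' D.
Proof.
move=> [H [[cH [hH H0]] cD]].
have h1 : 0 <= (1 : R) <= 1 by rewrite ler01 lexx.
have [cfT [gT [cgT fg]]] := homeo_inverse (hH 1 h1).
have cpr := @torus_cover_continuous R L.
pose F (q : R * plane R) := H (clamp 0 1 q.1) (pr q.2).
have cF : continuous F.
  move=> q; have h := (@cat_within _ _ _ _ (fun p => H p.1 p.2)
    (fun q : R * plane R => (clamp 0 1 q.1, pr q.2)) q cH).
  apply: h; first by cts.
  by move=> y; split => //=; rewrite in_itv /=; exact: clamp01P.
have [f0 [cf0 f0P]] := lifting (@space_contraction R) cF.
pose d x := f0 (0, x) - x.
have dL x : lattice_pt L (d x).
  by apply/torus_coverP; rewrite f0P /F /= clamp01_0 H0.
have cd : continuous d.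
  by move=> x; apply: cat_plane_add; [cts|apply: cat_plane_opp; cts].
have dc x : f0 (0, x) = x + d 0.
  by rewrite (lattice_valued_plane cd dL 0 x) /d subrKC.
have per t x l : lattice_pt L l -> f0 (t, x + l) = f0 (t, x) + l.
  move=> hl; pose g t := f0 (t, x + l) - f0 (t, x) - l.
  have gL s : lattice_pt L (g s).
    by apply: latticeB => //; apply/torus_coverP; rewrite !f0P /F /= torus_cover_shift.
  have cg : continuous g.
    move=> s; apply: cat_plane_add; last exact: cat_cst.
    by apply: cat_plane_add; [cts|apply: cat_plane_opp; cts].
  have RC : contraction (fun p : R * R => p.1 * p.2) 0.
    by split; [cts|move=> s /=; rewrite mul0r|move=> s /=; rewrite mul1r].
  have g0 : g t = 0.
    by rewrite (lattice_valued_cst RC cg gL t) /g !dc; set b := d 0; ring.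
  have -> : f0 (t, x + l) = g t + f0 (t, x) + l by rewrite /g; set a := f0 _; ring.
  by rewrite g0 add0r.
have lm0 y : lm 0 0 y = 0 by rewrite /lmap /= !mulr0 addr0.
apply: (@carries_realizable (H 1) gT (fun x => f0 (1, x)) 0 0) => //.
- by cts.
- by move=> x; rewrite f0P /F /= clamp01_1.
- by move=> x l hl; rewrite per // lm0 addr0.
Qed.

End TorusHomeo.

(** * Dehn twists *)

Section Dehn.
Context {R : realType} (L : lattice R).
Notation T := (torus L).
Notation pr := (torus_cover L).
Notation cuL := (cu L).
Notation cvL := (cv L).
Notation lm := (lmap L).

Let strip : set (R * R) := [set p : R * R | 0 <= p.2 <= 1].

Section Twist.
Variables (fT : T -> T) (phi : R * R -> T).
Hypotheses (cfT : continuous fT) (cphi : {within strip, continuous phi}).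
Hypothesis phi_inj : forall p q, strip p -> strip q ->
  (phi p = phi q <-> p.2 = q.2 /\ exists k : int, p.1 - q.1 = k%:~R).
Hypothesis twist : forall p, strip p -> fT (phi p) = phi (p.1 + p.2, p.2).
Hypothesis fix_out : forall x, ~ (phi @` strip) x -> fT x = x.

Let clip (p : R * R) : R * R := (p.1, clamp 0 1 p.2).

Let clip_strip p : strip (clip p). Proof. exact: clamp01P. Qed.

Let clip_id p : strip p -> clip p = p.
Proof. by case: p => s t h; rewrite /clip /= clamp_id. Qed.

(** [l0] is the class of the core of the annulus; the difference between the lifts at [s + 1] and
    [s] is lattice-valued, hence constant. *)
Lemma annulus_lift : exists (Phi : R * R -> plane R) (l0 : plane R),
  [/\ continuous Phi, forall p, strip p -> pr (Phi p) = phi p, lattice_pt L l0 &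
    forall s t, Phi (s + 1, t) = Phi (s, t) + l0].
Proof.
have cF : continuous (fun p => phi (clip p)).
  by move=> p; apply: (@cat_within _ _ _ strip phi clip p cphi) => //; rewrite /clip; cts.
have [Phi [cPhi PhiP]] := lifting (@plane_contraction R) cF.
pose d (p : R * R) := Phi (p.1 + 1, p.2) - Phi p.
have dL p : lattice_pt L (d p).
  apply/torus_coverP; rewrite !PhiP; apply/phi_inj => //; split => //.
  by exists 1; rewrite /clip /= addrAC subrr add0r.
have cd : continuous d by rewrite /d; cts.
exists Phi, (d 0); split => //.
- by move=> p sp; rewrite PhiP clip_id.
- by move=> s t; rewrite -(lattice_valued_plane cd dL (s, t) 0) /d subrKC.
Qed.

Variables (Phi : R * R -> plane R) (l0 : plane R).
Hypotheses (cPhi : continuous Phi) (PhiP : forall p, strip p -> pr (Phi p) = phi p).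
Hypotheses (l0L : lattice_pt L l0) (Phi_per : forall s t, Phi (s + 1, t) = Phi (s, t) + l0).

Lemma annulus_lift_int s t (k : int) : Phi (s + k%:~R, t) - Phi (s, t) = l0 *~ k.
Proof.
have n (j : nat) u : Phi (u + j%:R, t) = Phi (u, t) + l0 *+ j.
  by elim: j => [|j IH]; rewrite ?mulr0n ?addr0 // -natr1 addrA Phi_per IH mulrSr addrA.
case: k => j; first by rewrite n addrAC subrr add0r.
rewrite NegzE !mulrNz; have := n j.+1 (s - j.+1%:R); rewrite subrK => ->.
by rewrite opprD addrA subrr sub0r.
Qed.

Variables (ell : plane R -> R).
Hypotheses (ellD : forall x y, ell (x + y) = ell x + ell y) (ellc : continuous ell).
Hypotheses (ell0 : ell l0 = 0) (ellZ : forall l, lattice_pt L l -> exists k : int, ell l = k%:~R).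

Let ell00 : ell 0 = 0. Proof. by have := ellD 0 0; rewrite addr0; lra. Qed.
Let ellN x : ell (- x) = - ell x.
Proof. by have := ellD x (- x); rewrite subrr ell00; lra. Qed.
Let ellB x y : ell (x - y) = ell x - ell y. Proof. by rewrite ellD ellN. Qed.

Let sq : set (R * R) := `[0, 1] `*` `[0, 1].

Let sq_strip p : sq p -> strip p.
Proof. by move=> [_]; rewrite /= in_itv. Qed.

Let sq_cover p : strip p -> exists2 q, sq q & phi q = phi p.
Proof.
case: p => s t st; exists (s - (Num.floor s)%:~R, t).
  split; rewrite /= in_itv /= ?subr_ge0 ?floor_le //= lerBlDl.
  by have := floorD1_gt s; rewrite intrD; lra.
apply/phi_inj => //; split => //; exists (- Num.floor s) => /=.
by rewrite intrN addrAC subrr add0r.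
Qed.

(** The displacement of the lifted twist measured by [ell]. As [ell] kills [l0], it is well defined
    on the annulus and zero on both boundary circles. *)
Let disp (p : R * R) : R := ell (Phi (p.1 + p.2, p.2)) - ell (Phi p).

Let disp_phi p q : strip p -> strip q -> phi p = phi q -> disp p = disp q.
Proof.
move=> sp sq' /(phi_inj sp sq')[]; case: p q {sp sq'} => s t [s' t'] /= <- [k e].
have e1 : s = s' + k%:~R by rewrite -e subrKC.
have e2 : s + t = s' + t + k%:~R by rewrite e1 addrAC.
rewrite /disp /= e2 e1; have h1 := annulus_lift_int (s' + t) t k; have h2 := annulus_lift_int s' t k.
have := congr1 ell h1; have := congr1 ell h2; rewrite !ellB.
have -> : ell (l0 *~ k) = 0.
  have n (j : nat) : ell (l0 *+ j) = 0.
    by elim: j => [|j IH]; rewrite ?mulr0n // mulrS ellD ell0 IH addr0.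
  by case: k {e e1 e2 h1 h2} => j; [exact: n|rewrite NegzE mulrNz ellN -[_ *~ _]/(l0 *+ j.+1) n oppr0].
by lra.
Qed.

Let cdisp : continuous disp. Proof. by rewrite /disp; cts. Qed.

(* A frontier point of the annulus is fixed by [fT], being a limit of points outside: it lies on
   a boundary circle, where [disp] vanishes.  This replaces invariance of domain. *)
Lemma displacement_function : exists G : T -> R, [/\ continuous G,
  forall p, strip p -> G (phi p) = disp p & forall y, ~ (phi @` strip) y -> G y = 0].
Proof.
have [|G GP] := @boolp.choice T R (fun y r => (forall p, strip p -> phi p = y -> r = disp p) /\
    (~ (phi @` strip) y -> r = 0)).
  move=> y; have [[p sp py]|n] := pselect ((phi @` strip) y).
    exists (disp p); split; last by case; exists p.
    by move=> q sq' qy; apply: disp_phi => //; rewrite py qy.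
  by exists 0; split => // p sp py; case: n; exists p.
have Gphi p : strip p -> G (phi p) = disp p by move=> sp; case: (GP (phi p)) => h _; exact: h.
have Gout y : ~ (phi @` strip) y -> G y = 0 by case: (GP y).
exists G; split => //; apply/continuous_closedP => Z cZ.
have csq Y : closed Y -> closed (phi @` (sq `&` Y)).
  move=> cY; apply: compact_closed; first exact: torus_hausdorff.
  have cpt : compact (sq `&` Y).
    apply: (@subclosed_compact _ _ sq) => //.
      by apply: closedI => //; apply: compact_closed;
        [exact: norm_hausdorff|apply: compact_setX; exact: segment_compact].
    by apply: compact_setX; exact: segment_compact.
  apply: continuous_compact cpt.
  by apply: continuous_subspaceW cphi => p [/sq_strip].
have c1 : closed (phi @` (sq `&` disp @^-1` Z)).
  by apply: csq; apply: closed_comp => // *; exact: cdisp.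
pose B := closure (~` (phi @` strip)).
have GB y : B y -> G y = 0.
  move=> By; have [[p sp py]|/Gout //] := pselect ((phi @` strip) y).
  have fy : fT y = y.
    apply/eqP/negP => /negP ne.
    have := @torus_hausdorff R L; rewrite open_hausdorff => /(_ _ _ ne)[[U V] /=].
    rewrite !inE => -[Uf Vy] [oU oV UV0].
    have UV : U `&` V `<=` set0 by rewrite UV0.
    have nU : nbhs y (fT @^-1` U) by apply: cfT; exact: open_nbhs_nbhs.
    have nV : nbhs y V by exact: open_nbhs_nbhs.
    have [z [nz [fU Vz]]] := By _ (filterI nU nV).
    by apply: (UV z); split => //; move: fU; rewrite /= fix_out.
  (* A fixed point of the twist in the annulus has an integer second coordinate, hence 0 or 1; its
     displacement is then [ell] of 0 or of [l0]. *)
  have : phi (p.1 + p.2, p.2) = phi p by rewrite -twist // py.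
  move=> /(phi_inj (p := (p.1 + p.2, p.2)) sp sp)[_ [k]].
  rewrite /= addrAC subrr add0r => ek.
  rewrite -py Gphi // /disp; have := annulus_lift_int p.1 p.2 k.
  rewrite -ek => /(congr1 ell); rewrite ellB => h.
  have -> : Phi p = Phi (p.1, p.2) by case: (p).
  rewrite h; have := sp; rewrite /strip /= ek => /andP[k0 k1].
  have [->|->] : k = 0 \/ k = 1.
    have : (k : int) <= 1 by rewrite -(ler_int R).
    have : 0 <= (k : int) by rewrite -(ler_int R).
    by lia.
  - by rewrite mulr0z.
  - by rewrite mulr1z.
have GA y : (phi @` strip) y -> Z (G y) -> (phi @` (sq `&` disp @^-1` Z)) y.
  move=> [p sp <-]; have [q sq' qp] := sq_cover sp; rewrite -qp Gphi; last exact: sq_strip.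
  by move=> Zq; exists q.
have AG y : (phi @` (sq `&` disp @^-1` Z)) y -> Z (G y).
  by move=> [p [/sq_strip sp Zp] <-]; rewrite Gphi.
(* The preimage of [Z] is the image of a compact set, together with the closed set [B] when [Z]
   contains 0, the value of [G] on [B]. *)
have [Z0|nZ0] := pselect (Z 0).
  have -> : G @^-1` Z = (phi @` (sq `&` disp @^-1` Z)) `|` B.
    apply/seteqP; split=> y.
      move=> Zy; have [ay|na] := pselect ((phi @` strip) y); first by left; exact: GA.
      by right; exact: subset_closure.
    by case=> [/AG|/GB e] //; rewrite /= e.
  by apply: closedU => //; exact: closed_closure.
have -> // : G @^-1` Z = phi @` (sq `&` disp @^-1` Z).
apply/seteqP; split=> y; last exact: AG.
move=> Zy; apply: GA => //; have [//|/Gout e] := pselect ((phi @` strip) y).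
by case: nZ0; rewrite -e.
Qed.

(* [ell (f x - x)] and [G (pr x)] differ by an integer, which is constant, and the second is
   periodic. *)
Lemma twist_linear_part (f : plane R -> plane R) nu nv l : continuous f ->
  (forall x, pr (f x) = fT (pr x)) -> quasi_periodic L f nu nv -> lattice_pt L l ->
  ell (lm nu nv l) = 0.
Proof.
move=> cf fP fq hl; have [G [cG Gphi Gout]] := displacement_function.
have cpr := @torus_cover_continuous R L.
pose k (x : plane R) := ell (f x - x) - G (pr x).
have kZ x : exists j : int, k x = j%:~R.
  have [[p sp px]|n] := pselect ((phi @` strip) (pr x)); last first.
    rewrite /k Gout // subr0; apply: ellZ; apply/torus_coverP.
    by rewrite fP fix_out.
  rewrite /k -px Gphi // /disp -ellB -ellB; apply: ellZ.
  have sp' : strip (p.1 + p.2, p.2) by [].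
  have h : pr (f x) = pr (Phi (p.1 + p.2, p.2)) by rewrite fP -px twist // PhiP.
  have h' : pr x = pr (Phi p) by rewrite PhiP.
  move: h h' => /torus_coverP h /torus_coverP h'.
  have := latticeB h h'; set a := f x; set b := Phi _; set c := Phi _.
  by have -> : a - b - (x - c) = a - x - (b - c) by ring.
have ck : continuous k by rewrite /k; cts.
have kc x : k x = k 0.
  have : k (1 * x.1, 1 * x.2) = k (0 * x.1, 0 * x.2).
    apply: (@int_valued_cst R (fun s => k (s * x.1, s * x.2))); first by cts.
    by move=> s; exact: kZ.
  by case: x => x1 x2; rewrite !mul1r !mul0r.
have := kc (0 + l); rewrite /k torus_cover_shift // fq //.
set a := f 0; set b := lm nu nv l.
have -> : a + l + b - (0 + l) = (a - 0) + b by ring.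
by rewrite ellD; lra.
Qed.

End Twist.

(** Every integral form that vanishes on [l0] vanishes on the image of N. For nonzero [l0] one form
    confines the image to the line of [l0]; if the core is null-homotopic, both coordinates are such
    forms and N = 0. *)
Lemma dehn_realizable (D D' : diagram T) : dehn_move (R := R) D D' ->
  realizable D D' /\ realizable D' D.
Proof.
move=> [fT [[hf [phi [cphi [phi_inj [twist fix_out]]]]] cD]].
have [cfT [gT [cgT fg]]] := homeo_inverse hf.
have [f [nu [nv [cf fP nuL nvL fq]]]] := lift_quasi_periodic cfT.
have [Phi [l0 [cPhi PhiP l0L Phi_per]]] := annulus_lift cphi phi_inj.
have cc := @cu_continuous R L; have cc' := @cv_continuous R L.
have lin (ell : plane R -> R) : (forall x y, ell (x + y) = ell x + ell y) -> continuous ell ->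
    ell l0 = 0 -> (forall l, lattice_pt L l -> exists k : int, ell l = k%:~R) ->
    forall l, lattice_pt L l -> ell (lm nu nv l) = 0.
  move=> ellD ellc ell0 ellZ l hl.
  exact: (twist_linear_part cfT cphi phi_inj twist fix_out cPhi PhiP Phi_per
    ellD ellc ell0 ellZ cf fP fq hl).
(* The twist fixes the boundary circle at level 0, so lifted points of it move by a constant lattice
   vector; one turn around the circle would add [lm nu nv l0] to this vector. *)
have Nl0 : lm nu nv l0 = 0.
  have st s : [set p : R * R | 0 <= p.2 <= 1] (s, 0) by rewrite /= lexx ler01.
  pose h s := f (Phi (s, 0)) - Phi (s, 0).
  have hL s : lattice_pt L (h s).
    by apply/torus_coverP; rewrite fP (PhiP _ (st s)) (twist _ (st s)) /= addr0.
  have ch : continuous h by rewrite /h; cts.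
  have RC : contraction (fun p : R * R => p.1 * p.2) 0.
    by split; [cts|move=> s /=; rewrite mul0r|move=> s /=; rewrite mul1r].
  have := lattice_valued_cst RC ch hL (0 + 1).
  rewrite /h Phi_per fq //; set a := f _; set b := Phi _; set c := lm _ _ _.
  have -> : a + l0 + c - (b + l0) = a - b + c by ring.
  by move=> /eqP; rewrite addrC -subr_eq0 addrK => /eqP.
have [a [b [ea eb]]] : exists a b : int, cuL l0 = a%:~R /\ cvL l0 = b%:~R by exact/lattice_ptP.
have lattice_coord l : lattice_pt L l -> exists c d : int, cuL l = c%:~R /\ cvL l = d%:~R.
  by move=> /lattice_ptP.
suff NN l : lattice_pt L l -> lm nu nv (lm nu nv l) = 0.
  apply: (carries_realizable cfT cgT fg cf fP fq _ _ cD).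
    by have := NN _ (lattice_bu L); rewrite lmap_bu.
  by have := NN _ (lattice_bv L); rewrite lmap_bv.
move=> hl.
(* The form used is the determinant with [l0]. *)
have h1 : a%:~R * cvL (lm nu nv l) - b%:~R * cuL (lm nu nv l) = 0.
  apply: (lin (fun x => a%:~R * cvL x - b%:~R * cuL x)) => //.
  - by move=> x y; rewrite cuD cvD; ring.
  - by cts.
  - by rewrite ea eb; ring.
  - move=> l' /lattice_coord[c [d [-> ->]]]; exists (a * d - b * c).
    by rewrite intrB !intrM.
move: Nl0; rewrite {1}/lmap ea eb => -[e1 e2].
set w := lm nu nv l in h1 *.
(* After multiplication by a nonzero coordinate of [l0], the image of [w] is a combination of the
   image of [l0] and of the determinant of [l0] and [w], both zero. *)
have [a0|a0] := eqVneq (a%:~R : R) 0; last first.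
  rewrite /lmap; congr (_, _); apply: (mulfI a0); rewrite mulr0.
    have -> : a%:~R * (cuL w * nu.1 + cvL w * nv.1) =
        cuL w * (a%:~R * nu.1 + b%:~R * nv.1) +
        nv.1 * (a%:~R * cvL w - b%:~R * cuL w) by ring.
    by rewrite e1 h1 !mulr0 addr0.
  have -> : a%:~R * (cuL w * nu.2 + cvL w * nv.2) =
      cuL w * (a%:~R * nu.2 + b%:~R * nv.2) +
      nv.2 * (a%:~R * cvL w - b%:~R * cuL w) by ring.
  by rewrite e2 h1 !mulr0 addr0.
have [b0|b0] := eqVneq (b%:~R : R) 0; last first.
  rewrite /lmap; congr (_, _); apply: (mulfI b0); rewrite mulr0.
    have -> : b%:~R * (cuL w * nu.1 + cvL w * nv.1) =
        cvL w * (a%:~R * nu.1 + b%:~R * nv.1) -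
        nu.1 * (a%:~R * cvL w - b%:~R * cuL w) by ring.
    by rewrite e1 h1 !mulr0 subr0.
  have -> : b%:~R * (cuL w * nu.2 + cvL w * nv.2) =
      cvL w * (a%:~R * nu.2 + b%:~R * nv.2) -
      nu.2 * (a%:~R * cvL w - b%:~R * cuL w) by ring.
  by rewrite e2 h1 !mulr0 subr0.
have wu : cuL w = 0.
  apply: (lin cuL) => //; [exact: cuD|by rewrite ea a0|].
  by move=> l' /lattice_coord[c [d [-> _]]]; exists c.
have wv : cvL w = 0.
  apply: (lin cvL) => //; [exact: cvD|by rewrite eb b0|].
  by move=> l' /lattice_coord[c [d [_ ->]]]; exists d.
by rewrite /lmap wu wv !mul0r addr0.
Qed.

End Dehn.

(** * Local moves *)

Section LocalMove.
Context {R : realType} (L : lattice R).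
Notation T := (torus L).
Notation pr := (torus_cover L).

Definition big_box : set (plane R) := [set p | `|p.1| <= 10 /\ `|p.2| <= 10].

(* [N] and [N'] are links in [plane R * ]-1, 1[] over the pictures [P] and [P'], and [F] is a
   horizontal isotopy with support in [big_box] that carries [N] to [N']. *)
Definition model_move (P P' : diagram (plane R)) (N N' : set (plane R * R)) :=
  exists F G : R * (plane R * R) -> plane R,
  [/\ continuous F, continuous G,
    forall t p z, G (t, (F (t, (p, z)), z)) = p & forall t p z, F (t, (G (t, (p, z)), z)) = p] /\
  [/\ forall p z, F (0, (p, z)) = p, forall t p z, ~ big_box p -> F (t, (p, z)) = p &
    forall p z, N (p, z) <-> N' (F (1, (p, z)), z)] /\
  [/\ presents N P, presents N' P' & forall p z, ~ box p -> (N (p, z) <-> N' (p, z))].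

Lemma model_move_sym P P' N N' : model_move P P' N N' -> model_move P' P N' N.
Proof.
move=> [F [G [[cF cG GF FG] [[F0 FB FN] [pN pN' NN']]]]]; exists G, F.
split; split => //; split => //; last by move=> p z nb; have [? ?] := NN' p z nb; split.
- by move=> p z; rewrite -{1}(F0 p z) GF.
- by move=> t p z nB; rewrite -{1}(FB t p z nB) GF.
- by move=> p z; rewrite FN FG.
Qed.

Lemma compact_box (r : R) : compact [set p : plane R | `|p.1| <= r /\ `|p.2| <= r].
Proof.
have -> : [set p : plane R | `|p.1| <= r /\ `|p.2| <= r] = `[- r, r] `*` `[- r, r].
  by apply/seteqP; split=> p; rewrite /= !in_itv /= !ler_norml.
by apply: compact_setX; exact: segment_compact.
Qed.

Lemma chart_inverse_out (S : topologicalType) (phi : plane R -> S) (p0 : plane R) :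
  open_embedding phi -> exists psi : S -> plane R, [/\ forall p, psi (phi p) = p,
    forall p, continuous_at (phi p) psi & forall y, ~ range phi y -> psi y = p0].
Proof.
move=> pe; have [psi [psiK psic]] := chart_inverse pe; have [pi [pc po]] := pe.
pose psi' y := if pselect (range phi y) then psi y else p0.
have e p : psi' (phi p) = psi (phi p).
  by rewrite /psi'; case: pselect => // n; case: n; exists p.
exists psi'; split.
- by move=> p; rewrite e psiK.
- move=> p U; rewrite e => /psic h.
  have hr : nbhs (phi p) (range phi).
    by apply: open_nbhs_nbhs; split; [exact/po/openT|exists p].
  change (nbhs (phi p) (psi' @^-1` U)).
  apply: (@filterS _ (nbhs (phi p)) _ ((psi @^-1` U) `&` range phi)); last exact: filterI.
  by move=> y [h' [q _ yq]]; subst y; rewrite /= e.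
- by move=> y ny; rewrite /psi'; case: pselect.
Qed.

Lemma agree_near_refl (S : topologicalType) (D : diagram S) (x : S) : agree_near R x D D.
Proof. by split=> [|_]; apply: nearW. Qed.

Section Chart.
Variables (P P' : diagram (plane R)) (N N' : set (plane R * R)) (D D' : diagram T).
Hypothesis mN : model_move P P' N N'.
Variable phi : plane R -> T.
Hypotheses (pe : open_embedding phi) (sP : same_diagram R (pullback phi D) P)
  (sP' : same_diagram R (pullback phi D') P')
  (out : forall x, ~ (phi @` box) x -> agree_near R x D D').

Lemma chart_presents (Q : diagram (plane R)) (M : set (plane R * R)) (D0 : diagram T) (p : plane R) :
  presents M Q -> same_diagram R (pullback phi D0) Q ->
  presents_at [set q | exists p, phi p = q.1 /\ M (p, q.2)] D0 (phi p).
Proof.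
move=> pM sQ; have [pi _] := pe.
apply/(presents_pull (embedding_local_homeo pe)).
have -> : pull_link phi [set q | exists p, phi p = q.1 /\ M (p, q.2)] = M.
  apply/seteqP; split=> -[q z] /=; last by move=> Mq; exists q.
  by move=> [p' [/pi /= e Mp]]; rewrite -e.
have sQ' : same_diagram R Q (pullback phi D0) by move=> x; apply: agree_near_sym; exact: sQ.
exact: (presents_same sQ' pM).
Qed.

(* First deform [K] vertically so that it becomes the model over [big_box], then apply the
   isotopy of the model in the chart. *)
Lemma chart_realizable : realizable D D'.
Proof.
move=> K pK.
have [F [G [[cF cG GF FG] [[F0 FB FN] [pN pN' NN']]]]] := mN.
have [pi [pc po]] := pe.
(* The default value of [psi] off the chart is a point where the model isotopy is at rest. *)
have far : ~ big_box ((11 : R), (0 : R)) by move=> [/= + _]; rewrite ger0_norm //; lra.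
have [psi [psiK psic psi_out]] := chart_inverse_out ((11 : R), (0 : R)) pe.
pose Nh := [set q : T * R | exists p, phi p = q.1 /\ N (p, q.2)].
pose A := phi @` big_box.
have cA : compact A by apply: continuous_compact; [exact: continuous_subspaceT|exact: compact_box].
have oO : open (range phi) by exact/po/openT.
have AO : A `<=` range phi by move=> _ [p _ <-]; exists p.
have [E [vE EA]] := @vertical_match R T (@torus_normal R L) (@torus_hausdorff R L)
  K Nh D A (range phi) oO cA AO (fun y _ => pK y)
  (fun y '(ex_intro2 p _ e) => eq_ind _ (presents_at Nh D) (chart_presents p pN sP) y e).
have [E' [_ E'E EE']] := vertical_inverse vE.
pose K0 := [set q : T * R | K (q.1, E' q)].
have KK0 y z : K (y, z) <-> K0 (y, E (y, z)) by rewrite /K0 /= E'E.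
have pK0 : presents K0 D by move=> x; apply: vertical_presents vE KK0 (pK x).
have Nphi p z : Nh (phi p, z) <-> N (p, z).
  by split=> [[q [/= /pi e Nq]]|Np]; [rewrite -e|exists p].
have K0A p z : big_box p -> K0 (phi p, z) <-> N (p, z).
  move=> Bp; have Ap : A (phi p) by exists p.
  by have := EA _ Ap (E' (phi p, z)); rewrite EE' Nphi.
have GB t p z : ~ big_box p -> G (t, (p, z)) = p by move=> nB; rewrite -{1}(FB t p z nB) GF.
have GBin t p z : big_box p -> big_box (G (t, (p, z))).
  move=> Bp; have [//|nB] := pselect (big_box (G (t, (p, z)))).
  by move: (nB); rewrite -(FB t _ z nB) FG.
(* The image of [K0] under the isotopy at time 1, with membership tested through the inverse [G]. *)
pose K' := [set q : T * R | (range phi q.1 /\ K0 (phi (G (1, (psi q.1, q.2))), q.2)) \/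
                            (~ range phi q.1 /\ K0 q)].
have K'phi p z : K' (phi p, z) <-> K0 (phi (G (1, (p, z))), z).
  rewrite /K' /= psiK; split=> [[[]//|[]]|h]; first by case; exists p.
  by left; split => //; exists p.
have K'out y z : ~ range phi y -> K' (y, z) <-> K0 (y, z).
  by move=> ny; rewrite /K' /=; split=> [[[]//|[]]//|h]; right.
have K'N p z : big_box p -> K' (phi p, z) <-> N' (p, z).
  by move=> Bp; rewrite K'phi K0A ?FN ?FG //; exact: GBin.
have boxB : box `<=` [set p : plane R | `|p.1| < 10 /\ `|p.2| < 10].
  by move=> p [h1 h2]; split; [move: h1|move: h2]; lra.
exists K'; split.
  move=> x.
  (* Inside the open square [K'] is a copy of [N'], which presents [D']. At other points, which
     avoid the closed image of [box], [K'] agrees locally with [K0], and [D'] with [D]. *)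
  have [[p [p1 p2] <-]|nx] := pselect ((phi @` [set p : plane R | `|p.1| < 10 /\ `|p.2| < 10]) x).
    apply: (@presents_local _ _ [set q | exists p, phi p = q.1 /\ N' (p, q.2)]
      _ D' _ _ _ (agree_near_refl D' (phi p)) (chart_presents p pN' sP')).
    have : nbhs (phi p) (phi @` [set p : plane R | `|p.1| < 10 /\ `|p.2| < 10]).
      apply: open_nbhs_nbhs; split; last by exists p.
      apply: po; rewrite openE => q [q1 q2]; apply: filterI.
        by apply: (@cat_lt _ _ _ (fun q : plane R => `|q.1|) (fun=> 10)) => //; cts.
      by apply: (@cat_lt _ _ _ (fun q : plane R => `|q.2|) (fun=> 10)) => //; cts.
    apply: filterS => _ [q [q1 q2] <-] z; rewrite K'N; last by split; exact: ltW.
    by split=> [[q' [/= /pi <-]] //|h]; exists q.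
  have nbx : ~ (phi @` box) x by move=> [p /boxB ? e]; apply: nx; exists p.
  apply: (presents_local _ (out nbx) (pK0 x)).
  have cb : closed (phi @` box).
    apply: compact_closed; first exact: torus_hausdorff.
    by apply: continuous_compact; [exact: continuous_subspaceT|exact: compact_box].
  have : nbhs x (~` (phi @` box)) by apply: open_nbhs_nbhs; split => //; exact: closed_openC.
  apply: filterS => y nby z.
  have [[p _ py]|ny] := pselect (range phi y); last by rewrite K'out.
  have nbp : ~ box p by move=> bp; apply: nby; exists p.
  rewrite -py; have [Bp|nBp] := pselect (big_box p).
    by rewrite K'N // K0A // NN'.
  by rewrite K'phi GB.
apply: (strongly_isotopic_trans (vertical_isotopic (@torus_cover_continuous R L) vE KK0)).
have [Phi [cPhi PhiP]] := lifting (@plane_contraction R) pc.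
have cpr := @torus_cover_continuous R L.
(* The displacement of the model, seen in the plane through a lift [Phi] of the chart. As a function
   of the torus point alone, it can be added to every lift of that point. *)
pose dl (F0 : R * (plane R * R) -> plane R) (q : R * (T * R)) :=
  Phi (F0 (q.1, (psi q.2.1, q.2.2))) - Phi (psi q.2.1).
have dl_out F1 t y z : (forall t p z, ~ big_box p -> F1 (t, (p, z)) = p) -> ~ A y ->
    dl F1 (t, (y, z)) = 0.
  move=> F1B nA; have nB : ~ big_box (psi y).
    have [[p _ py]|/psi_out -> //] := pselect (range phi y).
    by rewrite -py psiK => Bp; apply: nA; exists p.
  by rewrite /dl /= F1B // subrr.
(* [psi] is known to be continuous only on the range of the chart. A point outside has a
   neighbourhood missing the compact set [A], where the displacement is zero. *)
have cdl F1 : continuous F1 -> (forall t p z, ~ big_box p -> F1 (t, (p, z)) = p) ->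
    continuous (dl F1).
  move=> cF1 F1B [t [y z]].
  have [[p _ py]|ny] := pselect (range phi y).
    have cp : continuous_at y psi by rewrite -py.
    have cq : continuous_at (t, (y, z)) (fun q : R * (T * R) => psi q.2.1).
      by apply: (@cat_comp _ _ _ (fun q : R * (T * R) => q.2.1) psi); [cts|exact: cp].
    rewrite /dl; apply: cat_plane_add; last by cts.
    by cts.
  have nA : ~ A y by move/AO.
  have : nbhs (t, (y, z)) [set q : R * (T * R) | dl F1 q = 0].
    have oA : nbhs y (~` A).
      apply: open_nbhs_nbhs; split => //; apply: closed_openC; apply: compact_closed => //.
      exact: torus_hausdorff.
    have c1 : continuous (fun q : R * (T * R) => q.2.1) by cts.
    apply: (@filterS _ _ _ ((fun q : R * (T * R) => q.2.1) @^-1` (~` A))); last exact: c1.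
    by move=> [t' [y' z']] /= nA'; rewrite dl_out.
  move=> h U; rewrite dl_out // => U0.
  change (nbhs (t, (y, z)) (dl F1 @^-1` U)).
  by apply: filterS h => q /= ->; exact: nbhs_singleton.
have pr_dl F1 t x z p : pr x = phi p -> pr (x + dl F1 (t, (pr x, z))) = phi (F1 (t, (p, z))).
  move=> xp; rewrite /dl /= xp psiK -PhiP.
  apply/torus_coverP; set a := Phi _.
  have : lattice_pt L (x - Phi p) by apply/torus_coverP; rewrite PhiP.
  by set b := Phi _; have -> : x + (a - b) - a = x - b by ring.
have comp F1 F2 t x z : (forall t p z, ~ big_box p -> F1 (t, (p, z)) = p) ->
    (forall t p z, ~ big_box p -> F2 (t, (p, z)) = p) ->
    (forall p, F2 (t, (F1 (t, (p, z)), z)) = p) ->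
    x + dl F1 (t, (pr x, z)) + dl F2 (t, (pr (x + dl F1 (t, (pr x, z))), z)) = x.
  move=> F1B F2B F21; have [[p _ py]|ny] := pselect (range phi (pr x)); last first.
    have nA : ~ A (pr x) by move/AO.
    by rewrite dl_out // addr0 dl_out // addr0.
  rewrite (pr_dl _ _ _ _ _ (esym py)) /dl /= -py !psiK F21.
  by set a := Phi _; set b := Phi _; ring.
exists (fun q => (q.2.1 + dl F (q.1, (pr q.2.1, q.2.2)), q.2.2)),
  (fun q => (q.2.1 + dl G (q.1, (pr q.2.1, q.2.2)), q.2.2)).
have cdF := cdl F cF FB; have cdG := cdl G cG GB.
split; split => /=.
- by cts.
- by cts.
- by move=> t [x z] /=; rewrite comp.
- by move=> t [x z] /=; rewrite comp.
- by move=> t [x z].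
- by move=> t [x z].
- by move=> [x z]; rewrite /dl /= F0 subrr addr0.
move=> [x z]; rewrite /lift_link /=.
have [[p _ py]|ny] := pselect (range phi (pr x)).
  by rewrite (pr_dl _ _ _ _ _ (esym py)) K'phi GF -py.
have nA : ~ A (pr x) by move/AO.
by rewrite dl_out // addr0 K'out.
Qed.

End Chart.

Lemma local_move_realizable P P' N N' (D D' : diagram T) : model_move P P' N N' ->
  local_move (R := R) P P' D D' -> realizable D D' /\ realizable D' D.
Proof.
move=> mN [phi [pe [sP [sP' out]]]]; split; first exact: (chart_realizable mN pe sP sP' out).
have out' x : ~ (phi @` box) x -> agree_near R x D' D by move=> /out; exact: agree_near_sym.
exact: (chart_realizable (model_move_sym mN) pe sP' sP out').
Qed.

End LocalMove.

(** * Horizontal slides depending on the height *)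

Section Slides.
Context {R : realType}.

Definition planar_isotopy (F G : R * (plane R * R) -> plane R) :=
  [/\ continuous F, continuous G,
    forall t p z, G (t, (F (t, (p, z)), z)) = p & forall t p z, F (t, (G (t, (p, z)), z)) = p] /\
  (forall p z, F (0, (p, z)) = p) /\ (forall t p z, ~ big_box p -> F (t, (p, z)) = p).

Lemma planar_isotopy_comp F1 G1 F2 G2 : planar_isotopy F1 G1 -> planar_isotopy F2 G2 ->
  planar_isotopy (fun q => F2 (q.1, (F1 q, q.2.2))) (fun q => G1 (q.1, (G2 q, q.2.2))).
Proof.
move=> [[cF1 cG1 GF1 FG1] [F10 F1B]] [[cF2 cG2 GF2 FG2] [F20 F2B]].
split; [split|split] => /=.
- by cts.
- by cts.
- by move=> t p z; rewrite GF2 GF1.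
- by move=> t p z; rewrite FG1 FG2.
- by move=> p z; rewrite F10 F20.
- by move=> t p z nB; rewrite F1B // F2B.
Qed.

(** The Lipschitz constant 1/2 keeps every intermediate map increasing in the moving coordinate,
    hence invertible. Each height moves on its own, so strands can cross in projection. *)
Lemma slide2 (d : plane R * R -> R) (C : R) : continuous d -> (forall q, `|d q| <= C) ->
  (forall a s s' z, `|d ((a, s'), z) - d ((a, s), z)| <= `|s' - s| / 2) ->
  (forall p z, ~ big_box p -> d (p, z) = 0) ->
  exists F G, planar_isotopy F G /\ forall p z, F (1, (p, z)) = (p.1, p.2 + d (p, z)).
Proof.
move=> cd dC dL dB; pose c t : R := clamp 0 1 t.
pose E (q : (R * (R * R)) * R) := q.2 + c q.1.1 * d ((q.1.2.1, q.2), q.1.2.2).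
have cE : continuous E by rewrite /E /c; cts.
have c01 t : 0 <= c t <= 1 by exact: clamp01P.
have mE x s s' : s < s' -> E (x, s) < E (x, s').
  move=> ss; rewrite /E /=; have := dL x.2.1 s s' x.2.2; have := c01 x.1.
  rewrite (gtr0_norm (_ : 0 < s' - s)) ?subr_gt0 // ler_norml.
  move: (c x.1) (d _) (d _) ss => t u v; clear; move=> ss /andP[t0 t1] /andP[h1 h2].
  by nra.
have bE x s : `|E (x, s) - s| <= C.
  rewrite /E addrAC subrr add0r normrM; have /andP[c0 c1] := c01 x.1.
  rewrite ger0_norm //; have := dC ((x.2.1, s), x.2.2); set u := `|_|.
  have u0 : 0 <= u by exact: normr_ge0.
  by move=> uC; apply: le_trans uC; rewrite -[leRHS]mul1r ler_wpM2r.
have [H [cH HE EH]] := increasing_inverse cE mE bE.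
exists (fun q => (q.2.1.1, E ((q.1, (q.2.1.1, q.2.2)), q.2.1.2))),
  (fun q => (q.2.1.1, H ((q.1, (q.2.1.1, q.2.2)), q.2.1.2))).
split; [split; [split|split]|] => /=.
- by cts.
- by cts.
- by move=> t [a s] z /=; rewrite HE.
- by move=> t [a s] z /=; rewrite EH.
- by move=> [a s] z; rewrite /E /c /= clamp01_0 mul0r addr0.
- by move=> t [a s] z nB; rewrite /E /= dB // mulr0 addr0.
- by move=> [a s] z; rewrite /E /c /= clamp01_1 mul1r.
Qed.

Lemma slide1 (d : plane R * R -> R) (C : R) : continuous d -> (forall q, `|d q| <= C) ->
  (forall a s s' z, `|d ((s', a), z) - d ((s, a), z)| <= `|s' - s| / 2) ->
  (forall p z, ~ big_box p -> d (p, z) = 0) ->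
  exists F G, planar_isotopy F G /\ forall p z, F (1, (p, z)) = (p.1 + d (p, z), p.2).
Proof.
move=> cd dC dL dB; pose sw (p : plane R) : plane R := (p.2, p.1).
have csw : continuous sw by rewrite /sw; cts.
have swK p : sw (sw p) = p by case: p.
have [||||F [G [[[cF cG GF FG] [F0 FB]] F1]]] := @slide2 (fun q => d (sw q.1, q.2)) C.
- by cts.
- by move=> q; exact: dC.
- by move=> a s s' z; exact: dL.
- by move=> [a b] z nB; apply: dB => -[? ?]; apply: nB.
exists (fun q => sw (F (q.1, (sw q.2.1, q.2.2)))), (fun q => sw (G (q.1, (sw q.2.1, q.2.2)))).
split; [split; [split|split]|] => /=.
- by cts.
- by cts.
- by move=> t p z; rewrite swK GF swK.
- by move=> t p z; rewrite swK FG swK.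
- by move=> p z; rewrite F0 swK.
- move=> t [a b] z nB; rewrite FB ?swK // => -[? ?]; exact: nB.
- by move=> [a b] z; rewrite F1.
Qed.

End Slides.

Section Sheets.
Context {R : realType} {S : topologicalType}.

Lemma sheets_arc (P : diagram S) (N : set (S * R)) (x : S) (U : set S) (f : S -> R) : nbhs x U ->
  continuous f -> (forall p q, U p -> U q -> curve P p -> curve P q -> f p = f q -> p = q) ->
  (forall p, U p -> single_over N p) -> sheets N P x.
Proof.
move=> Ux cf fi sU; left; split.
  by apply: (no_crossing_on_arc Ux (fun p _ => cf p) fi).
by apply: filterS Ux.
Qed.

Lemma sheets_off (P : diagram S) (N : set (S * R)) (x : S) : (forall p z, N (p, z) -> -1 < z < 1) ->
  (forall z, ~ N (x, z) -> \forall q \near (x, z), ~ N q) ->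
  (curve P x -> exists z, N (x, z)) -> ~ (exists z, N (x, z)) -> sheets N P x.
Proof.
move=> hN cN PN nx; left; split.
  by move=> [phi [[_ p0] pC]]; apply: nx; apply: PN; rewrite -p0 -[curve P _]/((phi @^-1` curve P) _) pC; left.
have : \forall p \near x, forall z, N (p, z) -> @set0 R z.
  apply: fibre_usc => //; first by apply: nearW => y z /hN.
  by move=> z Nz; apply: nx; exists z.
by apply: filterS => p h z w /h.
Qed.

Lemma near_imply4 (x : S) (A B C D Q : set S) : nbhs x A -> nbhs x B -> nbhs x C ->
  nbhs x D -> (forall y, A y -> B y -> C y -> D y -> Q y) -> nbhs x Q.
Proof.
move=> hA hB hC hD h.
have hh : nbhs x ((A `&` B) `&` (C `&` D)) by apply: filterI; exact: filterI.
by apply: filterS hh => y [[? ?] [? ?]]; exact: h.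
Qed.

End Sheets.

Section Pictures.
Context {R : realType}.
Implicit Types (p : plane R) (P : diagram (plane R)) (N : set (plane R * R)).

(** The linear map taking (a, b) to (a + b, a - b) carries the axes to the diagonals. *)
Lemma diagonal_crossing (C : set (plane R)) (x : plane R) :
  (\forall p \near x, C p <-> p.2 - x.2 = p.1 - x.1 \/ p.2 - x.2 = - (p.1 - x.1)) ->
  crossing R C x.
Proof.
move=> h; apply: (@crossing_local _ _ [set p | p.2 - x.2 = p.1 - x.1 \/ p.2 - x.2 = - (p.1 - x.1)]).
  by apply: filterS h => p [? ?]; split.
pose phi (q : plane R) : plane R := (x.1 + (q.1 + q.2), x.2 + (q.1 - q.2)).
pose psi (p : plane R) : plane R :=
  ((p.1 - x.1 + (p.2 - x.2)) / 2, (p.1 - x.1 - (p.2 - x.2)) / 2).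
have cphi : continuous phi by rewrite /phi; cts.
have cpsi : continuous psi by rewrite /psi; cts.
have mi : mutual_inverse phi psi.
  by split=> -[a b]; rewrite /phi /psi /=; congr (_, _); field.
exists phi; split.
  split; last by rewrite /phi /= !addr0 subr0 addr0; case: x {h phi psi cphi cpsi mi}.
  have [_ fo _] := bijection_local_homeo cphi cpsi mi.
  split; last by split.
  by move=> a b e; rewrite -(mi.1 a) e mi.1.
apply/seteqP; split=> -[a b]; rewrite /phi /cross /=.
  by case=> e; [right|left]; lra.
by case=> ->; [right|left]; ring.
Qed.

Section Multigraph.
Variables (I : finType) (g c : I -> R -> R) (P : diagram (plane R)).
Hypotheses (cg : forall i, continuous (g i)) (cc : forall i, continuous (c i)).
Hypothesis c1 : forall i t, -1 < c i t < 1.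
Hypothesis PE : forall p, curve P p <-> exists i, p.2 = g i p.1.
Hypothesis cij : forall i j t, i != j -> g i t = g j t -> c i t != c j t.
Hypothesis crossings : forall i j t, g i t = g j t -> c i t < c j t ->
  [/\ forall k, g k t = g i t -> k = i \/ k = j,
    exists2 e : R, e = 1 \/ e = -1 &
      \forall s \near t, g i s = g i t + e * (s - t) /\ g j s = g j t - e * (s - t) &
    \forall p \near (t, g i t), overstrand P p <-> p.2 = g j p.1].

Definition multigraph : set (plane R * R) :=
  [set q | exists i, q.1.2 = g i q.1.1 /\ q.2 = c i q.1.1].

Lemma near_fst (t u : R) (Q : set R) : (\forall s \near t, Q s) -> \forall p \near (t, u), Q p.1.
Proof.
have c0 : continuous (fun p : plane R => p.1) by cts.
by move=> h; exact: (c0 (t, u) _ h).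
Qed.

(** Near a point only the finitely many graphs through it matter. A single graph is an arc,
    parametrized by the abscissa; two graphs meet with slopes 1 and -1, which gives a diagonal
    crossing, and triple points are excluded by hypothesis. *)
Lemma multigraph_presents : presents multigraph P.
Proof.
have hN p z : multigraph (p, z) -> -1 < z < 1 by move=> [i [_ /= ->]].
have cN (p : plane R) z : ~ multigraph (p, z) -> \forall q \near (p, z), ~ multigraph q.
  move=> nN.
  have h i : \forall q \near (p, z), ~ (q.1.2 = g i q.1.1 /\ q.2 = c i q.1.1).
    have cgi : continuous (g i) by exact: cg.
    have cci : continuous (c i) by exact: cc.
    have ne (a b : plane R * R -> R) : continuous a -> continuous b -> a (p, z) != b (p, z) ->
        \forall q \near (p, z), a q != b q.
      move=> ca cb ab; have : `|a (p, z) - b (p, z)| > 0 by rewrite normr_gt0 subr_eq0.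
      move=> /(@cat_lt _ _ (p, z) (fun=> 0) (fun q => `|a q - b q|)) /= h.
      have {}h := h (@cat_cst _ _ _ _) ltac:(by cts).
      by apply: filterS h => q; rewrite normr_gt0 subr_eq0.
    have [e1|n1] := eqVneq p.2 (g i p.1); last first.
      have := ne (fun q => q.1.2) (fun q => g i q.1.1) ltac:(by cts) ltac:(by cts) n1.
      by apply: filterS => q /eqP n [].
    have n2 : z != c i p.1 by apply/eqP => e2; apply: nN; exists i.
    have := ne (fun q => q.2) (fun q => c i q.1.1) ltac:(by cts) ltac:(by cts) n2.
    by apply: filterS => q /eqP n [].
  have hh : \forall q \near (p, z), forall i, ~ (q.1.2 = g i q.1.1 /\ q.2 = c i q.1.1).
    exact: (@filter_forall _ _ _ (nbhs (p, z)) (nbhs_filter (p, z)) h).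
  by apply: filterS hh => q nq [i hi]; case: (nq i).
have PN p : curve P p <-> exists z, multigraph (p, z).
  rewrite PE; split=> [[i e]|[z [i [e _]]]]; last by exists i.
  by exists (c i p.1), i.
move=> x; split=> //; first by move=> z /hN.
  by move=> z; exact: cN.
have [[i xi]|nx] := pselect (exists i, x.2 = g i x.1); last first.
  by apply: sheets_off => //; [move=> z; exact: cN|exact: (PN x).1|move=> /PN/PE].
pose on k := x.2 == g k x.1.
have near_on : \forall p \near x, forall k, p.2 = g k p.1 -> on k.
  apply: (@filter_forall _ I (fun k p => p.2 = g k p.1 -> on k) (nbhs x) (nbhs_filter x)) => k.
  have cgk : continuous (g k) by exact: cg.
  have [e|n] := boolP (on k); first by apply: (@nearW _ (nbhs x)).
  have : 0 < `|x.2 - g k x.1| by rewrite normr_gt0 subr_eq0.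
  move=> /(@cat_lt _ _ x (fun=> 0) (fun p : plane R => `|p.2 - g k p.1|)) /= h.
  have {}h := h (@cat_cst _ _ _ _) ltac:(by cts).
  by apply: filterS h => p; rewrite normr_gt0 subr_eq0 => /eqP.
have [[j [ji xj]]|only] := pselect (exists j, j != i /\ x.2 = g j x.1); last first.
  have on_i k : on k -> k = i.
    by move=> /eqP e; apply/eqP/negP => /negP ki; apply: only; exists k.
  apply: (@sheets_arc _ _ _ _ _ _ (fun p : plane R => p.1) near_on); first by cts.
    move=> [a b] [a' b'] U1 U2 /PE[k e] /PE[k' e'] /= aa.
    have ki := on_i _ (U1 _ e); have ki' := on_i _ (U2 _ e').
    by move: e e'; rewrite ki ki' /= aa => -> ->.
  move=> p Up z w [k [e /= ->]] [k' [e' /= ->]].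
  by rewrite (on_i _ (Up _ e)) (on_i _ (Up _ e')).
right.
have [i' [j' [gi gj ij]]] : exists i' j', [/\ x.2 = g i' x.1, x.2 = g j' x.1 & c i' x.1 < c j' x.1].
  have := cij (t := x.1) ji; rewrite -xi -xj => /(_ erefl); rewrite neq_lt => /orP[h|h].
    by exists j, i.
  by exists i, j.
have gij : g i' x.1 = g j' x.1 by rewrite -gi.
have [only [e e1 slopes] over] := crossings gij ij.
have onE k : on k -> k = i' \/ k = j' by move=> /eqP ek; apply: only; rewrite -ek.
have sl : \forall p \near x, g i' p.1 = g i' x.1 + e * (p.1 - x.1) /\ g j' p.1 = g j' x.1 - e * (p.1 - x.1).
  by case: (x) slopes => t u; exact: near_fst.
rewrite -gi -gj in sl.
have over' : \forall p \near x, overstrand P p <-> p.2 = g j' p.1.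
  by move: over; rewrite -gi; case: (x).
have cross_near : \forall p \near x, curve P p <-> p.2 = x.2 + e * (p.1 - x.1) \/ p.2 = x.2 - e * (p.1 - x.1).
  near=> p; have [h1 h2] : g i' p.1 = x.2 + e * (p.1 - x.1) /\ g j' p.1 = x.2 - e * (p.1 - x.1) by near: p.
  have h3 : forall k, p.2 = g k p.1 -> on k by near: p.
  rewrite PE -h1 -h2; split=> [[k ek]|[] ek]; [|by exists i'|by exists j'].
  by case: (onE k (h3 _ ek)) => <-; [left|right].
split.
- apply: diagonal_crossing; move: cross_near; apply: filterS => p ->.
  by case: e1 => ->; rewrite ?mul1r ?mulN1r; split=> -[h|h]; [left|right|left|right|right|left|right|left]; lra.
- near=> p; move=> px z w [k [ek /= ->]] [k' [ek' /= ->]].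
  have [h1 h2] : g i' p.1 = x.2 + e * (p.1 - x.1) /\ g j' p.1 = x.2 - e * (p.1 - x.1) by near: p.
  have h3 : forall k, p.2 = g k p.1 -> on k by near: p.
  have nd : p.2 = g i' p.1 -> p.2 = g j' p.1 -> False.
    rewrite h1 h2 => q1 q2; apply: px.
    have p1 : p.1 = x.1 by case: e1 q1 q2 => ->; rewrite ?mul1r ?mulN1r; lra.
    by move: q1; rewrite p1 subrr mulr0 addr0 => p2; case: (p) (x) p1 p2 => ? ? [? ?] /= -> ->.
  have kk := onE k (h3 _ ek); have kk' := onE k' (h3 _ ek').
  move: ek ek'; case: kk => ->; case: kk' => -> ek ek' //.
    by case: (nd ek ek').
  by case: (nd ek' ek).
exists (c i' x.1), (c j' x.1); split => //.
  move=> z; split=> [[k [/= ek ->]]|[] ->]; last 2 first.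
  - by exists i'.
  - by exists j'.
  by case: (onE k) => [|->|->]; [exact/eqP|left|right].
move=> m /andP[im mj]; have ci : continuous (c i') by exact: cc.
have cj : continuous (c j') by exact: cc.
have n1 : \forall p \near x, c i' p.1 < m by apply: (@cat_lt _ _ x (fun p : plane R => c i' p.1) (fun=> m)) => //; cts.
have n2 : \forall p \near x, m < c j' p.1 by apply: (@cat_lt _ _ x (fun=> m) (fun p : plane R => c j' p.1)) => //; cts.
apply: (near_imply4 n1 n2 near_on over') => p h1 h2 h3 ov.
split=> [/ov e2|[z [mz [k [/= ek ez]]]]]; first by exists (c j' p.1); split => //; exists j'.
apply/ov.
have kk := onE k (h3 _ ek); move: ek ez; case: kk => -> ek ez; last exact: ek.
by move: mz; rewrite ez ltNge (ltW h1).
Unshelve. all: by end_near. Qed.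

End Multigraph.
End Pictures.

(** * Models of the second and third Reidemeister moves *)

Section Models.
Context {R : realType}.

(** A cut-off of slope 1/8: multiplied by an amplitude of at most 4 it has Lipschitz constant 1/2,
    as the slides require. This is why [big_box] is much larger than [box]. *)
Definition rho (a s : R) : R := Num.max 0 (Num.min 1 ((a - `|s|) / 8)).

Lemma rho_lip (a s s' : R) : `|rho a s' - rho a s| <= `|s' - s| / 8.
Proof.
have h := ler_dist_dist s' s.
rewrite /rho; move: h (normr_ge0 (s' - s)); move: (`|s'|) (`|s|) (`|s' - s|) => u v w.
rewrite ler_norml => /andP[h1 h2] w0; rewrite ler_norml.
have [a1|a1] := leP 1 ((a - u) / 8); have [a2|a2] := leP 1 ((a - v) / 8);
  rewrite ?(max_r ler01).
- by lra.
- by have [b2|b2] := leP 0 ((a - v) / 8); lra.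
- by have [b2|b2] := leP 0 ((a - u) / 8); lra.
by have [b1|b1] := leP 0 ((a - u) / 8); have [b2|b2] := leP 0 ((a - v) / 8); lra.
Qed.

Lemma rho01 (a s : R) : 0 <= rho a s <= 1.
Proof. by rewrite /rho le_max lexx /= ge_max ler01 ge_min lexx. Qed.

Lemma rho1 (a s : R) : `|s| <= a - 8 -> rho a s = 1.
Proof. by move=> h; rewrite /rho min_l ?max_r //; lra. Qed.

Lemma rho0 (a s : R) : a <= `|s| -> rho a s = 0.
Proof.
by move=> h; rewrite /rho max_l // ge_min; apply/orP; right; lra.
Qed.

Lemma rho_continuous (a : R) : continuous (rho a).
Proof. by rewrite /rho; cts. Qed.

Lemma slide_lip (A B C s s' r r' : R) : `|A| <= C -> `|B| <= 1 -> C <= 4 ->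
  `|r' - r| <= `|s' - s| / 8 -> `|A * (B * r') - A * (B * r)| <= `|s' - s| / 2.
Proof.
move=> hA hB C4 h; rewrite -!mulrBr !normrM.
have A0 := normr_ge0 A; have B0 := normr_ge0 B; have r0 := normr_ge0 (r' - r).
have s0 := normr_ge0 (s' - s).
apply: (@le_trans _ _ (4 * (1 * (`|s' - s| / 8)))); last by lra.
apply: ler_pM; [exact: A0|exact: mulr_ge0|exact: le_trans C4|exact: ler_pM].
Qed.

Lemma slide_bound (A B C r : R) : `|A| <= C -> `|B| <= 1 -> 0 <= r <= 1 -> `|A * (B * r)| <= C.
Proof.
move=> hA hB /andP[r0 r1]; rewrite !normrM (ger0_norm r0) -[leRHS]mulr1.
apply: ler_pM => //; first exact: mulr_ge0.
by rewrite -[leRHS]mulr1; apply: ler_pM.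
Qed.

Lemma near_itv (t a b : R) : a < t < b -> \forall s \near t, a < s < b.
Proof.
move=> /andP[h1 h2].
have n1 : \forall s \near t, a < s by apply: (@cat_lt _ _ _ (fun=> a) id); cts.
have n2 : \forall s \near t, s < b by apply: (@cat_lt _ _ _ id (fun=> b)); cts.
by move: n1 n2; apply: filterS2 => s -> ->.
Qed.

Lemma near_rect (x : plane R) (a b c d : R) : a < x.1 < b -> c < x.2 < d ->
  \forall p \near x, a < p.1 < b /\ c < p.2 < d.
Proof.
move=> /near_itv h1 /near_itv h2.
have c1 : continuous (fun p : plane R => p.1) by cts.
have c2 : continuous (fun p : plane R => p.2) by cts.
have n1 : \forall p \near x, a < p.1 < b := c1 x _ h1.
have n2 : \forall p \near x, c < p.2 < d := c2 x _ h2.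
by move: n1 n2; apply: filterS2.
Qed.

Lemma model_moveI (P P' : diagram (plane R)) (N N' : set (plane R * R)) F G :
  planar_isotopy F G -> (forall p z, N (p, z) -> N' (F (1, (p, z)), z)) ->
  (forall q z, N' (q, z) -> exists p, N (p, z) /\ F (1, (p, z)) = q) ->
  presents N P -> presents N' P' -> (forall p z, ~ box p -> (N (p, z) <-> N' (p, z))) ->
  model_move P P' N N'.
Proof.
move=> [[cF cG GF FG] [F0 FB]] NF FN pN pN' off; exists F, G; do 2 ?[split => //]; split => //.
move=> p z; split; first exact: NF.
move=> /FN[q [Nq e]]; suff -> : p = q by [].
by rewrite -(GF 1 p z) -(GF 1 q z) e.
Qed.

Definition r2_height (b : bool) (t : R) : R := if b then 1 / 2 else - (1 / 2).
Definition r2_line (b : bool) (t : R) : R := if b then 1 else -1.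
Definition r2_bent (b : bool) (t : R) : R :=
  if b then Num.min 1 (`|t| - 1) else - Num.min 1 (`|t| - 1).

Lemma r2_height_itv b t : -1 < r2_height b t < 1.
Proof. by case: b; rewrite /r2_height; lra. Qed.

Lemma r2_height_neq i j t : i != j -> r2_height i t != r2_height j t.
Proof. by case: i j => [] [] //= _; apply/eqP; rewrite /r2_height; lra. Qed.

Lemma r2_before_presents : presents (multigraph r2_line r2_height) r2_before.
Proof.
apply: multigraph_presents.
- by case; rewrite /r2_line; cts.
- by case; rewrite /r2_height; cts.
- exact: r2_height_itv.
- by move=> p; split=> [[e|e]|[[] e]]; [exists true|exists false|left|right].
- by move=> i j t ij _; exact: r2_height_neq.
- by case=> [] [] t; rewrite /r2_line /r2_height; lra.
Qed.

Lemma r2_after_presents : presents (multigraph r2_bent r2_height) r2_after.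
Proof.
apply: multigraph_presents.
- by case; rewrite /r2_bent; cts.
- by case; rewrite /r2_height; cts.
- exact: r2_height_itv.
- by move=> p; split=> [[e|e]|[[] e]]; [exists true|exists false|left|right].
- by move=> i j t ij _; exact: r2_height_neq.
case=> [] [] t; rewrite /r2_bent /r2_height; try by lra.
set m := Num.min _ _ => mm _; have m0 : m = 0 by lra.
have t1 : t = 1 \/ t = -1.
  move: m0; rewrite /m; have [h|h] := leP 1 (`|t| - 1); first by lra.
  have [?|?] := leP 0 t; [rewrite ger0_norm //|rewrite ltr0_norm //]; lra.
split.
- by case; rewrite m0; [right|left].
- exists (- t); first by case: t1 => ->; [right|left; rewrite opprK].
  rewrite m0; case: t1 => ->.
    have h : 0 < (1 : R) < 2 by lra.
    apply: filterS (near_itv h) => s /andP[s0 s2].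
    by rewrite ger0_norm ?min_r ?(ltW s0) //; lra.
  have h : -2 < (-1 : R) < 0 by lra.
  apply: filterS (near_itv h) => s /andP[s0 s2].
  by rewrite ltr0_norm ?min_r //; lra.
- by apply: (@nearW _ (nbhs (t, - m))).
Qed.

Lemma r2_model : model_move r2_before r2_after (multigraph r2_line r2_height)
  (multigraph r2_bent r2_height).
Proof.
(* [A] is the descent of the upper strand, and [s] is 1 at height 1/2 and -1 at height -1/2, so the
   lower strand makes the mirror motion. *)
pose A (p : plane R) : R := Num.min 0 (Num.max (-2) (`|p.1| - 2)).
pose s (z : R) : R := clamp (-1) 1 (2 * z).
have s1 z : `|s z| <= 1 by rewrite ler_norml; apply: clamp_itv; lra.
have A2 p : `|A p| <= 2.
  by rewrite /A ler_norml le_min ge_min le_max lexx /=; apply/andP; split; [|apply/orP; left]; lra.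
have cr := @rho_continuous 9.
have [||||F [G [FG F1]]] := @slide2 R (fun q => A q.1 * (s q.2 * rho 9 q.1.2)) 2.
- by rewrite /A /s; cts.
- move=> [p z]; apply: slide_bound; [exact: A2|exact: s1|exact: rho01].
- move=> a t t' z /=; rewrite {1 2}/A /=.
  apply: (@slide_lip _ _ 2); [exact: (A2 (a, 0))|exact: s1|lra|exact: rho_lip].
- move=> p z nB /=; have [h|h] := leP 2 (`|p.1|).
    by rewrite /A min_l ?mul0r // le_max; apply/orP; right; lra.
  rewrite rho0 ?mulr0 // leNgt; apply/negP => h2; apply: nB; split; lra.
have AE (t u : R) : A (t, u) = Num.min 1 (`|t| - 1) - 1.
  rewrite /A /=; have t0 := normr_ge0 t; rewrite max_r; last by lra.
  by have [h|h] := leP 0 (`|t| - 2); have [h'|h'] := leP 1 (`|t| - 1); lra.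
have move1 b t : F (1, ((t, r2_line b t), r2_height b t)) = (t, r2_bent b t).
  rewrite F1 /= AE; congr (_, _); case: b; rewrite /r2_line /r2_height /r2_bent /s.
    rewrite rho1 ?normr1; last by lra.
    by rewrite (_ : 2 * (1 / 2) = 1) ?clamp_id; lra.
  rewrite rho1 ?normrN ?normr1; last by lra.
  by rewrite (_ : 2 * - (1 / 2) = -1) ?clamp_id; lra.
apply: (model_moveI FG _ _ r2_before_presents r2_after_presents).
- by move=> [t u] z [b [/= -> ->]]; rewrite move1; exists b.
- by move=> [t u] z [b [/= -> ->]]; exists (t, r2_line b t); split; [exists b|].
move=> [t u] z nb; have [h|h] := leP 2 (`|t|).
  have e b : r2_bent b t = r2_line b t.
    by case: b; rewrite /r2_bent /r2_line min_l //; lra.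
  by split=> -[b [/= -> ->]]; exists b; rewrite /= e.
have u3 : 3 < `|u| by rewrite ltNge; apply/negP => u3; apply: nb; split => //=; lra.
split=> -[b [/= eu _]]; move: u3; rewrite eu; case: b {eu}; rewrite /r2_line /r2_bent ?normrN ?normr1.
- by lra.
- by lra.
- have t0 := normr_ge0 t; rewrite ltr_normr; have [?|?] := leP 1 (`|t| - 1) => /orP[]; lra.
- have t0 := normr_ge0 t; rewrite ltr_normr; have [?|?] := leP 1 (`|t| - 1) => /orP[]; lra.
Qed.

Definition r3_height (i : option bool) (t : R) : R :=
  match i with None => 1 / 2 | Some true => 0 | Some false => - (1 / 2) end.
Definition r3_strand (e : R) (i : option bool) (t : R) : R :=
  match i with None => e * Num.max 0 (1 - `|t|) | Some true => t | Some false => - t end.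

Lemma r3_presents (e : R) : e = 1 \/ e = -1 ->
  presents (multigraph (r3_strand e) r3_height) (r3_picture e).
Proof.
move=> e1; apply: multigraph_presents.
- by case=> [[]|]; rewrite /r3_strand; cts.
- by case=> [[]|]; rewrite /r3_height; cts.
- by case=> [[]|] t; rewrite /r3_height; lra.
- move=> p; split=> [[h|[h|h]]|[[[]|] h]]; [by exists None|by exists (Some true)|
    by exists (Some false)|by right; left|by right; right|by left].
- by case=> [[]|] [[]|] t //= _ _; apply/eqP; rewrite /r3_height; lra.
(* The tent meets the diagonals only in the middle of its slanted sides, where its slope is opposite
   to that of the diagonal it meets. *)
have tent (t k : R) : k = t \/ k = - t -> k = e * Num.max 0 (1 - `|t|) -> k = e / 2 /\ `|t| = 1 / 2.
  have [t0|t0] := leP 0 t; [rewrite ger0_norm //|rewrite ltr0_norm //].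
    by have [h|h] := leP 0 (1 - t); case: e1 => -> [] -> ?; split; lra.
  by have [h|h] := leP 0 (1 - - t); case: e1 => -> [] -> ?; split; lra.
have near_tent (t k : R) : k = e / 2 -> `|t| = 1 / 2 -> (k = t \/ k = - t) ->
    \forall s \near t, 1 / 4 < `|s| /\ e * Num.max 0 (1 - `|s|) = k - (if k == t then 1 else -1) * (s - t).
  move=> ke t2 kt; have [t0|t0] := leP 0 t.
    move: t2; rewrite ger0_norm // => t2.
    have h : 1 / 4 < t < 3 / 4 by lra.
    apply: filterS (near_itv h) => s /andP[s1 s2].
    have s0 : 0 < s by lra.
    rewrite gtr0_norm // max_r; last by lra.
    split => //; have [kt'|kt'] := eqVneq k t.
      by case: e1 ke => -> ke; lra.
    by case: kt => [/eqP|] kt; [rewrite (negbTE kt') in kt|case: e1 ke => -> ke; lra].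
  move: t2; rewrite ltr0_norm // => t2.
  have h : - (3 / 4) < t < - (1 / 4) by lra.
  apply: filterS (near_itv h) => s /andP[s1 s2].
  have s0 : s < 0 by lra.
  rewrite ltr0_norm // max_r; last by lra.
  split; first by lra.
  have [kt'|kt'] := eqVneq k t.
    by case: e1 ke => -> ke; lra.
  by case: kt => [/eqP|] kt; [rewrite (negbTE kt') in kt|case: e1 ke => -> ke; lra].
have over_tent (t k : R) : `|t| = 1 / 2 -> \forall p \near (t, k),
    overstrand (r3_picture e) p <-> p.2 = e * Num.max 0 (1 - `|p.1|).
  move=> t2.
  have n : \forall p \near (t, k), 1 / 4 < `|p.1|.
    have c1 : continuous (fun p : plane R => `|p.1|) by cts.
    apply: (@cat_lt _ _ (t, k) (fun=> 1 / 4) _ (@cat_cst _ _ _ _) (c1 (t, k))).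
    by rewrite /= t2; lra.
  apply: filterS n => p p4 /=; split=> [[//|[_ h]]|]; last by left.
  by move: h; rewrite ltNge (ltW p4).
(* Three pairs survive the comparison of heights: [y = x] under the tent, [y = -x] under [y = x],
   and [y = -x] under the tent. *)
case=> [[]|] [[]|] t; rewrite /r3_strand /r3_height; try by lra.
- move=> gt _; have [te t2] := tent t t (or_introl erefl) gt; split.
  + move=> [[]|] h; [by left|exfalso|by right].
    by have t0 : t = 0 by [lra]; move: t2; rewrite t0 normr0; lra.
  + exists 1; first by left.
    apply: filterS (near_tent t t te t2 (or_introl erefl)) => s [_ h].
    by split; [ring|rewrite h eqxx -gt].
  + exact: over_tent.
- move=> tt _; have t0 : t = 0 by lra.
  rewrite t0; split.
  + move=> [[]|]; [by right|by left|].
    by rewrite normr0 subr0 max_r // mulr1 oppr0 => h; exfalso; case: e1 h => ->; lra.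
  + by exists (-1); [right|apply: (@nearW _ (nbhs (0 : R))) => s; split; ring].
  pose x0 : plane R := (0, - 0).
  have h : - (1 / 4) < x0.1 < 1 / 4 by rewrite /x0 /=; lra.
  have h' : - (1 / 4) < x0.2 < 1 / 4 by rewrite /x0 /=; lra.
  apply: filterS (near_rect h h') => p [p1 p2] /=.
  have q1 : `|p.1| < 1 / 4 by rewrite ltr_norml.
  split=> [[h3|[]//]|h3]; last by right.
  by move: h3 p2; rewrite max_r; [case: e1 => ->|]; lra.
- move=> gt _; have [te t2] := tent t (- t) (or_intror erefl) gt.
  have tn : - t != t.
    by apply/eqP => h; have t0 : t = 0 by [lra]; move: t2; rewrite t0 normr0; lra.
  split.
  + move=> [[]|] h; [exfalso|by left|by right].
    by move: tn; rewrite -h eqxx.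
  + exists (-1); first by right.
    apply: filterS (near_tent t (- t) te t2 (or_intror erefl)) => s [_ h].
    by split; [ring|rewrite h (negbTE tn) -gt].
  + exact: over_tent.
Qed.

Lemma r3_model : model_move (r3_picture 1) (r3_picture (-1))
  (multigraph (r3_strand 1) r3_height) (multigraph (r3_strand (-1)) r3_height).
Proof.
(* [A] reverses the tent, and [s] is 1 at height 1/2 and 0 at the heights of the diagonals, so only
   the top strand moves. *)
pose A (p : plane R) : R := -2 * Num.max 0 (1 - `|p.1|).
pose s (z : R) : R := clamp 0 1 (2 * z).
have s1 z : `|s z| <= 1.
  by have /andP[h1 h2] := clamp01P (2 * z); rewrite ger0_norm.
have tent01 (t : R) : 0 <= Num.max 0 (1 - `|t|) <= 1.
  by have t0 := normr_ge0 t; rewrite le_max lexx /= ge_max ler01 /=; lra.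
have A2 p : `|A p| <= 2.
  rewrite /A normrM normrN (ger0_norm (_ : 0 <= 2 :> R)) // -[leRHS]mulr1 ler_wpM2l //.
  by have /andP[? ?] := tent01 p.1; rewrite ger0_norm.
have cr := @rho_continuous 9.
have [||||F [G [FG F1]]] := @slide2 R (fun q => A q.1 * (s q.2 * rho 9 q.1.2)) 2.
- by rewrite /A /s; cts.
- move=> [p z]; apply: slide_bound; [exact: A2|exact: s1|exact: rho01].
- move=> a t t' z /=; rewrite {1 2}/A /=.
  apply: (@slide_lip _ _ 2); [exact: (A2 (a, 0))|exact: s1|lra|exact: rho_lip].
- move=> p z nB /=; have [h|h] := leP 1 (`|p.1|).
    by rewrite /A max_l ?mulr0 ?mul0r //; lra.
  rewrite rho0 ?mulr0 // leNgt; apply/negP => h2; apply: nB; split; lra.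
have move1 i t : F (1, ((t, r3_strand 1 i t), r3_height i t)) = (t, r3_strand (-1) i t).
  rewrite F1 /= /A /=; congr (_, _); case: i => [[]|]; rewrite /r3_strand /r3_height /s.
  - by rewrite mulr0 clamp01_0 mul0r mulr0 addr0.
  - by rewrite clamp_lo ?mul0r ?mulr0 ?addr0 //; lra.
  have /andP[h0 h1] := tent01 t.
  rewrite rho1; last by rewrite mul1r ger0_norm //; lra.
  by rewrite (_ : 2 * (1 / 2) = 1) ?clamp01_1; lra.
apply: (model_moveI FG _ _ (r3_presents (or_introl erefl)) (r3_presents (or_intror erefl))).
- by move=> [t u] z [i [/= -> ->]]; rewrite move1; exists i.
- by move=> [t u] z [i [/= -> ->]]; exists (t, r3_strand 1 i t); split; [exists i|].
move=> [t u] z nb; have [h|h] := leP 1 (`|t|).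
  have e i : r3_strand (-1) i t = r3_strand 1 i t.
    by case: i => [[]|] //; rewrite /r3_strand max_l ?mulr0 //; lra.
  by split=> -[i [/= -> ->]]; exists i; rewrite /= e.
have u3 : 3 < `|u| by rewrite ltNge; apply/negP => u3; apply: nb; split => //=; lra.
have /andP[h0 h1] := tent01 t.
by split=> -[i [/= eu ez]]; exists i; split => //=; move: u3; rewrite eu;
  case: i {eu ez} => [[]|] //; rewrite /r3_strand normrM ?normrN normr1 mul1r ger0_norm //; lra.
Qed.

End Models.

(** * Model of the first Reidemeister move *)

Section ModelR1.
Context {R : realType}.

(** The height decreases along the part of the strand to be moved and so labels its points: a motion
    depending on the height can send each of them to its own place on the kink. *)
Definition r1_height (_ : unit) (t : R) : R := - (clamp (-1) 1 t / 2).
Definition r1_line (_ : unit) (_ : R) : R := 0.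

(* The kink is the path [s |-> (s + kink_x s, kink_y s)] at height [r1_height s]. *)
Definition kink_y (s : R) : R := Num.max 0 (Num.min 2 (3 - 3 * `|s|)).
Definition kink_x (s : R) : R := Num.min (-4 * s) (Num.max 0 (2 * s + 2)) +
  Num.max (-4 * s) (Num.min 0 (2 * s - 2)) + 4 * s.

(** Each third of [[-1, 1]] covers one edge of the kink at horizontal speed 3; the formulas for
    heights are [- s / 2] with s equal to (x - 2) / 3, - x / 3 and (x + 2) / 3. *)
Definition kink_link : set (plane R * R) := [set q |
  [\/ [/\ 1 <= `|q.1.1|, q.1.2 = 0 & q.2 = r1_height tt q.1.1],
      [/\ `|q.1.1| <= 1, q.1.2 = q.1.1 + 1 & q.2 = (2 - q.1.1) / 6],
      [/\ `|q.1.1| <= 1, q.1.2 = 2 & q.2 = q.1.1 / 6] |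
      [/\ `|q.1.1| <= 1, q.1.2 = 1 - q.1.1 & q.2 = - (2 + q.1.1) / 6]]].

Lemma r1_height_itv (t : R) : -1 < r1_height tt t < 1.
Proof.
have /andP[? ?] : -1 <= clamp (-1) 1 t <= 1 by apply: clamp_itv; lra.
by rewrite /r1_height; lra.
Qed.

Lemma r1_before_presents : presents (multigraph r1_line r1_height) r1_before.
Proof.
apply: multigraph_presents.
- by move=> i; rewrite /r1_line; cts.
- by move=> i; rewrite /r1_height; cts.
- by case=> t; exact: r1_height_itv.
- by move=> p; split=> [e|[_ e]] //; exists tt.
- by case; case.
- by case; case=> t _; rewrite ltxx.
Qed.

Lemma kink_out (s : R) : 1 <= `|s| -> kink_x s = 0 /\ kink_y s = 0.
Proof.
move=> s1; have -> : kink_y s = 0.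
  by rewrite /kink_y max_l // ge_min; apply/orP; right; lra.
split => //; rewrite /kink_x; move: s1; rewrite ler_normr => /orP[s1|s1].
  have -> : Num.max 0 (2 * s + 2) = 2 * s + 2 by rewrite max_r; lra.
  have -> : Num.min 0 (2 * s - 2) = 0 by rewrite min_l; lra.
  by rewrite min_l ?max_r; lra.
have -> : Num.max 0 (2 * s + 2) = 0 by rewrite max_l; lra.
have -> : Num.min 0 (2 * s - 2) = 2 * s - 2 by rewrite min_r; lra.
by rewrite min_r ?max_l; lra.
Qed.

Lemma kink_xE (s : R) : -1 <= s <= 1 ->
  kink_x s = Num.min (-4 * s) (2 * s + 2) + Num.max (-4 * s) (2 * s - 2) + 4 * s.
Proof.
move=> /andP[h1 h2]; rewrite /kink_x.
have -> : Num.max 0 (2 * s + 2) = 2 * s + 2 by rewrite max_r; lra.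
by have -> : Num.min 0 (2 * s - 2) = 2 * s - 2 by rewrite min_r; lra.
Qed.

Lemma kink_left (s : R) : -1 <= s <= - (1 / 3) -> kink_x s = 2 * s + 2 /\ kink_y s = 3 * s + 3.
Proof.
move=> /andP[h1 h2]; split; first by rewrite kink_xE ?min_r ?max_l; lra.
by rewrite /kink_y ltr0_norm ?min_r ?max_r; lra.
Qed.

Lemma kink_mid (s : R) : - (1 / 3) <= s <= 1 / 3 -> kink_x s = -4 * s /\ kink_y s = 2.
Proof.
move=> /andP[h1 h2]; split; first by rewrite kink_xE ?min_l ?max_l; lra.
have s3 : `|s| <= 1 / 3 by rewrite ler_norml; lra.
by rewrite /kink_y min_l ?max_r; lra.
Qed.

Lemma kink_right (s : R) : 1 / 3 <= s <= 1 -> kink_x s = 2 * s - 2 /\ kink_y s = 3 - 3 * s.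
Proof.
move=> /andP[h1 h2]; split; first by rewrite kink_xE ?min_l ?max_r; lra.
by rewrite /kink_y gtr0_norm ?min_r ?max_r; lra.
Qed.

Lemma kink_cases (s : R) : [\/ 1 <= `|s|, -1 <= s <= - (1 / 3), - (1 / 3) <= s <= 1 / 3 | 1 / 3 <= s <= 1].
Proof.
have [h|h] := leP 1 `|s|; first by constructor 1.
move: h; rewrite ltr_norml => /andP[h1 h2].
have [h|h] := leP s (- (1 / 3)); first by constructor 2; lra.
have [h'|h'] := leP s (1 / 3); first by constructor 3; lra.
by constructor 4; lra.
Qed.

Lemma kink_linkP (p : plane R) (z : R) : kink_link (p, z) <->
  exists s, p = (s + kink_x s, kink_y s) /\ z = r1_height tt s.
Proof.
have ht s : -1 <= s <= 1 -> r1_height tt s = - (s / 2).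
  by move=> h; rewrite /r1_height clamp_id.
case: p => a b; split.
  case=> /= -[a1 -> ->].
  - by exists a; have [-> ->] := kink_out a1; rewrite addr0.
  - move: a1; rewrite ler_norml => /andP[? ?]; exists ((a - 2) / 3).
    have [|-> ->] := @kink_left ((a - 2) / 3); first by lra.
    rewrite ht; last by lra.
    by split; [congr (_, _)|]; field.
  - move: a1; rewrite ler_norml => /andP[? ?]; exists (- (a / 3)).
    have [|-> ->] := @kink_mid (- (a / 3)); first by lra.
    rewrite ht; last by lra.
    by split; [congr (_, _)|]; field.
  - move: a1; rewrite ler_norml => /andP[? ?]; exists ((a + 2) / 3).
    have [|-> ->] := @kink_right ((a + 2) / 3); first by lra.
    rewrite ht; last by lra.
    by split; [congr (_, _)|]; field.
move=> [s [[-> ->] ->]]; case: (kink_cases s) => h.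
- by have [-> ->] := kink_out h; constructor 1; rewrite /= addr0.
- have [-> ->] := kink_left h; have /andP[? ?] := h; rewrite ht; last by lra.
  by constructor 2; rewrite /=; split; [rewrite ler_norml; lra|lra|lra].
- have [-> ->] := kink_mid h; have /andP[? ?] := h; rewrite ht; last by lra.
  by constructor 3; rewrite /=; split; [rewrite ler_norml; lra|lra|lra].
- have [-> ->] := kink_right h; have /andP[? ?] := h; rewrite ht; last by lra.
  by constructor 4; rewrite /=; split; [rewrite ler_norml; lra|lra|lra].
Qed.

(** At height z the parameter on the strand is -2 z, so two slides are enough: upwards by
    [kink_y (-2 * z)], then sideways by [kink_x (-2 * z)]. *)
Lemma kink_isotopy : exists F G : R * (plane R * R) -> plane R, planar_isotopy F G /\
  forall s, F (1, ((s, 0), r1_height tt s)) = (s + kink_x s, kink_y s).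
Proof.
have cr9 := @rho_continuous R 9; have cr10 := @rho_continuous R 10.
have cx : continuous kink_x by rewrite /kink_x; cts.
have cy : continuous kink_y by rewrite /kink_y; cts.
have by2 s : `|kink_y s| <= 2.
  by case: (kink_cases s) => [/kink_out[_ ->]|h|h|h]; rewrite ?normr0 //;
    [have [_ ->] := kink_left h|have [_ ->] := kink_mid h|have [_ ->] := kink_right h];
    move: h => /andP[? ?]; rewrite ler_norml; lra.
have bx2 s : `|kink_x s| <= 2.
  by case: (kink_cases s) => [/kink_out[-> _]|h|h|h]; rewrite ?normr0 //;
    [have [-> _] := kink_left h|have [-> _] := kink_mid h|have [-> _] := kink_right h];
    move: h => /andP[? ?]; rewrite ler_norml; lra.
have br (a s : R) : `|rho a s| <= 1 by have /andP[? ?] := @rho01 R a s; rewrite ger0_norm.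
have out (p : plane R) : ~ big_box p -> 10 < `|p.1| \/ 10 < `|p.2|.
  move=> nB; have [h|h] := leP `|p.1| 10; [right|by left].
  by rewrite ltNge; apply/negP => h2; apply: nB.
have [||||F1 [G1 [FG1 F1E]]] := @slide2 R (fun q => kink_y (-2 * q.2) * (rho 9 q.1.1 * rho 9 q.1.2)) 2.
- by cts.
- by move=> q; apply: slide_bound; [exact: by2|exact: br|exact: rho01].
- by move=> a s s' z; apply: (@slide_lip _ _ _ 2); [exact: by2|exact: br|lra|exact: rho_lip].
- by move=> p z /out[h|h] /=; [rewrite (@rho0 _ _ p.1)|rewrite (@rho0 _ _ p.2)];
    rewrite ?mul0r ?mulr0 //; lra.
(* The ordinate is cut off by [rho 10] because the first slide may have raised it to 2, where
   [rho 9] is no longer 1. *)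
have [||||F2 [G2 [FG2 F2E]]] := @slide1 R (fun q => kink_x (-2 * q.2) * (rho 10 q.1.2 * rho 9 q.1.1)) 2.
- by cts.
- by move=> q; apply: slide_bound; [exact: bx2|exact: br|exact: rho01].
- by move=> a s s' z; apply: (@slide_lip _ _ _ 2); [exact: bx2|exact: br|lra|exact: rho_lip].
- by move=> p z /out[h|h] /=; [rewrite (@rho0 _ 9)|rewrite (@rho0 _ 10)];
    rewrite ?mul0r ?mulr0 //; lra.
exists (fun q => F2 (q.1, (F1 q, q.2.2))), (fun q => G1 (q.1, (G2 q, q.2.2))).
split; first exact: planar_isotopy_comp FG1 FG2.
move=> s; rewrite /= F1E F2E /= add0r.
have e : -2 * r1_height tt s = clamp (-1) 1 s by rewrite /r1_height; field.
rewrite e; have [s1|s1] := leP `|s| 1.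
  rewrite clamp_id; last by rewrite -ler_norml.
  rewrite (@rho1 _ 9 s) ?(@rho1 _ 9 0) ?(@rho1 _ 10) ?mul1r ?mulr1 ?normr0 //; try by lra.
  by apply: le_trans (by2 _) _; lra.
have [x0 y0] : kink_x (clamp (-1) 1 s) = 0 /\ kink_y (clamp (-1) 1 s) = 0.
  apply: kink_out; move: s1; rewrite ltr_normr => /orP[s1|s1].
    by rewrite clamp_hi ?normr1 //; lra.
  by rewrite clamp_lo ?normrN ?normr1 //; lra.
have [-> ->] := kink_out (ltW s1).
by rewrite x0 y0 !mul0r !addr0.
Qed.

Lemma kink_curve (p : plane R) : curve r1_after p <-> exists z, kink_link (p, z).
Proof.
split=> [[[h e]|[h [e|[e|e]]]]|[z [[h e _]|[h e _]|[h e _]|[h e _]]]].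
- by exists (r1_height tt p.1); constructor 1.
- by exists ((2 - p.1) / 6); constructor 2.
- by exists (p.1 / 6); constructor 3.
- by exists (- (2 + p.1) / 6); constructor 4.
- by left.
- by right; split => //; left.
- by right; split => //; right; left.
- by right; split => //; right; right.
Qed.

Lemma kink_pieces (p : plane R) (z : R) : kink_link (p, z) ->
  [\/ [/\ p.1 <= -1, p.2 = 0 & z = 1 / 2], [/\ 1 <= p.1, p.2 = 0 & z = - (1 / 2)] |
  [\/ [/\ -1 <= p.1 <= 1, p.2 = p.1 + 1 & z = (2 - p.1) / 6],
      [/\ -1 <= p.1 <= 1, p.2 = 2 & z = p.1 / 6] |
      [/\ -1 <= p.1 <= 1, p.2 = 1 - p.1 & z = - (2 + p.1) / 6]]].
Proof.
case=> /= -[h e1 e2].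
- move: h; rewrite ler_normr => /orP[h|h]; [constructor 2|constructor 1]; split=> //.
  + by rewrite e2 /r1_height clamp_hi //; lra.
  + by lra.
  + by rewrite e2 /r1_height clamp_lo //; lra.
- by move: h; rewrite ler_norml; constructor 3; constructor 1.
- by move: h; rewrite ler_norml; constructor 3; constructor 2.
- by move: h; rewrite ler_norml; constructor 3; constructor 3.
Qed.

(* Off the crossing (0, 1), the kink is locally the graph of a function of one of the linear
   forms [p.1], [2 p.2 + p.1] and [2 p.2 - p.1], and so is its height. *)
Lemma kink_below (p : plane R) (z : R) : p.2 < 1 -> kink_link (p, z) ->
  p = (p.1, Num.max 0 (1 - `|p.1|)) /\
  z = if p.1 < 0 then Num.min (1 / 2) ((2 - p.1) / 6) else Num.max (- (1 / 2)) (- (2 + p.1) / 6).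
Proof.
case: p => a b /= b1 /kink_pieces /= [[h -> ->]|[h -> ->]|[[/andP[h h'] e ->]|[_ e _]|[/andP[h h'] e ->]]].
- have a0 : a < 0 by lra.
  have -> : Num.max 0 (1 - `|a|) = 0 by rewrite ltr0_norm // max_l //; lra.
  by have -> : Num.min (1 / 2) ((2 - a) / 6) = 1 / 2 by [rewrite min_l //; lra]; rewrite a0.
- have a0 : 0 <= a by lra.
  have -> : Num.max 0 (1 - `|a|) = 0 by rewrite ger0_norm // max_l //; lra.
  by rewrite ltNge a0 /= max_l //; lra.
- have a0 : a < 0 by lra.
  have -> : Num.max 0 (1 - `|a|) = b by rewrite ltr0_norm // max_r //; lra.
  by rewrite a0 min_r //; lra.
- by lra.
have a0 : 0 < a by lra.
have -> : Num.max 0 (1 - `|a|) = b by rewrite gtr0_norm // max_r //; lra.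
by rewrite ltNge (ltW a0) /= max_r //; lra.
Qed.

Lemma kink_top_right (p : plane R) (z : R) : 0 < p.1 /\ 1 < p.2 -> kink_link (p, z) ->
  p = (fun v => (Num.min (v - 2) (4 - v), (v + Num.min (v - 2) (4 - v)) / 2)) (2 * p.2 - p.1) /\
  z = (4 - (2 * p.2 - p.1)) / 6.
Proof.
case: p => a b /= [a0 b1] /kink_pieces /= [[h e _]|[h e _]|[[/andP[h h'] -> ->]|[/andP[h h'] -> ->]|[_ e _]]].
- by lra.
- by lra.
- by rewrite min_l; [split; [congr (_, _)|]; lra|lra].
- by rewrite min_r; [split; [congr (_, _)|]; lra|lra].
by lra.
Qed.

Lemma kink_top_left (p : plane R) (z : R) : p.1 < 0 /\ 1 < p.2 -> kink_link (p, z) ->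
  p = (fun v => (Num.max (2 - v) (v - 4), (v - Num.max (2 - v) (v - 4)) / 2)) (2 * p.2 + p.1) /\
  z = ((2 * p.2 + p.1) - 4) / 6.
Proof.
case: p => a b /= [a0 b1] /kink_pieces /= [[h e _]|[h e _]|[[_ e _]|[/andP[h h'] -> ->]|[/andP[h h'] -> ->]]].
- by lra.
- by lra.
- by lra.
- by rewrite max_r; [split; [congr (_, _)|]; lra|lra].
by rewrite max_l; [split; [congr (_, _)|]; lra|lra].
Qed.

Lemma kink_top_mid (p : plane R) (z : R) : - (1 / 2) < p.1 < 1 / 2 /\ 3 / 2 < p.2 < 3 ->
  kink_link (p, z) -> p = (p.1, 2) /\ z = p.1 / 6.
Proof.
case: p => a b /= [/andP[a1 a2] /andP[b1 b2]] /kink_pieces /= [[h e _]|[h e _]|[[_ e _]|[_ -> ->]|[_ e _]]] //; lra.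
Qed.

Lemma kink_top (p : plane R) (z : R) : p.1 = 0 -> 1 < p.2 -> kink_link (p, z) -> p.2 = 2.
Proof. by move=> p1 p2 /kink_pieces [[h e _]|[h e _]|[[_ e _]|[_ -> _]|[_ e _]]] //; lra. Qed.

Lemma kink_level1 (p : plane R) (z : R) : p.2 = 1 -> kink_link (p, z) -> p.1 = 0.
Proof. by move=> p2 /kink_pieces [[h e _]|[h e _]|[[_ e _]|[_ e _]|[_ e _]]]; lra. Qed.

Lemma r1_after_presents : presents kink_link r1_after.
Proof.
have [F [G [[[cF cG GF FG] _] FE]]] := kink_isotopy.
pose N := multigraph r1_line r1_height.
(* Closedness of the kink is inherited from the straight strand through the homeomorphism at time 1;
   the shape of the projection is then treated by cases. *)
have NK p z : kink_link (p, z) <-> N (G (1, (p, z)), z).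
  rewrite kink_linkP; split=> [[s [-> ->]]|[[] [/= e ez]]].
    by exists tt; rewrite /= -FE GF.
  exists (G (1, (p, z))).1; split => //.
  have eG : G (1, (p, z)) = ((G (1, (p, z))).1, 0) by case: (G _) e => a b /= ->.
  by rewrite -FE -ez -eG FG.
have hK (p : plane R) z : kink_link (p, z) -> -1 < z < 1.
  by rewrite kink_linkP => -[s [_ ->]]; exact: r1_height_itv.
have cK (p : plane R) z : ~ kink_link (p, z) -> \forall q \near (p, z), ~ kink_link q.
  rewrite NK => nN; have [_ cN _ _] := r1_before_presents (G (1, (p, z))).
  have cu0 : continuous (fun q : plane R * R => (G (1, q), q.2)) by cts.
  have h : \forall q \near (p, z), ~ N (G (1, q), q.2) := cu0 (p, z) _ (cN _ nN).
  by apply: filterS h => -[q w] /=; rewrite NK.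
move=> x; split; [by move=> z /hK|by move=> z; exact: cK|exact: kink_curve|].
have [Kx|nx] := pselect (exists z, kink_link (x, z)); last first.
  by apply: sheets_off => //; [move=> z; exact: cK|move=> /kink_curve].
have [z0 Kz0] := Kx.
have arc (U : set (plane R)) (f : plane R -> R) (Phi : R -> plane R) (Z : plane R -> R) :
    nbhs x U -> continuous f ->
    (forall p z, U p -> kink_link (p, z) -> p = Phi (f p) /\ z = Z p) ->
    sheets kink_link r1_after x.
  move=> Ux cf h; apply: (sheets_arc Ux cf) => [p q Up Uq|p Up z w].
    move=> /kink_curve[z /(h _ _ Up)[pE _]] /kink_curve[w /(h _ _ Uq)[qE _]] e.
    by rewrite pE e -qE.
  by move=> /(h _ _ Up)[_ ->] /(h _ _ Up)[_ ->].
have c1 : continuous (fun p : plane R => p.1) by cts.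
have c2 : continuous (fun p : plane R => p.2) by cts.
have cN1 : continuous (fun p : plane R => 2 * p.2 - p.1) by cts.
have cN2 : continuous (fun p : plane R => 2 * p.2 + p.1) by cts.
(* Below ordinate 1, above it on either side of the axis, and around the middle of the top edge, the
   kink is an arc; at ordinate 1 it has only the crossing (0, 1). *)
have [x2|x2|x2] := ltgtP x.2 1.
- have Ux : \forall p \near x, p.2 < 1.
    exact: (cat_lt (c2 x) (@cat_cst _ _ _ _) x2).
  apply: (arc _ _ (fun a => (a, Num.max 0 (1 - `|a|))) (fun p => if p.1 < 0
    then Num.min (1 / 2) ((2 - p.1) / 6) else Num.max (- (1 / 2)) (- (2 + p.1) / 6)) Ux c1).
  exact: kink_below.
- have [x1|x1|x1] := ltgtP x.1 0.
  + have Ux : \forall p \near x, p.1 < 0 /\ 1 < p.2.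
      have n1 : \forall p \near x, p.1 < 0 := cat_lt (c1 x) (@cat_cst _ _ _ _) x1.
      have n2 : \forall p \near x, 1 < p.2 := cat_lt (@cat_cst _ _ _ _) (c2 x) x2.
      exact: (@filterI _ (nbhs x) _ _ _ n1 n2).
    apply: (arc _ _ (fun v => (Num.max (2 - v) (v - 4), (v - Num.max (2 - v) (v - 4)) / 2))
      (fun p => ((2 * p.2 + p.1) - 4) / 6) Ux cN2); exact: kink_top_left.
  + have Ux : \forall p \near x, 0 < p.1 /\ 1 < p.2.
      have n1 : \forall p \near x, 0 < p.1 := cat_lt (@cat_cst _ _ _ _) (c1 x) x1.
      have n2 : \forall p \near x, 1 < p.2 := cat_lt (@cat_cst _ _ _ _) (c2 x) x2.
      exact: (@filterI _ (nbhs x) _ _ _ n1 n2).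
    apply: (arc _ _ (fun v => (Num.min (v - 2) (4 - v), (v + Num.min (v - 2) (4 - v)) / 2))
      (fun p => (4 - (2 * p.2 - p.1)) / 6) Ux cN1); exact: kink_top_right.
  + have x22 : x.2 = 2 := kink_top x1 x2 Kz0.
    have Ux : \forall p \near x, - (1 / 2) < p.1 < 1 / 2 /\ 3 / 2 < p.2 < 3.
      by apply: near_rect; rewrite ?x1 ?x22; lra.
    apply: (arc _ _ (fun a => (a, 2)) (fun p => p.1 / 6) Ux c1); exact: kink_top_mid.
have x1 : x.1 = 0 := kink_level1 x2 Kz0.
(* Near (0, 1) the kink coincides with two straight lines. Their heights are clamped to stay in
   []-1, 1[] everywhere, without change for abscissae between -1/2 and 1/2. *)
pose g (b : bool) (t : R) := if b then t + 1 else 1 - t.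
pose c (b : bool) (t : R) := clamp (- (1 / 2)) (1 / 2) (if b then (2 - t) / 6 else - (2 + t) / 6).
pose P0 : diagram (plane R) := Diagram [set p | p.2 = p.1 + 1 \/ p.2 = 1 - p.1] [set p | p.2 = p.1 + 1].
have cE b t : - (1 / 2) < t < 1 / 2 -> c b t = if b then (2 - t) / 6 else - (2 + t) / 6.
  by move=> /andP[? ?]; rewrite /c; case: b; rewrite clamp_id //; lra.
have pM : presents (multigraph g c) P0.
  apply: multigraph_presents.
  - by case; rewrite /g; cts.
  - by case; rewrite /c; cts.
  - move=> i t; have h : - (1 / 2) <= 1 / 2 :> R by lra.
    by have := clamp_itv (if i then (2 - t) / 6 else - (2 + t) / 6) h; rewrite /c; lra.
  - by move=> p; split=> [[e|e]|[[] e]]; [exists true|exists false|left|right].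
  - case=> [] [] t // _; rewrite /g => e; have -> : t = 0 by lra.
      by rewrite !cE; try lra; apply/eqP; lra.
    by rewrite !cE; try lra; apply/eqP; lra.
  case=> [] [] t; rewrite ?ltxx // => e; (have -> : t = 0 by move: e; rewrite /g; lra).
    by rewrite !cE; lra.
  move=> _; split.
  - by case=> _; [right|left].
  - exists (-1); first by right.
    by apply: (@nearW _ (nbhs (0 : R))) => s; rewrite /g; split; ring.
  - by apply: (@nearW _ (nbhs ((0 : R), g false 0))).
have Ux : \forall p \near x, - (1 / 2) < p.1 < 1 / 2 /\ 1 / 2 < p.2 < 3 / 2.
  by apply: near_rect; lra.
suff [_ _ _ //] : presents_at kink_link r1_after x.
apply: presents_local (pM x).
  apply: filterS Ux => p [/andP[p1 p1'] /andP[p2 p2']] z; split.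
    have hc := cE _ p.1; case=> -[] [/= e1 ->]; rewrite hc; try lra.
      by constructor 2; rewrite /= ler_norml; split => //; lra.
    by constructor 4; rewrite /= ler_norml; split => //; lra.
  move=> /kink_pieces [[_ e _]|[_ e _]|[[_ e ez]|[_ e _]|[_ e ez]]]; try by (exfalso; lra).
    by exists true; rewrite /= cE ?p1 //; split => //; exact: e.
  by exists false; rewrite /= cE ?p1 //; split => //; exact: e.
split; last by move=> _; apply: (@nearW _ (nbhs x)).
apply: filterS Ux => p [/andP[p1 p1'] /andP[p2 p2']] /=; split.
  by move=> e; right; rewrite ler_norml; split; [lra|case: e => ->; [left|right; right]].
case=> [[/[1!ler_normr] /orP[?|?] ?]|[_ [e|[e|e]]]]; [lra|lra|by left|lra|by right].
Qed.

Lemma r1_model : model_move r1_before r1_after (multigraph r1_line r1_height) kink_link.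
Proof.
have [F [G [FG FE]]] := kink_isotopy.
apply: (model_moveI FG _ _ r1_before_presents r1_after_presents).
- move=> [a b] z [[] [/= -> ->]]; apply/kink_linkP; exists a.
  by rewrite FE.
- move=> q z /kink_linkP[s [-> ->]]; exists (s, 0); split; first by exists tt.
  exact: FE.
move=> [a b] z nb; split.
  move=> [[] [/= b0 ->]]; constructor 1; split => //=.
  rewrite leNgt; apply/negP => a1; apply: nb; rewrite /box /= b0 normr0; split; lra.
have box_in : `|a| <= 1 -> 0 <= b <= 2 -> False.
  by move=> a1 /andP[? ?]; apply: nb; split => /=; [lra|rewrite ler_norml; lra].
case=> /= -[h e1 e2].
- by exists tt.
- by case: box_in => //; move: h; rewrite ler_norml => /andP[? ?]; lra.
- by case: box_in => //; lra.
- by case: box_in => //; move: h; rewrite ler_norml => /andP[? ?]; lra.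
Qed.

End ModelR1.

(** * Conclusion *)

Section Assembly.
Context {R : realType}.

Lemma hausdorff_setX (S S' : topologicalType) : hausdorff_space S -> hausdorff_space S' ->
  hausdorff_space (S * S')%type.
Proof.
move=> hS hS' [a r] [b s] cl; congr (_, _).
  apply: hS => A B Aa Bb.
  have h1 : nbhs (a, r) (A `*` setT) by exists (A, setT) => //; split => //; exact: filterT.
  have h2 : nbhs (b, s) (B `*` setT) by exists (B, setT) => //; split => //; exact: filterT.
  by have [[y z] [[/= ? _] [/= ? _]]] := cl _ _ h1 h2; exists y.
apply: hS' => A B Aa Bb.
have h1 : nbhs (a, r) (setT `*` A) by exists (setT, A) => //; split => //; exact: filterT.
have h2 : nbhs (b, s) (setT `*` B) by exists (setT, B) => //; split => //; exact: filterT.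
by have [[y z] [[/= _ ?] [/= _ ?]]] := cl _ _ h1 h2; exists z.
Qed.

(** By periodicity each of the finitely many components is the image of [[0, 1]], hence compact. *)
Lemma weaving_link_closed (L : lattice R) (K : set (torus L * R)) : weaving_link K ->
  closed K /\ forall q, K q -> -1 < q.2 < 1.
Proof.
move=> [n [c [[cc [cI [ch KE]]] _]]]; split; last by rewrite KE => _ [i [s ->]]; exact: ch.
have per i s : exists2 t, t \in `[0, 1] & c i s = c i t.
  exists (s - (Num.floor s)%:~R).
    rewrite in_itv /= subr_ge0 floor_le /= lerBlDl.
    by have := floorD1_gt s; rewrite intrD; lra.
  by apply/cI; split => //; exists (Num.floor s); rewrite opprB subrKC.
have -> : K = \bigcup_(i in [set: 'I_n]) (c i @` `[0, 1]).
  rewrite KE; apply/seteqP; split=> x.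
    by move=> [i [s ->]]; have [t t01 ->] := per i s; exists i => //; exists t.
  by move=> [i _ [t _ <-]]; exists i, t.
apply: closed_bigcup => [|i _]; first exact: finite_finset.
apply: compact_closed; last first.
  apply: continuous_compact; last exact: segment_compact.
  exact/continuous_subspaceT/cc.
exact: hausdorff_setX (@torus_hausdorff R L) (@norm_hausdorff R R^o).
Qed.

Lemma weaving_link_presents (L : lattice R) (K : set (torus L * R)) (D : diagram (torus L)) :
  weaving_link K -> diagram_of K D -> presents K D.
Proof. by move=> /weaving_link_closed[cK hK]; exact: diagram_of_presents. Qed.

Lemma torus_covering_local_homeo (L1 L2 : lattice R) (p : torus L2 -> torus L1) :
  (forall x, p (torus_cover L2 x) = torus_cover L1 x) -> local_homeo p.
Proof.
move=> pP.
have pE : p \o torus_cover L2 = torus_cover L1 by apply/funext => x; exact: pP.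
have [c1 o1 i1] := torus_cover_local_homeo L1.
have [c2 o2 _] := torus_cover_local_homeo L2.
split.
- by apply/quotient_continuous; rewrite -/(torus_cover L2) pE.
- move=> U oU; suff -> : p @` U = torus_cover L1 @` (torus_cover L2 @^-1` U).
    by apply: o1; move/continuousP: c2; apply.
  apply/seteqP; split=> [_ [y Uy <-]|_ [x Ux <-]]; last by exists (torus_cover L2 x).
  have [x xy] := torus_cover_surj y.
  by exists x; rewrite /= -?pP xy.
move=> y; have [x <-] := torus_cover_surj y; have [U Ux Ui] := i1 x.
move: Ux; rewrite nbhsE => -[V [oV Vx] VU]; exists (torus_cover L2 @` V).
  apply: open_nbhs_nbhs; split; last by exists x.
  exact: o2.
move=> _ _ [a Va <-] [b Vb <-]; rewrite !pP => e.
congr (torus_cover _ _); exact: Ui (VU _ Va) (VU _ Vb) e.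
Qed.

Lemma moves_realizable (L : lattice R) (D D' : diagram (torus L)) :
  related_by_moves R D D' -> realizable D D' /\ realizable D' D.
Proof.
elim=> {D D'} [D D' [m|[m|[m|[m|m]]]]|D|D D' _ []|D1 D2 D3 _ [h1 h2] _ [h3 h4]] //.
- exact: local_move_realizable r1_model m.
- exact: local_move_realizable r2_model m.
- exact: local_move_realizable r3_model m.
- exact: isotopy_realizable.
- exact: dehn_realizable.
- by split=> K pK; exists K; split => //; exact: strongly_isotopic_refl.
have comp (A B C : diagram (torus L)) : realizable A B -> realizable B C -> realizable A C.
  move=> AB BC K /AB[K' [/BC[K'' [pK'' i2]] i1]]; exists K''; split => //.
  exact: strongly_isotopic_trans i1 i2.
by split; [exact: comp h1 h3|exact: comp h4 h2].
Qed.

Lemma same_diagram_isotopic (L : lattice R) (K N : set (torus L * R)) (D : diagram (torus L)) :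
  presents K D -> presents N D -> strongly_isotopic (lift_link K) (lift_link N).
Proof.
move=> pK pN.
have [E [vE EA]] := @vertical_match R (torus L) (@torus_normal R L) (@torus_hausdorff R L)
  K N D setT setT openT (@torus_compact R L) (@subsetT _ _) (fun y _ => pK y) (fun y _ => pN y).
apply: (vertical_isotopic (@torus_cover_continuous R L) vE) => y z; exact: EA.
Qed.

End Assembly.

Theorem theorem2p4 (R : realType)
    (W1 W2 : set (plane R * R)) (Dinf1 Dinf2 : diagram (plane R))
    (hW1 : weave_with_diagram W1 Dinf1) (hW2 : weave_with_diagram W2 Dinf2)
    (L1 L2 : lattice R) (hL : sublattice L1 L2) (hne : ~ lattice_equiv L1 L2)
    (D1 : diagram (torus L1)) (D2 : diagram (torus L2))
    (hD1 : weaving_motif_of W1 Dinf1 D1) (hD2 : weaving_motif_of W2 Dinf2 D2)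
    (D1' : diagram (torus L2))
    (hi : scale_equivalent_through Dinf1 D1 D2 D1')
    (hii : related_by_moves R D1' D2) :
  weave_equiv W1 W2.
Proof.
have [[K1 [wK1 [dK1 ->]]] _] := hD1; have [[K2 [wK2 [dK2 ->]]] _] := hD2.
have [_ [_ [_ [_ [[p [pP sD]] _]]]]] := hi.
have lp := torus_covering_local_homeo pP.
have pK1 := weaving_link_presents wK1 dK1; have pK2 := weaving_link_presents wK2 dK2.
(* The required link over the larger torus is the inverse image of [K1] under the covering of tori;
   it has the same lift to the thickened plane as [K1]. *)
have pK1' : presents (pull_link p K1) D1'.
  apply: (@presents_same _ _ _ (pullback p D1)); first by move=> x; exact: agree_near_sym.
  by move=> x; apply/(presents_pull lp).
have [K' [pK' iK']] := (moves_realizable hii).1 _ pK1'.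
have <- : lift_link (pull_link p K1) = lift_link K1.
  by apply/seteqP; split=> -[x z]; rewrite /lift_link /pull_link /= pP.
apply: strongly_isotopic_weave_equiv.
exact: strongly_isotopic_trans iK' (same_diagram_isotopic pK' pK2).
Qed.
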